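(* Let $\lambda=0$. Suppose that $n$ and $m$ are integers with $1\le n\le q$ and $0\le m<n$ such that $F_i(x,y)\equiv0$ and $G_i(x,y)\equiv 0$ for all $i<n$, and such that $G_{n+m}(0,0)\ne0$ and $G_{n+l}(0,0)=0$ for all $0\le l<m$. If $G_{n+m}(0,0)>0$, then the perturbed system $$\frac{dx}{dt}=\partial_y H(x,y;\lambda)+F(x,y,t),\qquad \frac{dy}{dt}=-\partial_x H(x,y;\lambda)+G(x,y,t)$$ has two different solutions $x_\ast(t),y_\ast(t)$, one for each choice of sign $x_{n+m}=\pm\mu$, with asymptotic expansion of the form $$x_\ast(t)=\sum_{k=n+m}^{\infty}t^{-\frac{k}{2q}}x_k,\qquad y_\ast(t)=\sum_{k=2n}^{\infty}t^{-\frac{k}{2q}}y_k,\qquad t\to\infty,$$ with constant real coefficients $x_k,y_k$, where $$\mu=\sqrt{\frac{G_{n+m}(0,0)}{w(0)}}.$$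
   Context: Standing setting. The functions $H(x,y;\lambda)$, $F(x,y,t)$, $G(x,y,t)$ are smooth for all $(x,y)\in\mathbb R^2$, $t>0$, $\lambda\in\mathbb R$. The Hamiltonian of the limiting system is $H(x,y;\lambda)=\frac{y^2}{2}+V(x;\lambda)$ with $\partial_xV(x;\lambda)=(x^2-\lambda)w(x)$, where, for some $d_0>0$, $w(x)>0$ for all $(x,\lambda)\in\{|x|<\sqrt\lambda+d_0,\ \lambda\ge 0\}\cup\{|x|<d_0,\ \lambda<0\}$. The perturbations satisfy $F(x,y,t)\to0$ and $G(x,y,t)\to0$ as $t\to\infty$ for $(x,y)$ in any compact subset of $\mathbb R^2$, and have power-law asymptotics $$F(x,y,t)=\sum_{k=1}^\infty t^{-\frac kq}F_k(x,y),\qquad G(x,y,t)=\sum_{k=1}^\infty t^{-\frac kq}G_k(x,y),\qquad t\to\infty,$$ where $q$ is a positive integer and $F_k,G_k$ are smooth functions on $\mathbb R^2$. Infinite series followed by ''$t\to\infty$'' are understood as asymptotic expansions. The coefficients $x_k,y_k$ of the solutions' expansions are obtained by substituting the series into the system and equating the coefficients of equal powers of $t$. *)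

(* Defs.v *)
From Stdlib Require Import Reals.
From Coquelicot Require Import Coquelicot.
Open Scope R_scope.

(* C^k on a set D, which is assumed open: the continuity and differentiability
   conditions below are two-sided, so they see a neighbourhood of each point. *)
Fixpoint C3 (k : nat) (D : R -> R -> R -> Prop) (f : R -> R -> R -> R) : Prop :=
  (forall x y t, D x y t ->
     continuous (fun p : R * R * R => f (fst (fst p)) (snd (fst p)) (snd p))
       (x, y, t)) /\
  match k with
  | O => True
  | S k' =>
      (forall x y t, D x y t ->
         ex_derive (fun u => f u y t) x /\
         ex_derive (fun u => f x u t) y /\
         ex_derive (fun u => f x y u) t) /\
      C3 k' D (fun x y t => Derive (fun u => f u y t) x) /\
      C3 k' D (fun x y t => Derive (fun u => f x u t) y) /\
      C3 k' D (fun x y t => Derive (fun u => f x y u) t)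
  end.

Fixpoint C2 (k : nat) (f : R -> R -> R) : Prop :=
  (forall x y, continuous (fun p : R * R => f (fst p) (snd p)) (x, y)) /\
  match k with
  | O => True
  | S k' =>
      (forall x y, ex_derive (fun u => f u y) x /\ ex_derive (fun u => f x u) y) /\
      C2 k' (fun x y => Derive (fun u => f u y) x) /\
      C2 k' (fun x y => Derive (fun u => f x u) y)
  end.

Definition smooth3 (D : R -> R -> R -> Prop) (f : R -> R -> R -> R) : Prop :=
  forall k, C3 k D f.

Definition smooth2 (f : R -> R -> R) : Prop := forall k, C2 k f.

(* t^(-k/p), meaningful for t > 0. *)
Definition npow (p k : nat) (t : R) : R := Rpower t (- (INR k / INR p)).

(* The partial sum over k0 <= k <= N; it is 0 when N < k0. *)
Definition psum (p k0 : nat) (c : nat -> R) (N : nat) (t : R) : R :=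
  sum_n_m (fun k => npow p k t * c k) k0 N.

Definition expansion (p k0 : nat) (c : nat -> R) (f : R -> R) : Prop :=
  forall N : nat,
    is_domin (Rbar_locally p_infty) (npow p N) (fun t => f t - psum p k0 c N t).

(* Limits for (x, y) in a compact set are uniform there; squares [-M, M]^2
   suffice, since they exhaust the compact subsets of the plane. *)
Definition vanishes (f : R -> R -> R -> R) : Prop :=
  forall M eps, 0 < eps ->
    Rbar_locally p_infty (fun t =>
      forall x y, Rabs x <= M -> Rabs y <= M -> Rabs (f x y t) <= eps).

(* f(x,y,t) ~ sum_{k >= 1} t^(-k/q) c_k(x,y), uniformly on compact sets of (x, y).
   The term c 0 is never used. *)
Definition uniform_expansion (q : nat) (c : nat -> R -> R -> R)
    (f : R -> R -> R -> R) : Prop :=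
  forall (N : nat) M eps, 0 < eps ->
    Rbar_locally p_infty (fun t =>
      forall x y, Rabs x <= M -> Rabs y <= M ->
        Rabs (f x y t - psum q 1 (fun k => c k x y) N t) <= eps * npow q N t).

Definition field_x (H F : R -> R -> R -> R) (lam x y t : R) : R :=
  Derive (fun v => H x v lam) y + F x y t.

Definition field_y (H G : R -> R -> R -> R) (lam x y t : R) : R :=
  - Derive (fun u => H u y lam) x + G x y t.

Definition is_solution (H F G : R -> R -> R -> R) (lam t0 : R) (x y : R -> R) : Prop :=
  forall t, t0 < t ->
    is_derive x t (field_x H F lam (x t) (y t) t) /\
    is_derive y t (field_y H G lam (x t) (y t) t).

(* Substituting the series sum_{k >= kx} t^(-k/p) a_k, sum_{k >= ky} t^(-k/p) b_k
   makes the coefficients of equal powers of t agree: the terms of index > N do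
   not affect the powers t^(-k/p) with k <= N, so the agreement of these
   coefficients says that the residual of the N-th partial sums is o(t^(-N/p)). *)
Definition formal_solution (H F G : R -> R -> R -> R) (lam : R) (p kx ky : nat)
    (a b : nat -> R) : Prop :=
  forall N : nat,
    let X := psum p kx a N in
    let Y := psum p ky b N in
    is_domin (Rbar_locally p_infty) (npow p N)
      (fun t => Derive X t - field_x H F lam (X t) (Y t) t) /\
    is_domin (Rbar_locally p_infty) (npow p N)
      (fun t => Derive Y t - field_y H G lam (X t) (Y t) t).

(* Main.v *)
Require Import Defs.
From Stdlib Require Import Reals Lra Lia FunctionalExtensionality Classical_Prop IndefiniteDescription List.
From Coquelicot Require Import Coquelicot.
Open Scope R_scope.

(** Why the theorem is true. Put s = t^(-1/(2q)) and nu = n + m. Near the origin the system is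
    x' = y + F, y' = - x^2 w(x) + G, where F and G are expansions in s^2 that begin at s^(2n),
    and a time derivative costs s^(2q), that is at least s^(2n). At its lowest order s^(2 nu) the
    second equation therefore reads w(0) x_nu^2 = G_nu(0,0), which has the two roots +mu and -mu.
    Afterwards each order determines one new coefficient of y from the first equation and one of x
    from the second, the latter with the nonzero factor 2 w(0) x_nu ([formal_series]).

    It remains to find solutions with these expansions. The expansions of F and G hold uniformly
    on compact sets, but they give no control of the derivatives of the remainders, so the
    remainder is a small and not a slowly varying perturbation and contraction arguments do not
    apply. The deviation (u, v) from the N-th partial sums satisfies
    u' = al u + be v, v' = - ka u + de v up to small errors, where al, be - 1, de = O(s^(2n)) and
    ka ~ 2 w(0) x_nu s^nu ([deviation_exists]). A solution is caught topologically: in a thin tube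
    around the partial sums a differential inequality fixes the direction in which trajectories
    cross the boundary, some initial point stays inside up to any given time, and by compactness in
    the initial point some trajectory stays inside forever ([stay_forever]).

    If x_nu = mu, the linear part is a rotation. The quadratic form
    be v^2 + (al - de) u v + ka u^2 is invariant under the trace-free part of the frozen linear
    system, so along trajectories it changes only at the rate al + de of the trace and at rates
    O(1/t) ([energy_balance]). The trace is a smooth germ in s, hence is O(1/t) or has a leading
    power of s that beats 1/t. If that leading term is negative, the tube is entered forwards in
    time; otherwise trajectories leave the tube only outwards, and solutions started at the center
    at late times remain in it backwards ([oscillating_solution]).

    If x_nu = - mu, the linear part is a saddle with rates of size s^(nu/2), which dominate all
    other terms. In coordinates P = v + k u, Q = v - k u along the two eigendirections, the value
    of P at time t0 is found by shooting ([saddle_solution]).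

    A solution in one fixed thin tube has the whole expansion: the same differential inequalities
    hold for the deviation from every partial sum, and integrated from infinity
    ([decay_from_infinity]) or forwards ([decay_by_damping]) they bound that deviation by a power of
    s that grows with N. For this the rate constants must not depend on N, which is why al, be, ka
    and de are taken at one fixed order ([even_sum_freeze]). *)

(** * Powers of t and orders of smallness *)

Notation at_infty P := (Rbar_locally p_infty P).

(** The small variable s in which all expansions become polynomials. *)
Definition sv (p : nat) (t : R) : R := Rpower t (- (1 / INR p)).

Lemma sv_pos p t : 0 < sv p t.
Proof. unfold sv, Rpower. apply exp_pos. Qed.

Lemma npow_sv p k t : npow p k t = sv p t ^ k.
Proof.
  unfold npow, sv. rewrite <- (Rpower_pow k) by apply exp_pos.
  rewrite Rpower_mult. f_equal. unfold Rdiv. ring.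
Qed.

Lemma sv_pow_p p t : (0 < p)%nat -> 0 < t -> sv p t ^ p = / t.
Proof.
  intros Hp Ht. rewrite <- npow_sv. unfold npow.
  replace (INR p / INR p) with 1.
  - rewrite Rpower_Ropp, Rpower_1; auto.
  - field. apply not_0_INR. lia.
Qed.

Lemma is_derive_sv p t : (0 < p)%nat -> 0 < t ->
  is_derive (sv p) t (- / INR p * sv p t ^ (p + 1)).
Proof.
  intros Hp Ht. assert (Hp0 : INR p <> 0) by (apply not_0_INR; lia).
  unfold sv at 1, Rpower. evar_last.
  - auto_derive; [exact Ht | reflexivity].
  - rewrite pow_add, sv_pow_p by auto. unfold sv, Rpower. simpl. field. lra.
Qed.

Lemma sv_eventually_lt p e : (0 < p)%nat -> 0 < e -> at_infty (fun t => 0 < t /\ sv p t < e).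
Proof.
  intros Hp He. exists (Rmax 0 (Rpower e (- INR p))). intros t Ht.
  assert (H0 : 0 < t) by (eapply Rle_lt_trans; [apply Rmax_l | exact Ht]).
  assert (H1 : Rpower e (- INR p) < t) by (eapply Rle_lt_trans; [apply Rmax_r | exact Ht]).
  split; [exact H0|].
  apply Rnot_le_lt. intros Hle. apply (Rlt_not_le _ _ H1).
  assert (Hip : 0 < INR p) by (apply lt_0_INR; lia).
  assert (E : Rpower (sv p t) (- INR p) = t).
  { unfold sv. rewrite Rpower_mult. replace (- (1 / INR p) * - INR p) with 1 by (field; lra).
    apply Rpower_1; auto. }
  rewrite <- E. rewrite !Rpower_Ropp. apply Rinv_le_contravar.
  - unfold Rpower; apply exp_pos.
  - apply Rle_Rpower_l; [lra | split; auto].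
Qed.

Lemma sv_onto p s : (0 < p)%nat -> 0 < s -> exists t, 0 < t /\ sv p t = s.
Proof.
  intros Hp Hs. exists (Rpower s (- INR p)). split; [apply exp_pos|].
  unfold sv. rewrite Rpower_mult.
  replace (- INR p * - (1 / INR p)) with 1.
  - apply Rpower_1; auto.
  - field. apply not_0_INR; lia.
Qed.

Lemma sv_anti p t t' : (0 < p)%nat -> 0 < t -> t <= t' -> sv p t' <= sv p t.
Proof.
  intros Hp Ht Htt. unfold sv. rewrite !Rpower_Ropp. apply Rinv_le_contravar.
  - apply exp_pos.
  - apply Rle_Rpower_l; [|lra].
    assert (0 < INR p) by (apply lt_0_INR; lia).
    apply Rlt_le, Rdiv_lt_0_compat; lra.
Qed.

Lemma sv_eventually p e : (0 < p)%nat -> 0 < e -> at_infty (fun t => 1 <= t /\ 0 < sv p t < e /\ sv p t <= 1).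
Proof.
  intros Hp He. generalize (sv_eventually_lt p (Rmin e 1) Hp ltac:(apply Rmin_pos; lra)).
  intros [T HT]. exists (Rmax T 1). intros t Ht.
  assert (T < t) by (eapply Rle_lt_trans; [apply Rmax_l | exact Ht]).
  assert (1 < t) by (eapply Rle_lt_trans; [apply Rmax_r | exact Ht]).
  destruct (HT t) as [H1 H2]; auto. generalize (sv_pos p t) (Rmin_l e 1) (Rmin_r e 1). lra.
Qed.

Lemma pow_le_pow s i j : 0 <= s <= 1 -> (j <= i)%nat -> s ^ i <= s ^ j.
Proof.
  intros Hs Hij. replace i with (j + (i - j))%nat by lia. rewrite pow_add.
  rewrite <- (Rmult_1_r (s ^ j)) at 2. apply Rmult_le_compat_l; [apply pow_le; lra|].
  rewrite <- (pow1 (i - j)). apply pow_incr. lra.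
Qed.

Lemma at_infty_from (P : R -> Prop) : at_infty P -> exists t0, 1 <= t0 /\ forall t, t0 <= t -> P t.
Proof.
  intros [T HT]. exists (Rmax T 0 + 1). generalize (Rmax_l T 0) (Rmax_r T 0). intros A B.
  split; [lra|]. intros t Ht. apply HT. lra.
Qed.

(** The order at infinity of a function of t is measured in powers of s; [germO] is the same
    notion for a function of s itself, as s tends to 0 from the right. *)
Definition bigO (p j : nat) (f : R -> R) : Prop :=
  exists C, 0 <= C /\ at_infty (fun t => Rabs (f t) <= C * sv p t ^ j).

Definition germO (j : nat) (f : R -> R) : Prop :=
  exists C e, 0 <= C /\ 0 < e <= 1 /\ forall s, 0 < s < e -> Rabs (f s) <= C * s ^ j.

Lemma germO_bigO p j f : (0 < p)%nat -> germO j f -> bigO p j (fun t => f (sv p t)).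
Proof.
  intros Hp (C & e & HC & He & H). exists C. split; [exact HC|].
  generalize (sv_eventually p e Hp ltac:(lra)). apply filter_imp. intros t Ht. apply H. lra.
Qed.

Lemma bigO_germO p j f : (0 < p)%nat -> bigO p j (fun t => f (sv p t)) -> germO j f.
Proof.
  intros Hp (C & HC & [T HT]).
  set (T1 := Rmax T 1). assert (H1 : 1 <= T1) by apply Rmax_r.
  exists C, (Rmin 1 (sv p T1)). split; [exact HC|]. split.
  { split; [apply Rmin_pos; [lra|apply sv_pos] | apply Rmin_l]. }
  intros s [Hs Hse]. destruct (sv_onto p s Hp Hs) as (t & Ht & E). rewrite <- E. apply HT.
  apply Rle_lt_trans with T1; [apply Rmax_l|].
  apply Rnot_le_lt. intros Hle. generalize (sv_anti p t T1 Hp Ht Hle) (Rmin_r 1 (sv p T1)). lra.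
Qed.

Lemma bigO_ext p j f g : at_infty (fun t => f t = g t) -> bigO p j f -> bigO p j g.
Proof.
  intros E (C & HC & H). exists C; split; [exact HC|].
  generalize (filter_and _ _ E H). apply filter_imp. intros t [<- Ht]. exact Ht.
Qed.

Lemma bigO_ext' p j f g : (forall t, f t = g t) -> bigO p j f -> bigO p j g.
Proof. intros E. apply bigO_ext. exists 0. intros; apply E. Qed.

Lemma bigO_plus p j f g : bigO p j f -> bigO p j g -> bigO p j (fun t => f t + g t).
Proof.
  intros (C & HC & H) (D & HD & K). exists (C + D). split; [lra|].
  generalize (filter_and _ _ H K). apply filter_imp. intros t [A B].
  rewrite Rmult_plus_distr_r. eapply Rle_trans; [apply Rabs_triang|lra].
Qed.

Lemma bigO_opp p j f : bigO p j f -> bigO p j (fun t => - f t).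
Proof.
  intros (C & HC & H). exists C. split; [lra|]. revert H. apply filter_imp.
  intros t. rewrite Rabs_Ropp. auto.
Qed.

Lemma bigO_minus p j f g : bigO p j f -> bigO p j g -> bigO p j (fun t => f t - g t).
Proof. intros H K. apply bigO_plus; [exact H|]. apply bigO_opp, K. Qed.

Lemma bigO_scal p j c f : bigO p j f -> bigO p j (fun t => c * f t).
Proof.
  intros (C & HC & H). exists (Rabs c * C). split.
  { apply Rmult_le_pos; [apply Rabs_pos|lra]. }
  revert H. apply filter_imp. intros t Ht. rewrite Rabs_mult, Rmult_assoc.
  apply Rmult_le_compat_l; [apply Rabs_pos|exact Ht].
Qed.

Lemma bigO_mult p i j f g : bigO p i f -> bigO p j g -> bigO p (i + j) (fun t => f t * g t).
Proof.
  intros (C & HC & H) (D & HD & K). exists (C * D). split; [nra|].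
  generalize (filter_and _ _ H K). apply filter_imp. intros t [A B].
  rewrite Rabs_mult, pow_add. replace (C * D * (sv p t ^ i * sv p t ^ j)) with
   ((C * sv p t ^ i) * (D * sv p t ^ j)) by ring.
  apply Rmult_le_compat; auto using Rabs_pos.
Qed.

Lemma bigO_sv p j : bigO p j (fun t => sv p t ^ j).
Proof.
  exists 1. split; [lra|]. exists 0. intros t _.
  rewrite Rabs_pos_eq; [lra|]. apply pow_le, Rlt_le, sv_pos.
Qed.

Lemma bigO_weak p i j f : (0 < p)%nat -> (j <= i)%nat -> bigO p i f -> bigO p j f.
Proof.
  intros Hp Hij (C & HC & H). exists C. split; [exact HC|].
  generalize (filter_and _ _ (sv_eventually p 1 Hp Rlt_0_1) H). apply filter_imp.
  intros t [A B]. eapply Rle_trans; [exact B|]. apply Rmult_le_compat_l; [exact HC|].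
  apply pow_le_pow; [lra|exact Hij].
Qed.

Lemma bigO_le p j f g : bigO p j g -> at_infty (fun t => Rabs (f t) <= Rabs (g t)) -> bigO p j f.
Proof.
  intros (C & HC & H) K. exists C. split; [exact HC|].
  generalize (filter_and _ _ H K). apply filter_imp. intros t [A B]. lra.
Qed.

Lemma bigO_zero p j : bigO p j (fun _ => 0).
Proof.
  exists 0. split; [lra|]. exists 0. intros t _. rewrite Rabs_R0. lra.
Qed.

(** One power of s absorbs any constant. *)
Lemma bigO_small p j f eps : (0 < p)%nat -> 0 < eps -> bigO p (S j) f ->
  at_infty (fun t => Rabs (f t) <= eps * sv p t ^ j).
Proof.
  intros Hp He (C & HC & H).
  assert (He' : 0 < eps / (C + 1)) by (apply Rdiv_lt_0_compat; lra).
  generalize (filter_and _ _ (sv_eventually p _ Hp He') H).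
  apply filter_imp. intros t [(A1 & A2 & A3) B]. eapply Rle_trans; [exact B|].
  simpl. rewrite <- Rmult_assoc. apply Rmult_le_compat_r; [apply pow_le; lra|].
  assert (sv p t * (C + 1) <= eps / (C + 1) * (C + 1)) by (apply Rmult_le_compat_r; lra).
  replace (eps / (C + 1) * (C + 1)) with eps in H0 by (field; lra). nra.
Qed.

Lemma bigO_domin p N f : (0 < p)%nat -> bigO p (S N) f ->
  is_domin (Rbar_locally p_infty) (npow p N) f.
Proof.
  intros Hp H eps. generalize (bigO_small p N f eps Hp (cond_pos eps) H).
  apply filter_imp. intros t Ht. unfold norm; simpl. unfold abs; simpl.
  rewrite npow_sv, (Rabs_pos_eq (sv p t ^ N)); [exact Ht|]. apply pow_le, Rlt_le, sv_pos.
Qed.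

(** A form in which several estimates can be given a common constant. *)
Lemma bigO_elim p j f : bigO p j f -> exists C, 0 <= C /\ forall C', C <= C' ->
  at_infty (fun t => Rabs (f t) <= C' * sv p t ^ j).
Proof.
  intros (C & HC & H). exists C. split; [exact HC|]. intros C' HC'. revert H. apply filter_imp.
  intros t Ht. eapply Rle_trans; [exact Ht|]. apply Rmult_le_compat_r; [|exact HC'].
  apply pow_le, Rlt_le, sv_pos.
Qed.

Lemma sv_double q t : (0 < q)%nat -> sv (2 * q) t ^ 2 = sv q t.
Proof.
  intros Hq. rewrite <- npow_sv. unfold npow, sv. f_equal. f_equal. rewrite mult_INR.
  assert (0 < INR q) by (apply lt_0_INR; lia). simpl (INR 2). field. lra.
Qed.

(** * Smooth germs in the small variable *)

Lemma germO_iff j f : germO j f <-> bigO 1 j (fun t => f (sv 1 t)).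
Proof. split; [apply germO_bigO | apply bigO_germO]; lia. Qed.

Lemma germO_weak i j f : (j <= i)%nat -> germO i f -> germO j f.
Proof. rewrite !germO_iff. apply bigO_weak. lia. Qed.

Lemma germO_coef i c : germO (S i) (fun s => c * s ^ i) -> c = 0.
Proof.
  rewrite germO_iff. intros H. apply Classical_Prop.NNPP. intros Hc.
  assert (He : 0 < Rabs c / 2) by (generalize (Rabs_pos_lt c Hc); lra).
  generalize (filter_and _ _ (sv_eventually 1 1 Nat.lt_0_1 Rlt_0_1) (bigO_small 1 i _ _ Nat.lt_0_1 He H)).
  intros [T HT]. destruct (HT (T + 1)) as [A B]; [lra|].
  rewrite Rabs_mult, (Rabs_pos_eq (sv 1 (T + 1) ^ i)) in B by (apply pow_le; lra).
  assert (0 < sv 1 (T + 1) ^ i) by (apply pow_lt; lra). nra.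
Qed.

Fixpoint diffk (k : nat) (f : R -> R) : Prop :=
  match k with
  | O => True
  | S k' => (forall x, ex_derive f x) /\ diffk k' (Derive f)
  end.

Definition smooth1 (f : R -> R) : Prop := forall k, diffk k f.

Lemma diffk_weak k f : diffk (S k) f -> diffk k f.
Proof.
  revert f. induction k as [|k IH]; intros f; [intros _; exact I|].
  intros [H K]. split; [exact H|]. apply IH, K.
Qed.

Lemma diffk_const k c : diffk k (fun _ => c).
Proof.
  revert c. induction k as [|k IH]; intros c; [exact I|].
  split; [intros; apply ex_derive_const|].
  replace (Derive (fun _ => c)) with (fun _ : R => 0); [apply IH|].
  apply functional_extensionality. intros x. symmetry. apply Derive_const.
Qed.

Lemma diffk_id k : diffk k (fun x => x).
Proof.
  destruct k as [|k]; [exact I|]. split; [intros; apply ex_derive_id|].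
  replace (Derive (fun x => x)) with (fun _ : R => 1); [apply diffk_const|].
  apply functional_extensionality. intros x. symmetry. apply Derive_id.
Qed.

Lemma diffk_plus k f g : diffk k f -> diffk k g -> diffk k (fun x => f x + g x).
Proof.
  revert f g. induction k as [|k IH]; intros f g; [intros; exact I|].
  intros [H1 H2] [K1 K2]. split; [intros; apply (ex_derive_plus f g); auto|].
  replace (Derive (fun x => f x + g x)) with (fun x => Derive f x + Derive g x); [auto|].
  apply functional_extensionality. intros x. symmetry. apply Derive_plus; auto.
Qed.

Lemma diffk_mult k f g : diffk k f -> diffk k g -> diffk k (fun x => f x * g x).
Proof.
  revert f g. induction k as [|k IH]; intros f g; [intros; exact I|].
  intros H K. assert (H' := diffk_weak _ _ H). assert (K' := diffk_weak _ _ K).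
  destruct H as [H1 H2], K as [K1 K2]. split; [intros; apply ex_derive_mult; auto|].
  replace (Derive (fun x => f x * g x)) with (fun x => Derive f x * g x + f x * Derive g x).
  - apply diffk_plus; auto.
  - apply functional_extensionality. intros x. symmetry. apply Derive_mult; auto.
Qed.

Lemma smooth1_const c : smooth1 (fun _ => c). Proof. intros k; apply diffk_const. Qed.
Lemma smooth1_id : smooth1 (fun x => x). Proof. intros k; apply diffk_id. Qed.
Lemma smooth1_plus f g : smooth1 f -> smooth1 g -> smooth1 (fun x => f x + g x).
Proof. intros H K k; apply diffk_plus; auto. Qed.
Lemma smooth1_mult f g : smooth1 f -> smooth1 g -> smooth1 (fun x => f x * g x).
Proof. intros H K k; apply diffk_mult; auto. Qed.
Lemma smooth1_scal c f : smooth1 f -> smooth1 (fun x => c * f x).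
Proof. intros H. apply (smooth1_mult (fun _ => c)); [apply smooth1_const|exact H]. Qed.
Lemma smooth1_opp f : smooth1 f -> smooth1 (fun x => - f x).
Proof.
  intros H. replace (fun x => - f x) with (fun x => -1 * f x); [apply smooth1_scal, H|].
  apply functional_extensionality; intros; ring.
Qed.
Lemma smooth1_minus f g : smooth1 f -> smooth1 g -> smooth1 (fun x => f x - g x).
Proof. intros H K. apply smooth1_plus; [exact H|apply smooth1_opp, K]. Qed.
Lemma smooth1_pow j : smooth1 (fun x => x ^ j).
Proof.
  induction j as [|j IH]; [apply (smooth1_const 1)|]. apply (smooth1_mult (fun x => x)); [apply smooth1_id|exact IH].
Qed.
Lemma smooth1_sum (f : nat -> R -> R) n : (forall k, smooth1 (f k)) -> smooth1 (fun x => sum_f_R0 (fun k => f k x) n).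
Proof. intros H. induction n as [|n IH]; simpl; [apply H|]. apply smooth1_plus; auto. Qed.
Lemma smooth1_derive f : smooth1 f -> smooth1 (Derive f).
Proof. intros H k. apply (H (S k)). Qed.
Lemma smooth1_ex f x : smooth1 f -> ex_derive f x.
Proof. intros H. apply (H 1%nat). Qed.

Lemma smooth1_Derive_n f n : smooth1 f -> smooth1 (Derive_n f n).
Proof. intros H. induction n as [|n IH]; [exact H|]. apply smooth1_derive, IH. Qed.

Lemma smooth1_ex_n f n x : smooth1 f -> ex_derive_n f n x.
Proof. intros H. destruct n as [|n]; [exact I|]. apply smooth1_ex, smooth1_Derive_n, H. Qed.

Lemma smooth1_bounded f : smooth1 f -> exists C, 0 <= C /\ forall s, 0 <= s <= 1 -> Rabs (f s) <= C.
Proof.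
  intros H. destruct (continuity_ab_maj (fun s => Rabs (f s)) 0 1) as (M & HM & _); [lra| |].
  - intros c _. apply continuity_pt_filterlim.
    apply (continuous_comp f Rabs); [|apply continuous_Rabs].
    apply (ex_derive_continuous f), smooth1_ex, H.
  - exists (Rabs (f M)). split; [apply Rabs_pos|exact HM].
Qed.

Lemma sum_last (u : nat -> R) i : (forall m, (m < i)%nat -> u m = 0) -> sum_f_R0 u i = u i.
Proof.
  intros H. destruct i as [|i]; [reflexivity|]. simpl.
  rewrite (sum_eq _ (fun _ => 0)), sum_eq_R0; [ring|auto|]. intros m Hm. apply H. lia.
Qed.

(** Taylor's formula at 0; only s > 0 matters, since s is a negative power of t. *)
Lemma smooth1_taylor f j : smooth1 f ->
  germO (S j) (fun s => f s - sum_f_R0 (fun m => s ^ m / INR (Factorial.fact m) * Derive_n f m 0) j).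
Proof.
  intros H. destruct (smooth1_bounded _ (smooth1_Derive_n _ (S j) H)) as (C & HC & HB).
  exists C, 1. split; [exact HC|]. split; [lra|]. intros s Hs.
  destruct (Taylor_Lagrange f j 0 s) as (z & Hz & E); [lra| |].
  { intros; apply smooth1_ex_n, H. }
  rewrite Rminus_0_r in E. rewrite E.
  match goal with |- Rabs (?a + ?b - _) <= _ => replace (a + b - a) with b by ring end.
  rewrite Rabs_mult, (Rmult_comm C). apply Rmult_le_compat; auto using Rabs_pos.
  - assert (0 < s ^ S j) by (apply pow_lt; lra).
    assert (Hf : 1 <= INR (Factorial.fact (S j))).
    { apply (le_INR 1). apply Factorial.lt_O_fact. }
    rewrite Rabs_pos_eq by (apply Rlt_le, Rdiv_lt_0_compat; lra).
    apply Rle_div_l; [lra|]. nra.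
  - apply HB. lra.
Qed.

(** A germ of order j has no Taylor coefficients below j: the first nonzero one would be
    the leading term. *)
Lemma smooth1_germO_zero f j i : smooth1 f -> germO j f -> (i < j)%nat -> Derive_n f i 0 = 0.
Proof.
  intros H HO. induction i as [i IH] using (well_founded_induction Wf_nat.lt_wf). intros Hi.
  assert (A := smooth1_taylor f i H).
  assert (B := germO_weak j (S i) f Hi HO).
  rewrite germO_iff in A, B. assert (D := bigO_minus _ _ _ _ B A).
  assert (E : Derive_n f i 0 / INR (Factorial.fact i) = 0).
  { apply (germO_coef i). apply germO_iff. revert D. apply bigO_ext'. intros t.
    rewrite sum_last; [unfold Rdiv; ring|]. intros m Hm. rewrite IH; [ring|lia|lia]. }
  assert (F := INR_fact_neq_0 i).
  apply (f_equal (fun z => z * INR (Factorial.fact i))) in E. field_simplify in E; auto.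
Qed.

Lemma smooth1_lead f j : smooth1 f -> germO j f -> exists c, germO (S j) (fun s => f s - c * s ^ j).
Proof.
  intros H HO. exists (Derive_n f j 0 / INR (Factorial.fact j)).
  generalize (smooth1_taylor f j H). rewrite !germO_iff. apply bigO_ext'. intros t.
  rewrite sum_last; [unfold Rdiv; ring|]. intros m Hm. rewrite (smooth1_germO_zero f j m H HO Hm). ring.
Qed.

(** Orders may be differentiated, because the order of a smooth germ is visible in its Taylor
    coefficients. *)
Lemma smooth1_germO_derive f j : smooth1 f -> germO (S j) f -> germO j (Derive f).
Proof.
  intros H HO.
  assert (Z : forall i, (i < j)%nat -> Derive_n (Derive f) i 0 = 0).
  { intros i Hi. change (Derive f) with (Derive_n f 1). rewrite Derive_n_comp.
    apply (smooth1_germO_zero f (S j)); auto. lia. }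
  destruct j as [|j].
  - destruct (smooth1_bounded _ (smooth1_derive _ H)) as (C & HC & HB). exists C, 1.
    split; [exact HC|]. split; [lra|]. intros s Hs. simpl. rewrite Rmult_1_r. apply HB. lra.
  - assert (A := smooth1_taylor _ j (smooth1_derive _ H)). rewrite germO_iff in *. revert A. apply bigO_ext'.
    intros t. rewrite sum_last.
    + rewrite Z by lia. ring.
    + intros m Hm. rewrite Z by lia. ring.
Qed.

Lemma smooth1_dichotomy f p : smooth1 f ->
  germO p f \/ exists j c, (j < p)%nat /\ c <> 0 /\ germO (S j) (fun s => f s - c * s ^ j).
Proof.
  intros H. induction p as [|p [IH|(j & c & Hj & Hc & HO)]].
  - left. destruct (smooth1_bounded _ H) as (C & HC & HB). exists C, 1.
    split; [exact HC|]. split; [lra|]. intros s Hs. simpl. rewrite Rmult_1_r. apply HB. lra.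
  - destruct (smooth1_lead f p H IH) as (c & Hc). destruct (Req_dec c 0) as [->|Hn].
    + left. rewrite germO_iff in *. revert Hc. apply bigO_ext'. intros t. ring.
    + right. exists p, c. auto.
  - right. exists j, c. repeat split; auto.
Qed.

(** * Smooth functions of several variables *)

Lemma Rabs_ball (x y e : R) : Rabs (x - y) < e -> ball y e x.
Proof. intros H. exact H. Qed.

(** Each point has a neighbourhood on which f exceeds its value by at most 1; finitely many of
    these cover the box. *)
Lemma bounded3 (f : R -> R -> R -> R) a1 b1 a2 b2 a3 b3 :
  (forall x y t, a1 <= x <= b1 -> a2 <= y <= b2 -> a3 <= t <= b3 ->
     continuous (fun p : R * R * R => f (fst (fst p)) (snd (fst p)) (snd p)) (x, y, t)) ->
  exists C, 0 <= C /\ forall x y t, a1 <= x <= b1 -> a2 <= y <= b2 -> a3 <= t <= b3 ->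
    Rabs (f x y t) <= C.
Proof.
  intros Hc.
  set (F := fun v : Compactness.Tn 3 R => f (fst v) (fst (snd v)) (fst (snd (snd v)))).
  set (lo := (a1, (a2, (a3, tt))) : Compactness.Tn 3 R).
  set (hi := (b1, (b2, (b3, tt))) : Compactness.Tn 3 R).
  assert (H : forall v : Compactness.Tn 3 R, exists d : posreal,
     bounded_n 3 lo hi v -> forall v', close_n 3 d v' v -> Rabs (F v') <= Rabs (F v) + 1).
  { intros (x & y & t & []). unfold F; simpl.
    destruct (classic (a1 <= x <= b1 /\ a2 <= y <= b2 /\ a3 <= t <= b3)) as [(A & B & D)|N].
    - specialize (Hc x y t A B D).
      apply filterlim_locally with (eps := mkposreal 1 Rlt_0_1) in Hc.
      destruct Hc as [d Hd]. exists d. intros _ (x' & y' & t' & []) (X & Y & T & _).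
      specialize (Hd (x', y', t')). simpl in Hd.
      assert (K : ball (f x y t) 1 (f x' y' t')).
      { apply Hd. repeat split; simpl; apply Rabs_ball; assumption. }
      change (Rabs (f x' y' t' - f x y t) < 1) in K.
      simpl. generalize (Rabs_triang_inv (f x' y' t') (f x y t)). lra.
    - exists (mkposreal 1 Rlt_0_1). intros (A & B & D & _). elim N; auto. }
  destruct (functional_choice _ H) as [delta Hd].
  destruct (NNPP _ (compactness_list 3 lo hi delta)) as [l Hl].
  assert (HM : exists M, 0 <= M /\ forall v, In v l -> Rabs (F v) <= M).
  { clear Hl. induction l as [|v l (M & HM0 & HM)].
    - exists 0. split; [lra|]. intros v [].
    - exists (Rmax M (Rabs (F v))). split; [eapply Rle_trans; [exact HM0|apply Rmax_l]|].
      intros v' [<-|Hv]; [apply Rmax_r|]. eapply Rle_trans; [apply HM, Hv|apply Rmax_l]. }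
  destruct HM as (M & HM0 & HM). exists (M + 1). split; [lra|].
  intros x y t A B D.
  destruct (Hl (x, (y, (t, tt)))) as (v & V1 & V2 & V3); [simpl; auto|].
  specialize (Hd v V2 _ V3). specialize (HM v V1). unfold F in Hd at 1; simpl in Hd. lra.
Qed.

Lemma Rabs_le_1 x : Rabs x <= 1 -> -1 <= x <= 1.
Proof. intros H. apply Rabs_le_between in H. lra. Qed.

Lemma lip1 (f : R -> R) C : (forall x, Rabs x <= 1 -> ex_derive f x /\ Rabs (Derive f x) <= C) ->
  forall x y, Rabs x <= 1 -> Rabs y <= 1 -> Rabs (f x - f y) <= C * Rabs (x - y).
Proof.
  intros H x y Hx Hy. apply Rabs_le_1 in Hx, Hy.
  assert (Hm : forall z, Rmin y x <= z <= Rmax y x -> Rabs z <= 1).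
  { intros z Hz. apply Rabs_le_between.
    assert (-1 <= Rmin y x) by (apply Rmin_glb; lra).
    assert (Rmax y x <= 1) by (apply Rmax_lub; lra). lra. }
  destruct (MVT_gen f y x (Derive f)) as (c & Hc & E).
  - intros z Hz. apply Derive_correct, H, Hm. lra.
  - intros z Hz. apply continuity_pt_filterlim. apply (ex_derive_continuous f), H, Hm. lra.
  - rewrite E, Rabs_mult. apply Rmult_le_compat_r; [apply Rabs_pos|]. apply H, Hm. lra.
Qed.

Notation dX g := (fun x y => Derive (fun u => g u y) x).
Notation dY g := (fun x y => Derive (fun u => g x u) y).

Lemma C2_bounded g : C2 0 g ->
  exists C, 0 <= C /\ forall x y, Rabs x <= 1 -> Rabs y <= 1 -> Rabs (g x y) <= C.
Proof.
  intros [H _].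
  destruct (bounded3 (fun x y _ => g x y) (-1) 1 (-1) 1 0 0) as (C & HC & HB).
  - intros x y t _ _ _.
    apply (continuous_comp (fun p : R * R * R => fst p) (fun p : R * R => g (fst p) (snd p))).
    + apply continuous_fst.
    + apply H.
  - exists C. split; [exact HC|]. intros x y Hx Hy. apply (HB x y 0).
    + apply Rabs_le_1, Hx. + apply Rabs_le_1, Hy. + lra.
Qed.

Lemma C2_lip g : C2 1 g -> exists C, 0 <= C /\ forall x y x' y',
  Rabs x <= 1 -> Rabs y <= 1 -> Rabs x' <= 1 -> Rabs y' <= 1 ->
  Rabs (g x y - g x' y') <= C * (Rabs (x - x') + Rabs (y - y')).
Proof.
  intros (_ & HD & HX & HY).
  destruct (C2_bounded _ HX) as (A & HA & HAB), (C2_bounded _ HY) as (B & HB & HBB).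
  exists (A + B). split; [lra|]. intros x y x' y' Hx Hy Hx' Hy'.
  assert (E1 : Rabs (g x y - g x' y) <= A * Rabs (x - x')).
  { apply (lip1 (fun u => g u y)); auto. intros z Hz. split; [apply (HD z y)|]. apply (HAB z y); auto. }
  assert (E2 : Rabs (g x' y - g x' y') <= B * Rabs (y - y')).
  { apply (lip1 (fun u => g x' u)); auto. intros z Hz. split; [apply (HD x' z)|]. apply (HBB x' z); auto. }
  replace (g x y - g x' y') with ((g x y - g x' y) + (g x' y - g x' y')) by ring.
  eapply Rle_trans; [apply Rabs_triang|].
  generalize (Rabs_pos (x - x')) (Rabs_pos (y - y')). nra.
Qed.

Lemma between_abs x u c : Rabs x <= 1 -> Rabs (x + u) <= 1 ->
  Rmin x (x + u) <= c <= Rmax x (x + u) -> Rabs c <= 1.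
Proof.
  intros Hx Hu Hc. apply Rabs_le_1 in Hx, Hu. apply Rabs_le_between.
  unfold Rmin, Rmax in Hc. destruct (Rle_dec x (x + u)); lra.
Qed.

Lemma mvt_box (f : R -> R) x u : (forall z, ex_derive f z) -> Rabs x <= 1 -> Rabs (x + u) <= 1 ->
  exists c, f (x + u) - f x = Derive f c * u /\ Rabs (c - x) <= Rabs u /\ Rabs c <= 1.
Proof.
  intros H Hx Hu. destruct (MVT_gen f x (x + u) (Derive f)) as (c & Hc & E).
  - intros; apply Derive_correct, H.
  - intros z _. apply continuity_pt_filterlim, (ex_derive_continuous f), H.
  - exists c. split; [rewrite E; ring|]. split; [|apply (between_abs x u); auto].
    unfold Rmin, Rmax in Hc. destruct (Rle_dec x (x + u)).
    + rewrite (Rabs_pos_eq u), Rabs_pos_eq; lra.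
    + rewrite (Rabs_left u), Rabs_left1; lra.
Qed.

(** The increment is taken along the two sides of a rectangle, so that the mean value theorem
    in one variable and the Lipschitz bounds of the partial derivatives suffice. *)
Lemma C2_quad g : C2 2 g -> exists C, 0 <= C /\ forall x y u v,
  Rabs x <= 1 -> Rabs y <= 1 -> Rabs (x + u) <= 1 -> Rabs (y + v) <= 1 ->
  Rabs (g (x + u) (y + v) - g x y - (dX g x y * u + dY g x y * v)) <= C * (u ^ 2 + v ^ 2).
Proof.
  intros (_ & HD & HX & HY).
  destruct (C2_lip _ HX) as (A & HA & HAB), (C2_lip _ HY) as (B & HB & HBB).
  exists (2 * A + 2 * B). split; [lra|]. intros x y u v Hx Hy Hu Hv.
  destruct (mvt_box (fun z => g z (y + v)) x u) as (c & E1 & Hc & Hc1); auto.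
  { intros z; apply (HD z (y + v)). }
  destruct (mvt_box (fun z => g x z) y v) as (d & E2 & Hd & Hd1); auto.
  { intros z; apply (HD x z). }
  assert (K1 := HAB c (y + v) x y Hc1 Hv Hx Hy).
  assert (K2 := HBB x d x y Hx Hd1 Hx Hy).
  rewrite Rminus_diag, Rabs_R0 in K2. replace (y + v - y) with v in K1 by ring.
  cbv beta in *.
  set (gc := Derive (fun u0 => g u0 (y + v)) c) in *.
  set (gx := Derive (fun u0 => g u0 y) x) in *.
  set (gd := Derive (fun u0 => g x u0) d) in *.
  set (gy := Derive (fun u0 => g x u0) y) in *.
  replace (g (x + u) (y + v) - g x y - (gx * u + gy * v)) with ((gc - gx) * u + (gd - gy) * v) by lra.
  eapply Rle_trans; [apply Rabs_triang|]. rewrite !Rabs_mult.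
  rewrite <- (pow2_abs u), <- (pow2_abs v).
  generalize (Rabs_pos u) (Rabs_pos v). set (U := Rabs u) in *. set (W := Rabs v) in *. intros U0 W0.
  assert (Rabs (gc - gx) <= A * (U + W)).
  { eapply Rle_trans; [exact K1|]. apply Rmult_le_compat_l; lra. }
  assert (Rabs (gd - gy) <= B * W).
  { eapply Rle_trans; [exact K2|]. apply Rmult_le_compat_l; lra. }
  apply Rle_trans with (A * (U + W) * U + B * W * W).
  - apply Rplus_le_compat; apply Rmult_le_compat_r; auto.
  - assert (0 <= A * (U - W) ^ 2) by (apply Rmult_le_pos; [lra|apply pow2_ge_0]).
    assert (0 <= A * U ^ 2) by (apply Rmult_le_pos; [lra|apply pow2_ge_0]).
    assert (0 <= A * W ^ 2) by (apply Rmult_le_pos; [lra|apply pow2_ge_0]).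
    assert (0 <= B * U ^ 2) by (apply Rmult_le_pos; [lra|apply pow2_ge_0]).
    assert (0 <= B * W ^ 2) by (apply Rmult_le_pos; [lra|apply pow2_ge_0]). lra.
Qed.

Lemma C2_chain g P Q s : C2 1 g -> ex_derive P s -> ex_derive Q s ->
  is_derive (fun s => g (P s) (Q s)) s (dX g (P s) (Q s) * Derive P s + dY g (P s) (Q s) * Derive Q s).
Proof.
  intros (_ & HD & HX & HY) HP HQ.
  apply is_derive_Reals. apply derivable_pt_lim_comp_2d.
  - apply filterdiff_differentiable_pt_lim.
    apply (is_derive_filterdiff g (P s) (Q s) (fun x y => Derive (fun u => g u y) x)).
    + apply filter_forall. intros [x y]. apply (Derive_correct (fun z => g z y)), (HD x y).
    + apply (Derive_correct (fun z => g (P s) z)), (HD (P s) (Q s)).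
    + apply HX.
  - apply is_derive_Reals, Derive_correct, HP.
  - apply is_derive_Reals, Derive_correct, HQ.
Qed.

(** By induction on the order, through the chain rule: the derivative is again built from
    compositions of smooth functions with P and Q. *)
Lemma smooth1_comp2 g P Q : smooth2 g -> smooth1 P -> smooth1 Q -> smooth1 (fun s => g (P s) (Q s)).
Proof.
  intros Hg HP HQ k. revert g Hg. induction k as [|k IH]; intros g Hg; [exact I|].
  assert (HC : forall s, is_derive (fun s => g (P s) (Q s)) s
    (dX g (P s) (Q s) * Derive P s + dY g (P s) (Q s) * Derive Q s)).
  { intros s. apply C2_chain; [apply Hg|apply smooth1_ex, HP|apply smooth1_ex, HQ]. }
  split; [intros s; eexists; apply HC|].
  replace (Derive (fun s => g (P s) (Q s))) with
    (fun s => dX g (P s) (Q s) * Derive P s + dY g (P s) (Q s) * Derive Q s).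
  - apply diffk_plus; apply diffk_mult.
    + apply (IH (dX g)). intros j. apply (Hg (S j)).
    + apply (HP (S k)).
    + apply (IH (dY g)). intros j. apply (Hg (S j)).
    + apply (HQ (S k)).
  - apply functional_extensionality. intros s. symmetry. apply is_derive_unique, HC.
Qed.

Lemma smooth2_dX g : smooth2 g -> smooth2 (dX g).
Proof. intros H k. apply (H (S k)). Qed.
Lemma smooth2_dY g : smooth2 g -> smooth2 (dY g).
Proof. intros H k. apply (H (S k)). Qed.

(** The constant may depend on the time interval; this is all that the smoothness of F and G
    gives, and it is only used to solve initial value problems. *)
Definition square_lipschitz (f : R -> R -> R -> R) : Prop :=
  forall T0 T1, 0 < T0 -> exists C, 0 <= C /\ forall t x y x' y', T0 <= t <= T1 ->
    Rabs x <= 1 -> Rabs y <= 1 -> Rabs x' <= 1 -> Rabs y' <= 1 ->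
    Rabs (f x y t - f x' y' t) <= C * (Rabs (x - x') + Rabs (y - y')).

Definition curve_continuous (f : R -> R -> R -> R) : Prop :=
  forall (x y tau : R -> R) t, continuous x t -> continuous y t -> continuous tau t ->
    0 < tau t -> continuous (fun t => f (x t) (y t) (tau t)) t.

Lemma C3_lip f : C3 1 (fun _ _ t => 0 < t) f -> square_lipschitz f.
Proof.
  intros (_ & HD & [HX _] & [HY _] & _) T0 T1 HT.
  destruct (bounded3 (fun x y t => Derive (fun u => f u y t) x) (-1) 1 (-1) 1 T0 T1 (fun x y t _ _ Ht => HX x y t (Rlt_le_trans _ _ _ HT (proj1 Ht))))
    as (A & HA & HAB).
  destruct (bounded3 (fun x y t => Derive (fun u => f x u t) y) (-1) 1 (-1) 1 T0 T1 (fun x y t _ _ Ht => HY x y t (Rlt_le_trans _ _ _ HT (proj1 Ht))))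
    as (B & HB & HBB).
  exists (A + B). split; [lra|]. intros t x y x' y' Ht Hx Hy Hx' Hy'.
  assert (Ht0 : 0 < t) by lra.
  assert (E1 : Rabs (f x y t - f x' y t) <= A * Rabs (x - x')).
  { apply (lip1 (fun u => f u y t)); auto. intros z Hz. split; [apply (HD z y t Ht0)|].
    apply (HAB z y t); auto using Rabs_le_1. }
  assert (E2 : Rabs (f x' y t - f x' y' t) <= B * Rabs (y - y')).
  { apply (lip1 (fun u => f x' u t)); auto. intros z Hz. split; [apply (HD x' z t Ht0)|].
    apply (HBB x' z t); auto using Rabs_le_1. }
  replace (f x y t - f x' y' t) with ((f x y t - f x' y t) + (f x' y t - f x' y' t)) by ring.
  eapply Rle_trans; [apply Rabs_triang|].
  generalize (Rabs_pos (x - x')) (Rabs_pos (y - y')). nra.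
Qed.

Lemma continuous_pair {U V W : UniformSpace} (f : U -> V) (g : U -> W) x :
  continuous f x -> continuous g x -> continuous (fun u => (f u, g u)) x.
Proof.
  intros Hf Hg. apply filterlim_locally. intros eps.
  generalize (filter_and _ _ (proj1 (filterlim_locally _ _) Hf eps) (proj1 (filterlim_locally _ _) Hg eps)).
  apply filter_imp. intros y [A B]. split; assumption.
Qed.

Lemma C3_cont f : C3 0 (fun _ _ t => 0 < t) f -> curve_continuous f.
Proof.
  intros [H _] x y tau t Hx Hy Ht H0.
  apply (continuous_comp (fun t => (x t, y t, tau t))
    (fun p : R * R * R => f (fst (fst p)) (snd (fst p)) (snd p))).
  - apply (continuous_pair (fun t => (x t, y t)) tau); auto. apply continuous_pair; auto.
  - apply (H (x t) (y t) (tau t) H0).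
Qed.

Lemma C3_slice k f t0 : C3 k (fun _ _ _ => True) f -> C2 k (fun x y => f x y t0).
Proof.
  revert f. induction k as [|k IH]; intros f [Hc Hd].
  - split; [|exact I]. intros x y.
    apply (continuous_comp (fun z : R * R => (fst z, snd z, t0)) (fun q : R * R * R => f (fst (fst q)) (snd (fst q)) (snd q))).
    + apply (continuous_pair (fun z : R * R => (fst z, snd z)) (fun _ => t0)); [|apply continuous_const].
      apply continuous_pair; [apply continuous_fst|apply continuous_snd].
    + apply (Hc x y t0 I).
  - destruct Hd as (HD & HX & HY & HT). split.
    + intros x y.
      apply (continuous_comp (fun z : R * R => (fst z, snd z, t0)) (fun q : R * R * R => f (fst (fst q)) (snd (fst q)) (snd q))).
      * apply (continuous_pair (fun z : R * R => (fst z, snd z)) (fun _ => t0)); [|apply continuous_const].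
        apply continuous_pair; [apply continuous_fst|apply continuous_snd].
      * apply (Hc x y t0 I).
    + split; [intros x y; destruct (HD x y t0 I) as (A & B & _); split; assumption|].
      split; [apply (IH _ HX)|apply (IH _ HY)].
Qed.

Lemma C2_opp k f : C2 k f -> C2 k (fun x y => - f x y).
Proof.
  revert f. induction k as [|k IH]; intros f [Hc Hd].
  - split; [|exact I]. intros x y. apply (continuous_opp (fun z : R * R => f (fst z) (snd z))), Hc.
  - destruct Hd as (HD & HX & HY). split.
    + intros x y. apply (continuous_opp (fun z : R * R => f (fst z) (snd z))), Hc.
    + split; [intros x y; destruct (HD x y) as [A B]; split; [apply (ex_derive_opp (fun u => f u y))|apply (ex_derive_opp (fun u => f x u))]; assumption|].
      split.
      * replace (fun x y => Derive (fun u => - f u y) x) with (fun x y => - Derive (fun u => f u y) x); [apply IH, HX|].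
        apply functional_extensionality; intros x. apply functional_extensionality; intros y. symmetry. apply (Derive_opp (fun u => f u y)).
      * replace (fun x y => Derive (fun u => - f x u) y) with (fun x y => - Derive (fun u => f x u) y); [apply IH, HY|].
        apply functional_extensionality; intros x. apply functional_extensionality; intros y. symmetry. apply (Derive_opp (fun u => f x u)).
Qed.

Lemma C2_const k c : C2 k (fun _ _ => c).
Proof.
  revert c. induction k as [|k IH]; intros c; (split; [intros x y; apply continuous_const|]); [exact I|].
  split; [intros x y; split; apply ex_derive_const|].
  split.
  - replace (fun x y : R => Derive (fun _ => c) x) with (fun _ _ : R => 0); [apply IH|].
    apply functional_extensionality; intros x. apply functional_extensionality; intros y. symmetry. apply Derive_const.
  - replace (fun x y : R => Derive (fun _ => c) y) with (fun _ _ : R => 0); [apply IH|].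
    apply functional_extensionality; intros x. apply functional_extensionality; intros y. symmetry. apply Derive_const.
Qed.

Lemma C2_snd k : C2 k (fun _ y => y).
Proof.
  destruct k as [|k]; (split; [intros x y; apply continuous_snd|]); [exact I|].
  split; [intros x y; split; [apply ex_derive_const|apply ex_derive_id]|].
  split.
  - replace (fun x y : R => Derive (fun _ => y) x) with (fun _ _ : R => 0); [apply C2_const|].
    apply functional_extensionality; intros x. apply functional_extensionality; intros y. symmetry. apply Derive_const.
  - replace (fun x y : R => Derive (fun u => u) y) with (fun _ _ : R => 1); [apply C2_const|].
    apply functional_extensionality; intros x. apply functional_extensionality; intros y. symmetry. apply Derive_id.
Qed.

(** * Expansions in even powers of the small variable *)

(** The index k counts powers t^(-k/q) = s^(2k). *)
Definition even_sum (c : nat -> R -> R -> R) (J : nat) (s x y : R) : R :=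
  sum_f_R0 (fun k => s ^ (2 * k) * c k x y) J.

Lemma even_sum_S c J s x y : even_sum c (S J) s x y = even_sum c J s x y + s ^ (2 * S J) * c (S J) x y.
Proof. reflexivity. Qed.

Lemma even_sum_0 c s x y : even_sum c 0 s x y = c 0%nat x y.
Proof. unfold even_sum; simpl. ring. Qed.

Lemma even_sum_gap c j s x y : (forall k, (1 <= k <= j)%nat -> c k x y = 0) -> even_sum c j s x y = c 0%nat x y.
Proof.
  induction j as [|j IH]; intros H; [apply even_sum_0|]. rewrite even_sum_S, IH.
  - rewrite (H (S j)) by lia. ring.
  - intros k Hk. apply H. lia.
Qed.

Definition gap (c : nat -> R -> R -> R) (n : nat) : Prop :=
  forall k, (1 <= k < n)%nat -> forall x y, c k x y = 0.

Lemma even_sum_tail c J J' : (forall k, smooth2 (c k)) -> (J <= J')%nat -> exists C, 0 <= C /\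
  forall s x y, 0 <= s <= 1 -> Rabs x <= 1 -> Rabs y <= 1 ->
  Rabs (even_sum c J' s x y - even_sum c J s x y) <= C * s ^ (2 * J + 2).
Proof.
  intros Hc HJ. induction HJ as [|J' HJ (C & HC & H)].
  - exists 0. split; [lra|]. intros. rewrite Rminus_diag, Rabs_R0. lra.
  - destruct (C2_bounded (c (S J')) (Hc _ 0%nat)) as (D & HD & K).
    exists (C + D). split; [lra|]. intros s x y Hs Hx Hy.
    specialize (H s x y Hs Hx Hy). specialize (K x y Hx Hy).
    rewrite even_sum_S. replace (even_sum c J' s x y + s ^ (2 * S J') * c (S J') x y - even_sum c J s x y) with
      ((even_sum c J' s x y - even_sum c J s x y) + s ^ (2 * S J') * c (S J') x y) by ring.
    eapply Rle_trans; [apply Rabs_triang|].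
    assert (P1 : 0 <= s ^ (2 * S J')) by (apply pow_le; lra).
    assert (P2 := pow_le_pow s (2 * S J') (2 * J + 2) Hs ltac:(lia)).
    rewrite Rabs_mult, (Rabs_pos_eq _ P1).
    assert (s ^ (2 * S J') * Rabs (c (S J') x y) <= s ^ (2 * J + 2) * D).
    { apply Rmult_le_compat; auto using Rabs_pos. }
    lra.
Qed.

Lemma even_sum_lead c n J : (forall k, smooth2 (c k)) -> gap c n -> (1 <= n)%nat -> exists C, 0 <= C /\
  forall s x y, 0 <= s <= 1 -> Rabs x <= 1 -> Rabs y <= 1 ->
  Rabs (even_sum c J s x y - c 0%nat x y) <= C * s ^ (2 * n).
Proof.
  intros Hc Hg Hn. destruct (Nat.le_gt_cases J (n - 1)) as [HJ|HJ].
  - exists 0. split; [lra|]. intros. rewrite even_sum_gap.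
    + rewrite Rminus_diag, Rabs_R0. lra.
    + intros k Hk. apply Hg. lia.
  - destruct (even_sum_tail c (n - 1) J Hc ltac:(lia)) as (C & HC & H). exists C. split; [exact HC|].
    intros s x y Hs Hx Hy. specialize (H s x y Hs Hx Hy). rewrite (even_sum_gap c (n - 1)) in H.
    + replace (2 * n)%nat with (2 * (n - 1) + 2)%nat by lia. exact H.
    + intros k Hk. apply Hg. lia.
Qed.

(** Apart from the term k = 0 the sum starts at s^(2n), so it also moves by s^(2n) times the
    displacement. *)
Lemma even_sum_lip_gap c n J : (forall k, smooth2 (c k)) -> gap c n -> exists C, 0 <= C /\
  forall s x y x' y', 0 <= s <= 1 -> Rabs x <= 1 -> Rabs y <= 1 -> Rabs x' <= 1 -> Rabs y' <= 1 ->
  Rabs ((even_sum c J s x y - c 0%nat x y) - (even_sum c J s x' y' - c 0%nat x' y')) <=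
    C * s ^ (2 * n) * (Rabs (x - x') + Rabs (y - y')).
Proof.
  intros Hc Hg. induction J as [|J (C & HC & H)].
  - exists 0. split; [lra|]. intros. rewrite !even_sum_0, !Rminus_diag, Rabs_R0. lra.
  - destruct (C2_lip (c (S J)) (Hc _ 1%nat)) as (D & HD & K).
    exists (C + D). split; [lra|]. intros s x y x' y' Hs Hx Hy Hx' Hy'.
    specialize (H s x y x' y' Hs Hx Hy Hx' Hy'). specialize (K x y x' y' Hx Hy Hx' Hy').
    rewrite !even_sum_S.
    match goal with |- Rabs ?A <= _ => replace A with
      ((even_sum c J s x y - c 0%nat x y) - (even_sum c J s x' y' - c 0%nat x' y') +
       s ^ (2 * S J) * (c (S J) x y - c (S J) x' y')) by ring end.
    eapply Rle_trans; [apply Rabs_triang|].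
    assert (Q : 0 <= Rabs (x - x') + Rabs (y - y')) by (generalize (Rabs_pos (x - x')) (Rabs_pos (y - y')); lra).
    assert (P1 : 0 <= s ^ (2 * S J)) by (apply pow_le; lra).
    assert (P3 : 0 <= s ^ (2 * n)) by (apply pow_le; lra).
    rewrite Rabs_mult, (Rabs_pos_eq _ P1).
    assert (s ^ (2 * S J) * Rabs (c (S J) x y - c (S J) x' y') <=
       s ^ (2 * n) * (D * (Rabs (x - x') + Rabs (y - y')))); [|lra].
    destruct (Nat.lt_ge_cases (S J) n) as [Hlt|Hge].
    + rewrite !Hg, Rminus_diag, Rabs_R0 by lia. rewrite Rmult_0_r.
      apply Rmult_le_pos; [exact P3|]. apply Rmult_le_pos; lra.
    + apply Rmult_le_compat; auto using Rabs_pos. apply pow_le_pow; [lra|lia].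
Qed.

Lemma even_sum_quad c J : (forall k, smooth2 (c k)) -> exists C, 0 <= C /\
  forall s x y u v, 0 <= s <= 1 -> Rabs x <= 1 -> Rabs y <= 1 -> Rabs (x + u) <= 1 -> Rabs (y + v) <= 1 ->
  Rabs (even_sum c J s (x + u) (y + v) - even_sum c J s x y -
    (even_sum (fun k => dX (c k)) J s x y * u + even_sum (fun k => dY (c k)) J s x y * v)) <= C * (u ^ 2 + v ^ 2).
Proof.
  intros Hc. induction J as [|J (C & HC & H)].
  - destruct (C2_quad (c 0%nat) (Hc _ 2%nat)) as (D & HD & K). exists D. split; [exact HD|].
    intros. rewrite !even_sum_0. apply K; auto.
  - destruct (C2_quad (c (S J)) (Hc _ 2%nat)) as (D & HD & K).
    exists (C + D). split; [lra|]. intros s x y u v Hs Hx Hy Hu Hv.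
    specialize (H s x y u v Hs Hx Hy Hu Hv). specialize (K x y u v Hx Hy Hu Hv).
    rewrite !even_sum_S. cbv beta in *.
    set (gx := Derive (fun u0 => c (S J) u0 y) x) in *.
    set (gy := Derive (fun u0 => c (S J) x u0) y) in *.
    match type of H with Rabs ?A <= _ => match type of K with Rabs ?B <= _ =>
      match goal with |- Rabs ?G <= _ => replace G with (A + s ^ (2 * S J) * B) by ring end end end.
    eapply Rle_trans; [apply Rabs_triang|].
    assert (P1 : 0 <= s ^ (2 * S J)) by (apply pow_le; lra).
    assert (P2 : s ^ (2 * S J) <= 1).
    { rewrite <- (pow_O s). apply pow_le_pow; [lra|lia]. }
    rewrite Rabs_mult, (Rabs_pos_eq _ P1), Rmult_plus_distr_r. apply Rplus_le_compat; [exact H|].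
    eapply Rle_trans; [|exact K]. rewrite <- (Rmult_1_l (Rabs _)) at 2.
    apply Rmult_le_compat_r; [apply Rabs_pos|exact P2].
Qed.

Lemma even_sum_smooth c J P Q : (forall k, smooth2 (c k)) -> smooth1 P -> smooth1 Q -> smooth1 (fun s => even_sum c J s (P s) (Q s)).
Proof.
  intros Hc HP HQ. unfold even_sum. apply (smooth1_sum (fun k s => s ^ (2 * k) * c k (P s) (Q s))).
  intros k. apply (smooth1_mult (fun s => s ^ (2 * k))); [apply smooth1_pow|]. apply smooth1_comp2; auto.
Qed.

(** Partial sums as polynomials in s. The lower summation index is encoded in the vanishing of
    the first coefficients, see [spoly_psum]. *)
Definition spoly (a : nat -> R) (N : nat) (s : R) : R := sum_f_R0 (fun k => a k * s ^ k) N.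

Lemma spoly_S a N s : spoly a (S N) s = spoly a N s + a (S N) * s ^ S N.
Proof. reflexivity. Qed.

Lemma spoly_smooth a N : smooth1 (spoly a N).
Proof.
  unfold spoly. apply (smooth1_sum (fun k s => a k * s ^ k)). intros k. apply smooth1_scal, smooth1_pow.
Qed.

Lemma spoly_ext a b N s : (forall k, (k <= N)%nat -> a k = b k) -> spoly a N s = spoly b N s.
Proof. intros H. apply sum_eq. intros k Hk. rewrite H; auto. Qed.

Lemma spoly_tail p a N N' : (0 < p)%nat -> (N <= N')%nat ->
  bigO p (S N) (fun t => spoly a N' (sv p t) - spoly a N (sv p t)).
Proof.
  intros Hp H. induction H as [|N' H IH].
  - apply (bigO_ext' p (S N) (fun _ => 0)); [intros; ring|apply bigO_zero].
  - apply (bigO_ext' p (S N) (fun t => (spoly a N' (sv p t) - spoly a N (sv p t)) + a (S N') * sv p t ^ S N')).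
    { intros t. rewrite spoly_S. ring. }
    apply bigO_plus; [exact IH|]. apply (bigO_weak p (S N')); [exact Hp|lia|].
    apply bigO_scal, bigO_sv.
Qed.

Lemma spoly_head p a N k0 : (0 < p)%nat -> (forall k, (k < k0)%nat -> a k = 0) ->
  bigO p k0 (fun t => spoly a N (sv p t)).
Proof.
  intros Hp H. induction N as [|N IH]; unfold spoly; simpl sum_f_R0.
  - destruct k0 as [|k0].
    + apply bigO_scal. apply (bigO_sv p 0).
    + rewrite (H 0%nat) by lia. apply (bigO_ext' p (S k0) (fun _ => 0)); [intros; ring|apply bigO_zero].
  - apply bigO_plus; [exact IH|]. destruct (Nat.lt_ge_cases (S N) k0) as [Hlt|Hge].
    + rewrite (H (S N)) by lia. apply (bigO_ext' p k0 (fun _ => 0)); [intros; ring|apply bigO_zero].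
    + apply (bigO_weak p (S N)); [exact Hp|lia|]. apply (bigO_scal p (S N)), bigO_sv.
Qed.

Lemma spoly_low a N s : (forall k, (k <= N)%nat -> a k = 0) -> spoly a N s = 0.
Proof. intros H. apply sum_eq_R0. intros k Hk. rewrite H by exact Hk. ring. Qed.

Lemma spoly_psum p k0 a N t : (forall k, (k < k0)%nat -> a k = 0) ->
  psum p k0 a N t = spoly a N (sv p t).
Proof.
  intros H. unfold psum, spoly.
  rewrite (sum_n_m_ext _ (fun k => a k * sv p t ^ k)) by (intros k; rewrite npow_sv; apply Rmult_comm).
  rewrite <- sum_n_Reals. unfold sum_n.
  induction k0 as [|k0 IH]; [reflexivity|].
  destruct (Nat.lt_ge_cases N k0) as [Hlt|Hge].
  - rewrite <- IH by (intros; apply H; lia). rewrite !sum_n_m_zero by lia. reflexivity.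
  - rewrite <- IH by (intros; apply H; lia). rewrite (sum_Sn_m _ k0) by lia.
    rewrite (H k0), Rmult_0_l by lia. symmetry. apply Rplus_0_l.
Qed.

(** Functions of (x, y, t) that expand in even powers of s, uniformly near the origin. *)
Definition approx (p : nat) (c : nat -> R -> R -> R) (f : R -> R -> R -> R) : Prop :=
  forall J, exists C, 0 <= C /\ at_infty (fun t => forall x y, Rabs x <= 1 -> Rabs y <= 1 ->
    Rabs (f x y t - even_sum c J (sv p t) x y) <= C * sv p t ^ (2 * J)).

(** The system as the construction of the series sees it. The unperturbed field is the term
    k = 0 of the expansions cF and cG, nu = n + m is the order of x and m0 the coefficient of s^nu
    in x, which solves m0^2 w0 = G_nu(0,0). *)
Record expanded_field (p n nu : nat) (m0 w0 : R) (cF cG : nat -> R -> R -> R)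
    (f1 f2 : R -> R -> R -> R) : Prop := {
  ef_n : (1 <= n)%nat;
  ef_nu1 : (n <= nu)%nat;
  ef_nu : (nu < 2 * n)%nat;
  ef_p : (2 * n <= p)%nat;
  ef_m0 : m0 <> 0;
  ef_w0 : 0 < w0;
  ef_cF : forall k, smooth2 (cF k);
  ef_cG : forall k, smooth2 (cG k);
  ef_gF : gap cF n;
  ef_gG : gap cG n;
  ef_F0 : forall x y, cF 0%nat x y = y;
  ef_G0y : forall x y, cG 0%nat x y = cG 0%nat x 0;
  ef_G0 : exists C, 0 <= C /\ forall x y, Rabs x <= 1 -> Rabs y <= 1 ->
     Rabs (cG 0%nat x y + w0 * x ^ 2) <= C * Rabs x ^ 3;
  ef_G0x : exists C, 0 <= C /\ forall x y, Rabs x <= 1 -> Rabs y <= 1 ->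
     Rabs (dX (cG 0%nat) x y + 2 * w0 * x) <= C * Rabs x ^ 2;
  ef_low : forall k, (1 <= k < nu)%nat -> cG k 0 0 = 0;
  ef_nu0 : cG nu 0 0 = m0 ^ 2 * w0;
  ef_f1 : approx p cF f1;
  ef_f2 : approx p cG f2;
  ef_lip1 : square_lipschitz f1; ef_lip2 : square_lipschitz f2;
  ef_cont1 : curve_continuous f1; ef_cont2 : curve_continuous f2
}.

Arguments ef_n {p n nu m0 w0 cF cG f1 f2}.
Arguments ef_p {p n nu m0 w0 cF cG f1 f2}.
Arguments ef_m0 {p n nu m0 w0 cF cG f1 f2}.
Arguments ef_w0 {p n nu m0 w0 cF cG f1 f2}.

(** * The formal series *)

Lemma bigO_unit p f : (0 < p)%nat -> bigO p 1 f -> at_infty (fun t => Rabs (f t) <= 1).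
Proof.
  intros Hp H. generalize (bigO_small p 0 f 1 Hp Rlt_0_1 H). apply filter_imp.
  intros t Ht. simpl in Ht. lra.
Qed.

(** Changing the argument by O(s^j) changes the perturbation, that is the field minus its
    term k = 0, only by O(s^(2n+j)). *)
Lemma approx_gap_diff p n j c f X Y X' Y' : (0 < p)%nat ->
  (forall k, smooth2 (c k)) -> gap c n -> approx p c f ->
  bigO p 1 X -> bigO p 1 Y -> bigO p 1 X' -> bigO p 1 Y' ->
  bigO p j (fun t => X t - X' t) -> bigO p j (fun t => Y t - Y' t) ->
  bigO p (2 * n + j) (fun t => f (X t) (Y t) t - f (X' t) (Y' t) t -
     (c 0%nat (X t) (Y t) - c 0%nat (X' t) (Y' t))).
Proof.
  intros Hp Hc Hg Hf HX HY HX' HY' (A & HA & DX) (B & HB & DY).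
  set (J := (2 * n + j)%nat).
  destruct (Hf J) as (C & HC & K).
  destruct (even_sum_lip_gap c n J Hc Hg) as (D & HD & L).
  exists (2 * C + D * (A + B)). split; [generalize (Rmult_le_pos D (A + B)); lra|].
  generalize (filter_and _ _ (bigO_unit _ _ Hp HX) (filter_and _ _ (bigO_unit _ _ Hp HY)
   (filter_and _ _ (bigO_unit _ _ Hp HX') (filter_and _ _ (bigO_unit _ _ Hp HY')
   (filter_and _ _ DX (filter_and _ _ DY (filter_and _ _ K (sv_eventually p 1 Hp Rlt_0_1)))))))).
  apply filter_imp. intros t (H1 & H2 & H3 & H4 & H5 & H6 & H7 & H8).
  set (s := sv p t) in *.
  assert (K1 := H7 _ _ H1 H2). assert (K2 := H7 _ _ H3 H4).
  assert (Hs : 0 <= s <= 1) by lra.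
  assert (L1 := L s _ _ _ _ Hs H1 H2 H3 H4).
  assert (P : s ^ (2 * J) <= s ^ J) by (apply pow_le_pow; [lra|lia]).
  assert (E : s ^ (2 * n) * s ^ j = s ^ J) by (rewrite <- pow_add; reflexivity).
  assert (L2 : D * s ^ (2 * n) * (Rabs (X t - X' t) + Rabs (Y t - Y' t)) <= D * (A + B) * s ^ J).
  { rewrite <- E. replace (D * (A + B) * (s ^ (2 * n) * s ^ j)) with
      (D * s ^ (2 * n) * (A * s ^ j + B * s ^ j)) by ring.
    apply Rmult_le_compat_l; [|lra]. apply Rmult_le_pos; [lra|apply pow_le; lra]. }
  match goal with |- Rabs ?G <= _ => replace G with
    ((f (X t) (Y t) t - even_sum c J s (X t) (Y t)) - (f (X' t) (Y' t) t - even_sum c J s (X' t) (Y' t))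
    + ((even_sum c J s (X t) (Y t) - c 0%nat (X t) (Y t)) - (even_sum c J s (X' t) (Y' t) - c 0%nat (X' t) (Y' t))))
    by ring end.
  eapply Rle_trans; [apply Rabs_triang|].
  match goal with |- Rabs (?a - ?b) + _ <= _ => generalize (Rabs_triang a (- b)); rewrite Rabs_Ropp; fold (a - b) end.
  intros T. assert (C * s ^ (2 * J) <= C * s ^ J) by (apply Rmult_le_compat_l; lra). lra.
Qed.

Lemma approx_lead p n c f X Y : (0 < p)%nat -> (1 <= n)%nat ->
  (forall k, smooth2 (c k)) -> gap c n -> approx p c f -> bigO p 1 X -> bigO p 1 Y ->
  bigO p (2 * n) (fun t => f (X t) (Y t) t - c 0%nat (X t) (Y t)).
Proof.
  intros Hp Hn Hc Hg Hf HX HY.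
  destruct (Hf n) as (C & HC & K). destruct (even_sum_lead c n n Hc Hg Hn) as (D & HD & L).
  exists (C + D). split; [lra|].
  generalize (filter_and _ _ (bigO_unit _ _ Hp HX) (filter_and _ _ (bigO_unit _ _ Hp HY)
   (filter_and _ _ K (sv_eventually p 1 Hp Rlt_0_1)))).
  apply filter_imp. intros t (H1 & H2 & H7 & H8).
  assert (K1 := H7 _ _ H1 H2). assert (L1 := L (sv p t) _ _ ltac:(lra) H1 H2).
  match goal with |- Rabs ?G <= _ => replace G with
    ((f (X t) (Y t) t - even_sum c n (sv p t) (X t) (Y t)) +
     (even_sum c n (sv p t) (X t) (Y t) - c 0%nat (X t) (Y t))) by ring end.
  eapply Rle_trans; [apply Rabs_triang|]. lra.
Qed.

Lemma is_derive_comp_sv p P t : (0 < p)%nat -> 0 < t -> smooth1 P ->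
  is_derive (fun t => P (sv p t)) t (- / INR p * sv p t ^ (p + 1) * Derive P (sv p t)).
Proof.
  intros Hp Ht HP. apply (is_derive_comp P (sv p)).
  - apply Derive_correct, smooth1_ex, HP.
  - apply is_derive_sv; auto.
Qed.

Lemma Derive_comp_sv p P : (0 < p)%nat -> smooth1 P ->
  at_infty (fun t => - / INR p * sv p t ^ (p + 1) * Derive P (sv p t) = Derive (fun t => P (sv p t)) t).
Proof.
  intros Hp HP. exists 0. intros t Ht. symmetry. apply is_derive_unique, is_derive_comp_sv; auto.
Qed.

Lemma continuous_Derive_sv p P t : (0 < p)%nat -> 0 < t -> smooth1 P ->
  continuous (Derive (fun t => P (sv p t))) t.
Proof.
  intros Hp Ht HP.
  apply (continuous_ext_loc (Derive (fun t => P (sv p t))) (fun t => - / INR p * sv p t ^ (p + 1) * Derive P (sv p t))).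
  - exists (mkposreal t Ht). intros r Hr. change (Rabs (r - t) < t) in Hr. apply Rabs_lt_between in Hr.
    symmetry. apply is_derive_unique, is_derive_comp_sv; auto; lra.
  - set (g := fun s => - / INR p * s ^ (p + 1) * Derive P s).
    apply (ex_derive_continuous (fun t => g (sv p t))). eexists. apply is_derive_comp_sv; auto.
    unfold g. apply (smooth1_mult (fun s => - / INR p * s ^ (p + 1))); [apply smooth1_scal, smooth1_pow|apply smooth1_derive, HP].
Qed.

Lemma bigO_Derive p P j : (0 < p)%nat -> smooth1 P -> bigO p (S j) (fun t => P (sv p t)) ->
  bigO p (p + S j) (Derive (fun t => P (sv p t))).
Proof.
  intros Hp HP H. eapply bigO_ext; [apply Derive_comp_sv; auto|].
  replace (p + S j)%nat with ((p + 1) + j)%nat by lia.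
  apply bigO_mult; [apply bigO_scal, bigO_sv|].
  apply germO_bigO; [exact Hp|]. apply smooth1_germO_derive; [exact HP|]. apply (bigO_germO p); auto.
Qed.

Definition residual (f : R -> R -> R -> R) (Z X Y : R -> R) (t : R) : R :=
  Derive Z t - f (X t) (Y t) t.

(** The residual of smooth germs is itself, up to any order, a smooth germ in s,
    hence has a leading coefficient at its order, which the next terms of the series must cancel. *)
Lemma residual_lead p j c f Z P Q : (0 < p)%nat ->
  (forall k, smooth2 (c k)) -> approx p c f -> smooth1 Z -> smooth1 P -> smooth1 Q ->
  bigO p 1 (fun t => P (sv p t)) -> bigO p 1 (fun t => Q (sv p t)) ->
  bigO p j (residual f (fun t => Z (sv p t)) (fun t => P (sv p t)) (fun t => Q (sv p t))) ->
  exists d, bigO p (S j) (fun t =>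
    residual f (fun t => Z (sv p t)) (fun t => P (sv p t)) (fun t => Q (sv p t)) t - d * sv p t ^ j).
Proof.
  intros Hp Hc Hf HZ HP HQ OP OQ HR.
  set (r := residual _ _ _ _) in *.
  set (g := fun s => - / INR p * s ^ (p + 1) * Derive Z s - even_sum c (S j) s (P s) (Q s)).
  assert (Hg : smooth1 g).
  { apply (smooth1_minus (fun s => - / INR p * s ^ (p + 1) * Derive Z s)).
    - apply (smooth1_mult (fun s => - / INR p * s ^ (p + 1))); [apply smooth1_scal, smooth1_pow|apply smooth1_derive, HZ].
    - apply even_sum_smooth; auto. }
  assert (HD : bigO p (S j) (fun t => r t - g (sv p t))).
  { destruct (Hf (S j)) as (C & HC & K).
    exists C. split; [exact HC|].
    generalize (filter_and _ _ (bigO_unit _ _ Hp OP) (filter_and _ _ (bigO_unit _ _ Hp OQ)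
     (filter_and _ _ K (filter_and _ _ (sv_eventually p 1 Hp Rlt_0_1) (Derive_comp_sv p Z Hp HZ))))).
    apply filter_imp. intros t (H1 & H2 & H7 & H8 & H9).
    assert (K1 := H7 _ _ H1 H2). unfold r, residual, g. rewrite <- H9.
    match goal with |- Rabs ?G <= _ => match type of K1 with Rabs ?A <= _ => replace G with (- A) by ring end end.
    rewrite Rabs_Ropp. eapply Rle_trans; [exact K1|]. apply Rmult_le_compat_l; [exact HC|].
    apply pow_le_pow; [lra|lia]. }
  destruct (smooth1_lead g j Hg) as (d & Hd).
  { apply (bigO_germO p); [exact Hp|].
    apply (bigO_ext' p j (fun t => r t - (r t - g (sv p t)))); [intros; ring|].
    apply bigO_minus; [exact HR|]. apply (bigO_weak p (S j)); auto. }
  exists d. apply (germO_bigO p) in Hd; [|exact Hp].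
  apply (bigO_ext' p (S j) (fun t => (r t - g (sv p t)) + (g (sv p t) - d * sv p t ^ j))); [intros; ring|].
  apply bigO_plus; auto.
Qed.

Section Formal.
Context {p n nu : nat} {m0 w0 : R} {cF cG : nat -> R -> R -> R} {f1 f2 : R -> R -> R -> R}.
Hypothesis EF : expanded_field p n nu m0 w0 cF cG f1 f2.

Lemma ef_p_pos : (0 < p)%nat.
Proof. generalize (ef_n EF) (ef_p EF). lia. Qed.

Notation "'pa' a N" := (fun t => spoly a N (sv p t)) (at level 10, a at level 9, N at level 9).

(** The residual of the second equation is required to be smaller by the factor s^nu: the
    coefficient of s^k in x enters that equation at the order k + nu, through x^2. *)
Definition formal_upto (N : nat) (ab : (nat -> R) * (nat -> R)) : Prop :=
  let (a, b) := ab in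
  (forall k, (k < nu)%nat -> a k = 0) /\ (forall k, (k < 2 * n)%nat -> b k = 0) /\ a nu = m0 /\
  bigO p (S N) (residual f1 (pa a N) (pa a N) (pa b N)) /\
  bigO p (S (N + nu)) (residual f2 (pa b N) (pa a N) (pa b N)).

(** With x = m0 s^nu and y = 0 the force balances the term s^(2 nu) G_nu(0,0); the terms
    G_k with n <= k < nu vanish at the origin and contribute O(s^(2n+nu)) only. *)
Lemma formal_start : formal_upto nu (fun k => if Nat.eqb k nu then m0 else 0, fun _ => 0).
Proof.
  assert (Hp := ef_p_pos). destruct EF as [Hn Hnu1 Hnu Hpn Hm0 Hw0 HcF HcG HgF HgG HF0 HG0y (CG & HCG & HG0) _ Hlow Hnu0 Hf1 Hf2 _ _ _ _].
  unfold formal_upto. set (a := fun k => if Nat.eqb k nu then m0 else 0).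
  assert (Ha : forall k, (k < nu)%nat -> a k = 0).
  { intros k Hk. unfold a. destruct (Nat.eqb_spec k nu); [lia|reflexivity]. }
  assert (Han : a nu = m0) by (unfold a; rewrite Nat.eqb_refl; reflexivity).
  assert (EX : forall s, spoly a nu s = m0 * s ^ nu).
  { intros s. destruct nu as [|v] eqn:Ev; [lia|]. rewrite spoly_S, Han, spoly_low; [ring|].
    intros k Hk. apply Ha. lia. }
  assert (EY : forall s, spoly (fun _ => 0) nu s = 0) by (intros; apply spoly_low; auto).
  assert (OX : bigO p nu (pa a nu)) by (apply spoly_head; auto).
  assert (OX1 : bigO p 1 (pa a nu)) by (apply (bigO_weak p nu); auto; lia).
  assert (OY : bigO p 1 (pa (fun _ => 0) nu)) by (apply spoly_head; auto).
  assert (Oz : bigO p 1 (fun _ => 0)) by apply bigO_zero.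
  repeat split; auto.
  - assert (A := approx_lead p n cF f1 _ _ Hp Hn HcF HgF Hf1 OX1 OY).
    assert (B : bigO p (p + S (nu - 1)) (Derive (pa a nu))).
    { apply bigO_Derive; [exact Hp|apply spoly_smooth|]. replace (S (nu - 1)) with nu by lia. exact OX. }
    apply (bigO_weak p _ (S nu)) in A; [|exact Hp|lia].
    apply (bigO_weak p _ (S nu)) in B; [|exact Hp|lia].
    generalize (bigO_minus _ _ _ _ B A). apply bigO_ext'. intros t. unfold residual.
    rewrite HF0, EY. ring.
  - assert (A := approx_gap_diff p n nu cG f2 (pa a nu) (pa (fun _ => 0) nu) (fun _ => 0) (fun _ => 0) Hp HcG HgG Hf2 OX1 OY Oz Oz).
    assert (A1 : bigO p (2 * n + nu) (fun t => f2 (spoly a nu (sv p t)) (spoly (fun _ => 0) nu (sv p t)) t - f2 0 0 t -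
     (cG 0%nat (spoly a nu (sv p t)) (spoly (fun _ => 0) nu (sv p t)) - cG 0%nat 0 0))).
    { apply A.
      - revert OX. apply bigO_ext'. intros; ring.
      - apply (bigO_ext' p nu (fun _ => 0)); [intros; rewrite EY; ring|apply bigO_zero]. }
    apply (bigO_weak p _ (S (nu + nu))) in A1; [|exact Hp|lia].
    (* at the origin all terms of G below s^(2 nu) vanish *)
    assert (B : bigO p (S (nu + nu)) (fun t => f2 0 0 t - (cG 0%nat 0 0 + m0 ^ 2 * w0 * sv p t ^ (nu + nu)))).
    { destruct (Hf2 (S nu)) as (C & HC & K). destruct (even_sum_tail cG nu (S nu) HcG ltac:(lia)) as (D & HD & L).
      exists (C + D). split; [lra|].
      generalize (filter_and _ _ K (sv_eventually p 1 Hp Rlt_0_1)). apply filter_imp. intros t (H1 & H2).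
      assert (Z0 : Rabs 0 <= 1) by (rewrite Rabs_R0; lra).
      specialize (H1 0 0 Z0 Z0). specialize (L (sv p t) 0 0 ltac:(lra) Z0 Z0).
      assert (E : even_sum cG nu (sv p t) 0 0 = cG 0%nat 0 0 + m0 ^ 2 * w0 * sv p t ^ (nu + nu)).
      { destruct nu as [|v] eqn:Ev; [lia|]. rewrite even_sum_S, even_sum_gap.
        - rewrite Hnu0. replace (2 * S v)%nat with (S v + S v)%nat by lia. ring.
        - intros k Hk. apply Hlow. lia. }
      rewrite E in L.
      match goal with |- Rabs ?G <= _ => match type of L with Rabs ?A' <= _ => match type of H1 with Rabs ?B' <= _ =>
        replace G with (B' + A') by ring end end end.
      eapply Rle_trans; [apply Rabs_triang|]. rewrite Rmult_plus_distr_r.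
      apply Rplus_le_compat; (eapply Rle_trans; [eassumption|]); apply Rmult_le_compat_l; auto;
        apply pow_le_pow; lra || lia. }
    assert (D : bigO p (S (nu + nu)) (fun t => cG 0%nat (spoly a nu (sv p t)) (spoly (fun _ => 0) nu (sv p t)) + m0 ^ 2 * w0 * sv p t ^ (nu + nu))).
    { apply (bigO_le p _ _ (fun t => CG * (spoly a nu (sv p t) * (spoly a nu (sv p t) * spoly a nu (sv p t))))).
      - apply bigO_scal. apply (bigO_weak p (nu + (nu + nu))); [exact Hp|lia|].
        apply bigO_mult; [exact OX|]. apply bigO_mult; exact OX.
      - generalize (filter_and _ _ (bigO_unit _ _ Hp OX1) (bigO_unit _ _ Hp OY)). apply filter_imp.
        intros t [H1 H2]. specialize (HG0 _ _ H1 H2).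
        replace (m0 ^ 2 * w0 * sv p t ^ (nu + nu)) with (w0 * spoly a nu (sv p t) ^ 2) by (rewrite EX, pow_add; ring).
        eapply Rle_trans; [exact HG0|]. rewrite !Rabs_mult, (Rabs_pos_eq CG) by exact HCG. right. ring. }
    generalize (bigO_opp _ _ _ (bigO_plus _ _ _ _ (bigO_plus _ _ _ _ A1 B) D)). apply bigO_ext'.
    intros t. unfold residual. rewrite (Derive_ext _ (fun _ => 0)) by (intros; apply EY). rewrite Derive_const.
    ring.
Qed.

(** The coefficient of y removes the leading term of the first residual, that of x the leading
    term of the second, with the factor 2 w0 m0 from the derivative of the force at x = m0 s^nu;
    every other effect of the two new terms is of higher order, because nu < 2n <= p. *)
Lemma formal_step N ab : (nu <= N)%nat -> formal_upto N ab ->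
  exists ab', formal_upto (S N) ab' /\
    forall k, (k <= N)%nat -> fst ab' k = fst ab k /\ snd ab' k = snd ab k.
Proof.
  intros HN. destruct ab as [a b]. intros (Ha & Hb & Han & R1 & R2).
  assert (Hp := ef_p_pos). destruct EF as [Hn Hnu1 Hnu Hpn Hm0 Hw0 HcF HcG HgF HgG HF0 HG0y _ (CG & HCG & HG0x) Hlow Hnu0 Hf1 Hf2 _ _ _ _].
  assert (OX : forall M, bigO p nu (pa a M)) by (intros; apply spoly_head; auto).
  assert (OX1 : bigO p 1 (pa a N)) by (apply (bigO_weak p nu); auto; lia).
  assert (OY : bigO p 1 (pa b N)).
  { apply (bigO_weak p (2 * n)); [auto|lia|]. apply spoly_head; auto. }
  destruct (residual_lead p (S N) cF f1 (spoly a N) (spoly a N) (spoly b N) Hp HcF Hf1) as (d1 & Hd1); auto using spoly_smooth.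
  destruct (residual_lead p (S (N + nu)) cG f2 (spoly b N) (spoly a N) (spoly b N) Hp HcG Hf2) as (d2 & Hd2); auto using spoly_smooth.
  (* the series of y starts at 2n, before that its new coefficient is 0 *)
  set (cb := if Nat.ltb (S N) (2 * n) then 0 else d1).
  set (ca := - d2 / (2 * w0 * m0)).
  set (a' := fun k => if Nat.eqb k (S N) then ca else a k).
  set (b' := fun k => if Nat.eqb k (S N) then cb else b k).
  assert (Ea : forall k, (k <= N)%nat -> a' k = a k).
  { intros k Hk. unfold a'. destruct (Nat.eqb_spec k (S N)); [lia|reflexivity]. }
  assert (Eb : forall k, (k <= N)%nat -> b' k = b k).
  { intros k Hk. unfold b'. destruct (Nat.eqb_spec k (S N)); [lia|reflexivity]. }
  assert (Ha' : forall k, (k < nu)%nat -> a' k = 0) by (intros; rewrite Ea by lia; auto).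
  assert (Hb' : forall k, (k < 2 * n)%nat -> b' k = 0).
  { intros k Hk. unfold b'. destruct (Nat.eqb_spec k (S N)); [|auto]. unfold cb.
    destruct (Nat.ltb_spec (S N) (2 * n)); [reflexivity|lia]. }
  assert (EX : forall s, spoly a' (S N) s = spoly a N s + ca * s ^ S N).
  { intros s. rewrite spoly_S, (spoly_ext a' a) by auto. unfold a'. rewrite Nat.eqb_refl. reflexivity. }
  assert (EY : forall s, spoly b' (S N) s = spoly b N s + cb * s ^ S N).
  { intros s. rewrite spoly_S, (spoly_ext b' b) by auto. unfold b'. rewrite Nat.eqb_refl. reflexivity. }
  assert (OX' : bigO p 1 (pa a' (S N))) by (apply (bigO_weak p nu); [auto|lia|apply spoly_head; auto]).
  assert (OY' : bigO p 1 (pa b' (S N))) by (apply (bigO_weak p (2 * n)); [auto|lia|apply spoly_head; auto]).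
  assert (DX : bigO p (S N) (fun t => spoly a' (S N) (sv p t) - spoly a N (sv p t))).
  { apply (bigO_ext' p (S N) (fun t => ca * sv p t ^ S N)); [intros; rewrite EX; ring|]. apply bigO_scal, bigO_sv. }
  assert (DY : bigO p (S N) (fun t => spoly b' (S N) (sv p t) - spoly b N (sv p t))).
  { apply (bigO_ext' p (S N) (fun t => cb * sv p t ^ S N)); [intros; rewrite EY; ring|]. apply bigO_scal, bigO_sv. }
  assert (DD : forall c g e, (forall s, spoly g (S N) s = spoly e N s + c * s ^ S N) ->
    bigO p (p + S N) (fun t => Derive (pa g (S N)) t - Derive (pa e N) t)).
  { intros c g e E.
    assert (B : bigO p (p + S N) (Derive (fun t => c * sv p t ^ S N))).
    { apply (bigO_Derive p (fun s => c * s ^ S N) N Hp); [apply smooth1_scal, smooth1_pow|apply bigO_scal, bigO_sv]. }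
    revert B. apply bigO_ext. exists 0. intros t Ht.
    rewrite <- (Derive_minus (pa g (S N)) (pa e N)).
    - apply Derive_ext. intros u. rewrite E. ring.
    - eexists. apply is_derive_comp_sv; auto using spoly_smooth.
    - eexists. apply is_derive_comp_sv; auto using spoly_smooth. }
  assert (F1 := approx_gap_diff p n (S N) cF f1 _ _ _ _ Hp HcF HgF Hf1 OX' OY' OX1 OY DX DY).
  assert (F2 := approx_gap_diff p n (S N) cG f2 _ _ _ _ Hp HcG HgG Hf2 OX' OY' OX1 OY DX DY).
  exists (a', b'). split; [|intros k Hk; split; [apply Ea|apply Eb]; exact Hk].
  repeat split; auto.
  - rewrite Ea by lia. exact Han.
  - assert (D1 := DD _ _ _ EX).
    apply (bigO_weak p _ (S (S N))) in F1; [|exact Hp|lia].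
    apply (bigO_weak p _ (S (S N))) in D1; [|exact Hp|lia].
    unfold cb in *. destruct (Nat.ltb_spec (S N) (2 * n)) as [Hlt|Hge].
    + (* as long as y = 0, the first residual is O(s^(2n)) *)
      assert (A := approx_lead p n cF f1 _ _ Hp Hn HcF HgF Hf1 OX' OY').
      assert (B : bigO p (p + S (nu - 1)) (Derive (pa a' (S N)))).
      { apply bigO_Derive; [exact Hp|apply spoly_smooth|]. replace (S (nu - 1)) with nu by lia. apply spoly_head; auto. }
      apply (bigO_weak p _ (S (S N))) in A; [|exact Hp|lia].
      apply (bigO_weak p _ (S (S N))) in B; [|exact Hp|lia].
      generalize (bigO_minus _ _ _ _ B A). apply bigO_ext'. intros t. unfold residual.
      rewrite HF0, (spoly_low b' (S N)); [ring|]. intros k Hk. apply Hb'. lia.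
    + generalize (bigO_plus _ _ _ _ (bigO_minus _ _ _ _ D1 F1) Hd1). apply bigO_ext'. intros t.
      unfold residual. rewrite !HF0, EY. ring.
  - assert (D2 := DD _ _ _ EY).
    apply (bigO_weak p _ (S (S N + nu))) in F2; [|exact Hp|lia].
    apply (bigO_weak p _ (S (S N + nu))) in D2; [|exact Hp|lia].
    replace (S (S (N + nu))) with (S (S N + nu)) in Hd2 by lia.
    (* the force responds linearly, with the slope 2 w0 m0 s^nu *)
    assert (L : bigO p (S (S N + nu)) (fun t =>
       cG 0%nat (spoly a' (S N) (sv p t)) (spoly b' (S N) (sv p t)) - cG 0%nat (spoly a N (sv p t)) (spoly b N (sv p t))
       + 2 * w0 * m0 * ca * sv p t ^ (S N + nu))).
    { destruct (C2_quad (cG 0%nat) (HcG _ 2%nat)) as (D & HD & K).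
      assert (L1 : bigO p (S (S N + nu)) (fun t => cG 0%nat (spoly a' (S N) (sv p t)) (spoly b' (S N) (sv p t))
         - cG 0%nat (spoly a N (sv p t)) (spoly b N (sv p t))
         - dX (cG 0%nat) (spoly a N (sv p t)) (spoly b N (sv p t)) * (spoly a' (S N) (sv p t) - spoly a N (sv p t)))).
      { apply (bigO_le p _ _ (fun t => D * ((spoly a' (S N) (sv p t) - spoly a N (sv p t)) * (spoly a' (S N) (sv p t) - spoly a N (sv p t))
           + (spoly b' (S N) (sv p t) - spoly b N (sv p t)) * (spoly b' (S N) (sv p t) - spoly b N (sv p t))))).
        - apply bigO_scal. apply (bigO_weak p (S N + S N)); [exact Hp|lia|].
          apply bigO_plus; apply bigO_mult; auto.
        - generalize (filter_and _ _ (bigO_unit _ _ Hp OX1) (filter_and _ _ (bigO_unit _ _ Hp OY)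
             (filter_and _ _ (bigO_unit _ _ Hp OX') (bigO_unit _ _ Hp OY')))). apply filter_imp.
          intros t (H1 & H2 & H3 & H4).
          set (x := spoly a N (sv p t)) in *. set (y := spoly b N (sv p t)) in *.
          set (x' := spoly a' (S N) (sv p t)) in *. set (y' := spoly b' (S N) (sv p t)) in *.
          specialize (K x y (x' - x) (y' - y) H1 H2).
          replace (x + (x' - x)) with x' in K by ring. replace (y + (y' - y)) with y' in K by ring.
          specialize (K H3 H4). cbv beta in *.
          assert (Ez : Derive (fun u => cG 0%nat x u) y = 0).
          { rewrite (Derive_ext _ (fun _ => cG 0%nat x 0)) by (intros; apply HG0y). apply Derive_const. }
          rewrite Ez in K.
          match type of K with Rabs ?A' <= _ => match goal with |- Rabs ?B' <= _ => replace B' with A' by ring end end.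
          eapply Rle_trans; [exact K|]. eapply Rle_trans; [|apply Rle_abs]. right. ring. }
      assert (L2 : bigO p (S nu) (fun t => dX (cG 0%nat) (spoly a N (sv p t)) (spoly b N (sv p t)) + 2 * w0 * m0 * sv p t ^ nu)).
      { assert (E1 : bigO p (S nu) (fun t => dX (cG 0%nat) (spoly a N (sv p t)) (spoly b N (sv p t)) + 2 * w0 * spoly a N (sv p t))).
        { apply (bigO_le p _ _ (fun t => CG * (spoly a N (sv p t) * spoly a N (sv p t)))).
          - apply bigO_scal. apply (bigO_weak p (nu + nu)); [exact Hp|lia|]. apply bigO_mult; auto.
          - generalize (filter_and _ _ (bigO_unit _ _ Hp OX1) (bigO_unit _ _ Hp OY)). apply filter_imp.
            intros t [H1 H2]. eapply Rle_trans; [apply (HG0x _ _ H1 H2)|].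
            rewrite !Rabs_mult, (Rabs_pos_eq CG) by exact HCG. right. ring. }
        assert (E2 : bigO p (S nu) (fun t => spoly a N (sv p t) - m0 * sv p t ^ nu)).
        { generalize (spoly_tail p a nu N Hp HN). apply bigO_ext'. intros t.
          replace (spoly a nu (sv p t)) with (m0 * sv p t ^ nu); [ring|].
          destruct nu as [|v] eqn:Ev; [lia|]. rewrite spoly_S, Han, spoly_low; [ring|].
          intros k Hk. apply Ha. lia. }
        generalize (bigO_minus _ _ _ _ E1 (bigO_scal _ _ (2 * w0) _ E2)). apply bigO_ext'. intros t. ring. }
      assert (L3 := bigO_mult _ _ _ _ _ DX L2).
      replace (S N + S nu)%nat with (S (S N + nu)) in L3 by lia.
      generalize (bigO_plus _ _ _ _ L1 L3). apply bigO_ext'. intros t.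
      replace (2 * w0 * m0 * ca * sv p t ^ (S N + nu)) with
        (2 * w0 * m0 * (spoly a' (S N) (sv p t) - spoly a N (sv p t)) * sv p t ^ nu)
        by (rewrite EX, pow_add; ring). ring. }
    generalize (bigO_plus _ _ _ _ (bigO_minus _ _ _ _ (bigO_minus _ _ _ _ D2 F2) L) Hd2). apply bigO_ext'. intros t.
    unfold residual. replace (2 * w0 * m0 * ca) with (- d2).
    + change (S N + nu)%nat with (S (N + nu)). ring.
    + unfold ca. field. split; [exact Hm0|lra].
Qed.

(** The coefficients found at stage N are kept at all later stages, so the k-th coefficient can
    be read off at stage k. *)
Theorem formal_series : exists a b : nat -> R,
  (forall k, (k < nu)%nat -> a k = 0) /\ (forall k, (k < 2 * n)%nat -> b k = 0) /\ a nu = m0 /\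
  forall N, bigO p (S N) (residual f1 (pa a N) (pa a N) (pa b N)) /\
            bigO p (S N) (residual f2 (pa b N) (pa a N) (pa b N)).
Proof.
  assert (Hp := ef_p_pos).
  assert (HS : forall x : nat * ((nat -> R) * (nat -> R)), exists ab',
    formal_upto (nu + fst x) (snd x) -> formal_upto (S (nu + fst x)) ab' /\
    forall k, (k <= nu + fst x)%nat -> fst ab' k = fst (snd x) k /\ snd ab' k = snd (snd x) k).
  { intros [i ab]. simpl. destruct (classic (formal_upto (nu + i) ab)) as [H|H].
    - destruct (formal_step (nu + i) ab ltac:(lia) H) as (ab' & H'). exists ab'. auto.
    - exists ab. intros K. elim H; exact K. }
  destruct (functional_choice _ HS) as [next Hnext].
  set (st := fix st i := match i with
     | O => (fun k => if Nat.eqb k nu then m0 else 0, fun _ => 0)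
     | S i' => next (i', st i') end : (nat -> R) * (nat -> R)).
  assert (Hst : forall i, formal_upto (nu + i) (st i)).
  { induction i as [|i IH].
    - rewrite Nat.add_0_r. apply formal_start.
    - replace (nu + S i)%nat with (S (nu + i)) by lia. apply (Hnext (i, st i)). exact IH. }
  assert (Hstab : forall i j k, (i <= j)%nat -> (k <= nu + i)%nat ->
     fst (st j) k = fst (st i) k /\ snd (st j) k = snd (st i) k).
  { intros i j k Hij Hk. induction Hij as [|j Hij IH]; [auto|].
    destruct (Hnext (j, st j) (Hst j)) as [_ E]. simpl in E.
    destruct (E k ltac:(lia)) as [E1 E2]. destruct IH as [I1 I2]. split; [rewrite <- I1|rewrite <- I2]; assumption. }
  exists (fun k => fst (st k) k), (fun k => snd (st k) k).
  assert (Hag : forall i k, (k <= nu + i)%nat -> fst (st k) k = fst (st i) k /\ snd (st k) k = snd (st i) k).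
  { intros i k Hk. destruct (Nat.le_gt_cases i k) as [H|H].
    - apply Hstab; auto.
    - destruct (Hstab k i k) as [A B]; [lia|lia|]. split; symmetry; assumption. }
  assert (HA : forall k, (k < nu)%nat -> fst (st k) k = 0).
  { intros k Hk. generalize (Hst k). destruct (st k) as [a b]. intros (H & _). apply H, Hk. }
  assert (HB : forall k, (k < 2 * n)%nat -> snd (st k) k = 0).
  { intros k Hk. generalize (Hst k). destruct (st k) as [a b]. intros (_ & H & _). apply H, Hk. }
  split; [exact HA|]. split; [exact HB|]. split.
  { generalize (Hst nu). destruct (st nu) as [a b]. intros (_ & _ & H & _). exact H. }
  intros N. destruct (Nat.le_gt_cases nu N) as [HN|HN].
  - assert (E : N = (nu + (N - nu))%nat) by lia. set (i := (N - nu)%nat) in *.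
    generalize (Hst i) (Hag i). destruct (st i) as [a b]. simpl. intros (_ & _ & _ & R1 & R2) Hi. rewrite <- E in *.
    assert (EA : forall s, spoly a N s = spoly (fun k => fst (st k) k) N s) by (intros; apply spoly_ext; intros; symmetry; apply Hi; auto).
    assert (EB : forall s, spoly b N s = spoly (fun k => snd (st k) k) N s) by (intros; apply spoly_ext; intros; symmetry; apply Hi; auto).
    split.
    + revert R1. apply bigO_ext'. intros t. unfold residual.
      rewrite EA, EB. f_equal. apply Derive_ext. intros; apply EA.
    + apply (bigO_weak p _ (S N)) in R2; [|exact Hp|lia].
      revert R2. apply bigO_ext'. intros t. unfold residual.
      rewrite EA, EB. f_equal. apply Derive_ext. intros; apply EB.
  - destruct EF as [Hn Hnu1 Hnu Hpn Hm0 Hw0 HcF HcG HgF HgG HF0 HG0y (CG & HCG & HG0) _ Hlow Hnu0 Hf1 Hf2 _ _ _ _].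
    assert (EA : forall s, spoly (fun k => fst (st k) k) N s = 0) by (intros; apply spoly_low; intros; apply HA; lia).
    assert (EB : forall s, spoly (fun k => snd (st k) k) N s = 0) by (intros; apply spoly_low; intros; apply HB; lia).
    assert (Oz : bigO p 1 (fun _ => 0)) by apply bigO_zero.
    split.
    + assert (A := approx_lead p n cF f1 _ _ Hp Hn HcF HgF Hf1 Oz Oz).
      apply (bigO_weak p _ (S N)) in A; [|exact Hp|lia].
      apply bigO_opp in A. revert A. apply bigO_ext'. intros t. unfold residual.
      rewrite EA, EB, HF0. rewrite (Derive_ext _ (fun _ => 0)) by (intros; apply EA). rewrite Derive_const. ring.
    + assert (A := approx_lead p n cG f2 _ _ Hp Hn HcG HgG Hf2 Oz Oz).
      apply (bigO_weak p _ (S N)) in A; [|exact Hp|lia].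
      apply bigO_opp in A. revert A. apply bigO_ext'. intros t. unfold residual.
      rewrite EA, EB. rewrite (Derive_ext _ (fun _ => 0)) by (intros; apply EB). rewrite Derive_const.
      assert (E0 : cG 0%nat 0 0 = 0).
      { assert (Z0 : Rabs 0 <= 1) by (rewrite Rabs_R0; lra). specialize (HG0 0 0 Z0 Z0).
        rewrite Rabs_R0 in HG0. replace (w0 * 0 ^ 2) with 0 in HG0 by ring. rewrite Rplus_0_r in HG0.
        replace (CG * 0 ^ 3) with 0 in HG0 by ring. apply Rabs_eq_0. generalize (Rabs_pos (cG 0%nat 0 0)). lra. }
      rewrite E0. ring.
Qed.
End Formal.

(** * Linearization along the partial sums *)

Lemma gap_dX c n : gap c n -> gap (fun k => dX (c k)) n.
Proof.
  intros H k Hk x y. rewrite (Derive_ext _ (fun _ => 0)) by (intros; apply H, Hk). apply Derive_const.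
Qed.

Lemma gap_dY c n : gap c n -> gap (fun k => dY (c k)) n.
Proof.
  intros H k Hk x y. rewrite (Derive_ext _ (fun _ => 0)) by (intros; apply H, Hk). apply Derive_const.
Qed.

Lemma even_sum_lip c J : (forall k, smooth2 (c k)) -> exists C, 0 <= C /\
  forall s x y x' y', 0 <= s <= 1 -> Rabs x <= 1 -> Rabs y <= 1 -> Rabs x' <= 1 -> Rabs y' <= 1 ->
  Rabs (even_sum c J s x y - even_sum c J s x' y') <= C * (Rabs (x - x') + Rabs (y - y')).
Proof.
  intros Hc.
  destruct (even_sum_lip_gap c 0 J Hc) as (C & HC & H); [intros k Hk; lia|].
  destruct (C2_lip (c 0%nat) (Hc _ 1%nat)) as (D & HD & K).
  exists (C + D). split; [lra|]. intros s x y x' y' Hs Hx Hy Hx' Hy'.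
  specialize (H s x y x' y' Hs Hx Hy Hx' Hy'). specialize (K x y x' y' Hx Hy Hx' Hy').
  simpl pow in H. rewrite Rmult_1_r in H.
  match goal with |- Rabs ?G <= _ => match type of H with Rabs ?A <= _ => match type of K with Rabs ?B <= _ =>
    replace G with (A + B) by ring end end end.
  eapply Rle_trans; [apply Rabs_triang|]. lra.
Qed.

(** Truncating the coefficients of the linear part at a fixed order J0, and evaluating them on a
    fixed partial sum, costs only a high power of s. The linear system is then the same for all
    partial sums. *)
Lemma even_sum_freeze p c J0 J j X Y X0 Y0 : (0 < p)%nat -> (forall k, smooth2 (c k)) -> (J0 <= J)%nat ->
  (j <= 2 * J0 + 2)%nat ->
  bigO p 1 X -> bigO p 1 Y -> bigO p 1 X0 -> bigO p 1 Y0 ->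
  bigO p j (fun t => X t - X0 t) -> bigO p j (fun t => Y t - Y0 t) ->
  bigO p j (fun t => even_sum c J (sv p t) (X t) (Y t) - even_sum c J0 (sv p t) (X0 t) (Y0 t)).
Proof.
  intros Hp Hc HJ Hj HX HY HX0 HY0 (A & HA & DX) (B & HB & DY).
  destruct (even_sum_tail c J0 J Hc HJ) as (C & HC & K).
  destruct (even_sum_lip c J0 Hc) as (D & HD & L).
  exists (C + D * (A + B)). split; [generalize (Rmult_le_pos D (A + B)); lra|].
  generalize (filter_and _ _ (bigO_unit _ _ Hp HX) (filter_and _ _ (bigO_unit _ _ Hp HY)
   (filter_and _ _ (bigO_unit _ _ Hp HX0) (filter_and _ _ (bigO_unit _ _ Hp HY0)
   (filter_and _ _ DX (filter_and _ _ DY (sv_eventually p 1 Hp Rlt_0_1))))))).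
  apply filter_imp. intros t (H1 & H2 & H3 & H4 & H5 & H6 & H7).
  specialize (K (sv p t) _ _ ltac:(lra) H1 H2). specialize (L (sv p t) _ _ _ _ ltac:(lra) H1 H2 H3 H4).
  match goal with |- Rabs ?G <= _ => match type of K with Rabs ?A <= _ => match type of L with Rabs ?B <= _ =>
    replace G with (A + B) by ring end end end.
  eapply Rle_trans; [apply Rabs_triang|].
  assert (sv p t ^ (2 * J0 + 2) <= sv p t ^ j) by (apply pow_le_pow; [lra|lia]).
  assert (C * sv p t ^ (2 * J0 + 2) <= C * sv p t ^ j) by (apply Rmult_le_compat_l; lra).
  assert (D * (Rabs (X t - X0 t) + Rabs (Y t - Y0 t)) <= D * (A * sv p t ^ j + B * sv p t ^ j))
   by (apply Rmult_le_compat_l; lra).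
  lra.
Qed.

Lemma bigO_half p f : (0 < p)%nat -> bigO p 1 f -> at_infty (fun t => Rabs (f t) <= 1 / 2).
Proof.
  intros Hp H. generalize (bigO_small p 0 f (1 / 2) Hp ltac:(lra) H). apply filter_imp.
  intros t Ht. simpl in Ht. lra.
Qed.

Lemma sq_abs_le u r : Rabs u <= r -> u ^ 2 <= r * Rabs u.
Proof. intros H. rewrite <- pow2_abs. generalize (Rabs_pos u). nra. Qed.

(** The quadratic remainder is absorbed in the linear error because |u|, |v| <= s^r; the
    remainder of the asymptotic expansion and the residual of (X, Y) make up the term s^N. *)
Lemma field_linearization p c f Z X Y X0 Y0 r J0 N : (0 < p)%nat -> (1 <= r)%nat -> (r <= 2 * J0 + 2)%nat ->
  (forall k, smooth2 (c k)) -> approx p c f ->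
  bigO p 1 X -> bigO p 1 Y -> bigO p 1 X0 -> bigO p 1 Y0 ->
  bigO p r (fun t => X t - X0 t) -> bigO p r (fun t => Y t - Y0 t) ->
  bigO p N (residual f Z X Y) ->
  exists C, 0 <= C /\ at_infty (fun t => forall u v, Rabs u <= sv p t ^ r -> Rabs v <= sv p t ^ r ->
    Rabs (f (X t + u) (Y t + v) t - Derive Z t -
     (even_sum (fun k => dX (c k)) J0 (sv p t) (X0 t) (Y0 t) * u +
      even_sum (fun k => dY (c k)) J0 (sv p t) (X0 t) (Y0 t) * v))
    <= C * sv p t ^ r * (Rabs u + Rabs v) + C * sv p t ^ N).
Proof.
  intros Hp Hr HJ0 Hc Hf HX HY HX0 HY0 DX DY (A & HA & HR).
  set (J := (N + J0)%nat).
  destruct (Hf J) as (B & HB & K).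
  destruct (even_sum_quad c J Hc) as (D & HD & L).
  destruct (even_sum_freeze p (fun k => dX (c k)) J0 J r X Y X0 Y0) as (E & HE & M1); auto;
    [intros; apply smooth2_dX, Hc|unfold J; lia|].
  destruct (even_sum_freeze p (fun k => dY (c k)) J0 J r X Y X0 Y0) as (F & HF & M2); auto;
    [intros; apply smooth2_dY, Hc|unfold J; lia|].
  exists (A + 2 * B + D + E + F). split; [lra|].
  generalize (filter_and _ _ (bigO_half _ _ Hp HX) (filter_and _ _ (bigO_half _ _ Hp HY)
   (filter_and _ _ HR (filter_and _ _ K (filter_and _ _ M1 (filter_and _ _ M2 (sv_eventually p (1 / 2) Hp ltac:(lra)))))))).
  apply filter_imp. intros t (H1 & H2 & H3 & H4 & H5 & H6 & H7) u v Hu Hv.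
  set (s := sv p t) in *.
  assert (Hs : 0 <= s <= 1) by lra.
  assert (Hsr : s ^ r <= 1 / 2).
  { apply Rle_trans with (s ^ 1); [apply pow_le_pow; auto|]. lra. }
  assert (HX1 : Rabs (X t) <= 1) by lra. assert (HY1 : Rabs (Y t) <= 1) by lra.
  assert (HXu : Rabs (X t + u) <= 1) by (generalize (Rabs_triang (X t) u); lra).
  assert (HYv : Rabs (Y t + v) <= 1) by (generalize (Rabs_triang (Y t) v); lra).
  assert (K1 := H4 _ _ HXu HYv). assert (K2 := H4 _ _ HX1 HY1).
  assert (L1 := L s (X t) (Y t) u v Hs HX1 HY1 HXu HYv). unfold residual in H3. fold s in L1. cbv beta in *.
  set (lx := even_sum (fun k x y => Derive (fun u0 => c k u0 y) x) J s (X t) (Y t)) in *.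
  set (ly := even_sum (fun k x y => Derive (fun u0 => c k x u0) y) J s (X t) (Y t)) in *.
  set (mx := even_sum (fun k x y => Derive (fun u0 => c k u0 y) x) J0 s (X0 t) (Y0 t)) in *.
  set (my := even_sum (fun k x y => Derive (fun u0 => c k x u0) y) J0 s (X0 t) (Y0 t)) in *.
  set (fu := f (X t + u) (Y t + v) t) in *. set (fz := f (X t) (Y t) t) in *.
  set (Su := even_sum c J s (X t + u) (Y t + v)) in *. set (Sz := even_sum c J s (X t) (Y t)) in *.
  replace (fu - Derive Z t - (mx * u + my * v)) with
    ((fu - Su) + (- (fz - Sz)) + (- (Derive Z t - fz)) + (Su - Sz - (lx * u + ly * v)) + (lx - mx) * u + (ly - my) * v) by ring.
  assert (T : forall a b c d e g, Rabs (a + b + c + d + e + g) <= Rabs a + Rabs b + Rabs c + Rabs d + Rabs e + Rabs g).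
  { intros. repeat (eapply Rle_trans; [apply Rabs_triang|]; apply Rplus_le_compat_r). apply Rle_refl. }
  eapply Rle_trans; [apply T|]. rewrite !Rabs_Ropp, !Rabs_mult.
  assert (Pr : 0 <= s ^ r) by (apply pow_le; lra). assert (PN : 0 <= s ^ N) by (apply pow_le; lra).
  assert (Q : s ^ (2 * J) <= s ^ N) by (apply pow_le_pow; [lra|unfold J; lia]).
  assert (Q1 : B * s ^ (2 * J) <= B * s ^ N) by (apply Rmult_le_compat_l; lra).
  assert (U0 := Rabs_pos u). assert (V0 := Rabs_pos v).
  assert (Q2 : D * (u ^ 2 + v ^ 2) <= D * s ^ r * (Rabs u + Rabs v)).
  { rewrite Rmult_assoc. apply Rmult_le_compat_l; [exact HD|].
    generalize (sq_abs_le _ _ Hu) (sq_abs_le _ _ Hv). lra. }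
  assert (Q3 : Rabs (lx - mx) * Rabs u <= E * s ^ r * Rabs u) by (apply Rmult_le_compat_r; auto).
  assert (Q4 : Rabs (ly - my) * Rabs v <= F * s ^ r * Rabs v) by (apply Rmult_le_compat_r; auto).
  assert (Q5 : 0 <= E * s ^ r * Rabs v) by (repeat apply Rmult_le_pos; auto).
  assert (Q6 : 0 <= F * s ^ r * Rabs u) by (repeat apply Rmult_le_pos; auto).
  assert (Q7 : 0 <= D * s ^ N) by (apply Rmult_le_pos; auto).
  assert (Q8 : 0 <= E * s ^ N) by (apply Rmult_le_pos; auto).
  assert (Q9 : 0 <= F * s ^ N) by (apply Rmult_le_pos; auto).
  assert (Q10 : 0 <= (A + 2 * B) * s ^ r * (Rabs u + Rabs v)).
  { apply Rmult_le_pos; [|lra]. apply Rmult_le_pos; lra. }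
  lra.
Qed.

(** What the dynamics uses. For every N the deviation (u, v) from the N-th partial sums obeys the
    same linear system u' = al u + be v, v' = - ka u + de v, with an error that is by s^(nu+1)
    smaller than 1/t = s^p. The sign of k0 = 2 w0 m0 decides between rotation and saddle. *)
Record deviation_system (p n nu : nat) (k0 : R) (f1 f2 : R -> R -> R -> R) (a b : nat -> R)
   (al be ka de : R -> R) : Prop := {
  ds_n : (1 <= n)%nat; ds_nu1 : (1 <= nu)%nat; ds_nu : (nu < 2 * n)%nat; ds_p : (2 * n <= p)%nat;
  ds_a : forall k, (k < nu)%nat -> a k = 0;
  ds_b : forall k, (k < 2 * n)%nat -> b k = 0;
  ds_al : smooth1 al; ds_be : smooth1 be; ds_ka : smooth1 ka; ds_de : smooth1 de;
  ds_oal : germO (2 * n) al; ds_obe : germO (2 * n) (fun s => be s - 1); ds_ode : germO (2 * n) de;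
  ds_oka : germO (S nu) (fun s => ka s - k0 * s ^ nu);
  ds_lin : forall N, (p + nu <= N)%nat -> exists C, 0 <= C /\ at_infty (fun t => forall u v,
     Rabs u <= sv p t ^ (p + nu + 1) -> Rabs v <= sv p t ^ (p + nu + 1) ->
     Rabs (f1 (spoly a N (sv p t) + u) (spoly b N (sv p t) + v) t - Derive (fun t => spoly a N (sv p t)) t
        - (al (sv p t) * u + be (sv p t) * v)) <= C * sv p t ^ (p + nu + 1) * (Rabs u + Rabs v) + C * sv p t ^ N /\
     Rabs (f2 (spoly a N (sv p t) + u) (spoly b N (sv p t) + v) t - Derive (fun t => spoly b N (sv p t)) t
        - (- ka (sv p t) * u + de (sv p t) * v)) <= C * sv p t ^ (p + nu + 1) * (Rabs u + Rabs v) + C * sv p t ^ N);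
  ds_lip1 : square_lipschitz f1; ds_lip2 : square_lipschitz f2;
  ds_cont1 : curve_continuous f1; ds_cont2 : curve_continuous f2
}.

Arguments ds_al {p n nu k0 f1 f2 a b al be ka de}.
Arguments ds_be {p n nu k0 f1 f2 a b al be ka de}.
Arguments ds_ka {p n nu k0 f1 f2 a b al be ka de}.
Arguments ds_de {p n nu k0 f1 f2 a b al be ka de}.
Arguments ds_lin {p n nu k0 f1 f2 a b al be ka de}.
Arguments ds_lip1 {p n nu k0 f1 f2 a b al be ka de}.
Arguments ds_lip2 {p n nu k0 f1 f2 a b al be ka de}.
Arguments ds_cont1 {p n nu k0 f1 f2 a b al be ka de}.
Arguments ds_cont2 {p n nu k0 f1 f2 a b al be ka de}.

Lemma deviation_exists p n nu m0 w0 cF cG f1 f2 a b : expanded_field p n nu m0 w0 cF cG f1 f2 ->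
  (forall k, (k < nu)%nat -> a k = 0) -> (forall k, (k < 2 * n)%nat -> b k = 0) -> a nu = m0 ->
  (forall N, bigO p (S N) (residual f1 (fun t => spoly a N (sv p t)) (fun t => spoly a N (sv p t)) (fun t => spoly b N (sv p t))) /\
    bigO p (S N) (residual f2 (fun t => spoly b N (sv p t)) (fun t => spoly a N (sv p t)) (fun t => spoly b N (sv p t)))) ->
  exists al be ka de, deviation_system p n nu (2 * w0 * m0) f1 f2 a b al be ka de.
Proof.
  intros EF Ha Hb Han HR. assert (Hp := ef_p_pos EF).
  destruct EF as [Hn Hnu1 Hnu Hpn Hm0 Hw0 HcF HcG HgF HgG HF0 HG0y _ (CG & HCG & HG0x) Hlow Hnu0 Hf1 Hf2 L1 L2 C1 C2].
  set (N0 := (p + nu)%nat). set (P := spoly a N0). set (Q := spoly b N0).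
  assert (smP : smooth1 P) by apply spoly_smooth. assert (smQ : smooth1 Q) by apply spoly_smooth.
  set (al := fun s => even_sum (fun k => dX (cF k)) N0 s (P s) (Q s)).
  set (be := fun s => even_sum (fun k => dY (cF k)) N0 s (P s) (Q s)).
  set (gx := fun s => even_sum (fun k => dX (cG k)) N0 s (P s) (Q s)).
  set (de := fun s => even_sum (fun k => dY (cG k)) N0 s (P s) (Q s)).
  assert (OX : forall N, bigO p 1 (fun t => spoly a N (sv p t))).
  { intros N. apply (bigO_weak p nu); [auto|lia|apply spoly_head; auto]. }
  assert (OY : forall N, bigO p 1 (fun t => spoly b N (sv p t))).
  { intros N. apply (bigO_weak p (2 * n)); [auto|lia|apply spoly_head; auto]. }
  assert (lead : forall c, (forall k, smooth2 (c k)) -> gap c n ->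
     bigO p (2 * n) (fun t => even_sum c N0 (sv p t) (P (sv p t)) (Q (sv p t)) - c 0%nat (P (sv p t)) (Q (sv p t)))).
  { intros c Hc Hg. destruct (even_sum_lead c n N0 Hc Hg Hn) as (C & HC & K). exists C. split; [exact HC|].
    generalize (filter_and _ _ (bigO_unit _ _ Hp (OX N0)) (filter_and _ _ (bigO_unit _ _ Hp (OY N0)) (sv_eventually p 1 Hp Rlt_0_1))).
    apply filter_imp. intros t (H1 & H2 & H3). apply K; auto. lra. }
  assert (K1 := lead _ (fun k => smooth2_dX _ (HcF k)) (gap_dX _ _ HgF)).
  assert (K2 := lead _ (fun k => smooth2_dY _ (HcF k)) (gap_dY _ _ HgF)).
  assert (K3 := lead _ (fun k => smooth2_dX _ (HcG k)) (gap_dX _ _ HgG)).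
  assert (K4 := lead _ (fun k => smooth2_dY _ (HcG k)) (gap_dY _ _ HgG)).
  exists al, be, (fun s => - gx s), de.
  constructor; auto.
  - lia.
  - apply even_sum_smooth; auto. intros; apply smooth2_dX, HcF.
  - apply even_sum_smooth; auto. intros; apply smooth2_dY, HcF.
  - apply smooth1_opp. apply even_sum_smooth; auto. intros; apply smooth2_dX, HcG.
  - apply even_sum_smooth; auto. intros; apply smooth2_dY, HcG.
  - apply (bigO_germO p); [exact Hp|]. revert K1. apply bigO_ext'. intros t. unfold al.
    rewrite (Derive_ext (fun u => cF 0%nat u _) (fun _ => Q (sv p t))) by (intros; apply HF0).
    rewrite Derive_const. ring.
  - apply (bigO_germO p (2 * n) (fun s => be s - 1)); [exact Hp|]. revert K2. apply bigO_ext'. intros t. unfold be.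
    rewrite (Derive_ext (fun u => cF 0%nat _ u) (fun u => u)) by (intros; apply HF0).
    rewrite Derive_id. ring.
  - apply (bigO_germO p); [exact Hp|]. revert K4. apply bigO_ext'. intros t. unfold de.
    rewrite (Derive_ext (fun u => cG 0%nat _ u) (fun _ => cG 0%nat (P (sv p t)) 0)) by (intros; apply HG0y).
    rewrite Derive_const. ring.
  - apply (bigO_germO p (S nu) (fun s => - gx s - 2 * w0 * m0 * s ^ nu)); [exact Hp|].
    assert (E1 : bigO p (S nu) (fun t => dX (cG 0%nat) (P (sv p t)) (Q (sv p t)) + 2 * w0 * P (sv p t))).
    { apply (bigO_le p _ _ (fun t => CG * (P (sv p t) * P (sv p t)))).
      - apply bigO_scal. apply (bigO_weak p (nu + nu)); [exact Hp|lia|]. apply bigO_mult; apply spoly_head; auto.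
      - generalize (filter_and _ _ (bigO_unit _ _ Hp (OX N0)) (bigO_unit _ _ Hp (OY N0))). apply filter_imp.
        intros t [H1 H2]. eapply Rle_trans; [apply (HG0x _ _ H1 H2)|].
        rewrite !Rabs_mult, (Rabs_pos_eq CG) by exact HCG. right. unfold P. ring. }
    assert (E2 : bigO p (S nu) (fun t => P (sv p t) - m0 * sv p t ^ nu)).
    { generalize (spoly_tail p a nu N0 Hp ltac:(unfold N0; lia)). apply bigO_ext'. intros t.
      replace (spoly a nu (sv p t)) with (m0 * sv p t ^ nu); [unfold P; ring|].
      destruct nu as [|v] eqn:Ev; [lia|]. rewrite spoly_S, Han, spoly_low; [ring|].
      intros k Hk. apply Ha. lia. }
    apply (bigO_weak p _ (S nu)) in K3; [|exact Hp|lia].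
    generalize (bigO_minus _ _ _ _ (bigO_minus _ _ _ _ (bigO_scal _ _ (2 * w0) _ E2) E1) K3). apply bigO_ext'.
    intros t. unfold gx. ring.
  - intros N HN. destruct (HR N) as [R1 R2].
    assert (DX : bigO p (p + nu + 1) (fun t => spoly a N (sv p t) - P (sv p t))).
    { replace (p + nu + 1)%nat with (S N0) by (unfold N0; lia). apply spoly_tail; auto. }
    assert (DY : bigO p (p + nu + 1) (fun t => spoly b N (sv p t) - Q (sv p t))).
    { replace (p + nu + 1)%nat with (S N0) by (unfold N0; lia). apply spoly_tail; auto. }
    apply (bigO_weak p _ N) in R1; [|exact Hp|lia]. apply (bigO_weak p _ N) in R2; [|exact Hp|lia].
    destruct (field_linearization p cF f1 _ _ _ _ _ (p + nu + 1) N0 N Hp ltac:(lia) ltac:(unfold N0; lia) HcF Hf1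
       (OX N) (OY N) (OX N0) (OY N0) DX DY R1) as (A & HA & H1).
    destruct (field_linearization p cG f2 _ _ _ _ _ (p + nu + 1) N0 N Hp ltac:(lia) ltac:(unfold N0; lia) HcG Hf2
       (OX N) (OY N) (OX N0) (OY N0) DX DY R2) as (B & HB & H2).
    exists (A + B). split; [lra|].
    generalize (filter_and _ _ H1 (filter_and _ _ H2 (sv_eventually p 1 Hp Rlt_0_1))). apply filter_imp.
    intros t (G1 & G2 & G3) u v Hu Hv. specialize (G1 u v Hu Hv). specialize (G2 u v Hu Hv).
    assert (0 <= sv p t ^ N) by (apply pow_le; lra).
    assert (0 <= sv p t ^ (p + nu + 1) * (Rabs u + Rabs v)).
    { apply Rmult_le_pos; [apply pow_le; lra|]. generalize (Rabs_pos u) (Rabs_pos v). lra. }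
    assert (0 <= A * (sv p t ^ (p + nu + 1) * (Rabs u + Rabs v))) by (apply Rmult_le_pos; lra).
    assert (0 <= B * (sv p t ^ (p + nu + 1) * (Rabs u + Rabs v))) by (apply Rmult_le_pos; lra).
    assert (0 <= A * sv p t ^ N) by (apply Rmult_le_pos; lra).
    assert (0 <= B * sv p t ^ N) by (apply Rmult_le_pos; lra).
    unfold al, be, gx, de. split.
    + eapply Rle_trans; [exact G1|]. lra.
    + rewrite Ropp_involutive. eapply Rle_trans; [exact G2|]. lra.
Qed.

(** * Ordinary differential equations *)

Lemma nondec (f f' : R -> R) a b : a <= b ->
  (forall t, a <= t <= b -> is_derive f t (f' t)) -> (forall t, a <= t <= b -> 0 <= f' t) -> f a <= f b.
Proof.
  intros Hab Hd Hp.
  destruct (MVT_gen f a b f') as (c & Hc & E).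
  - intros x Hx. rewrite Rmin_left, Rmax_right in Hx by lra. apply Hd. lra.
  - intros x Hx. rewrite Rmin_left, Rmax_right in Hx by lra. apply continuity_pt_filterlim.
    apply (ex_derive_continuous f). eexists. apply Hd. lra.
  - rewrite Rmin_left, Rmax_right in Hc by lra.
    assert (0 <= f' c * (b - a)) by (apply Rmult_le_pos; [apply Hp; lra|lra]). lra.
Qed.

Lemma exp_growth_fwd (D D' : R -> R) t1 T c k : 0 <= c -> 0 < k -> D t1 = 0 ->
  (forall s, t1 <= s <= T -> is_derive D s (D' s)) ->
  (forall s, t1 <= s <= T -> Rabs (D' s) <= c * exp (k * (s - t1))) ->
  forall t, t1 <= t <= T -> Rabs (D t) <= c / k * exp (k * (t - t1)).
Proof.
  intros Hc Hk H0 Hd HB t Ht.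
  set (phi := fun s => c / k * exp (k * (s - t1))).
  assert (Hphi : forall s, is_derive phi s (c * exp (k * (s - t1)))).
  { intros s. unfold phi. auto_derive; [exact I|]. fold (s - t1). field. lra. }
  assert (P0 : 0 <= phi t1).
  { unfold phi. apply Rmult_le_pos; [apply Rdiv_le_0_compat; lra|apply Rlt_le, exp_pos]. }
  assert (A : phi t1 - D t1 <= phi t - D t).
  { apply (nondec (fun s => phi s - D s) (fun s => c * exp (k * (s - t1)) - D' s)); [lra| |].
    - intros s Hs. apply (is_derive_minus phi D); [apply Hphi|apply Hd; lra].
    - intros s Hs. generalize (HB s ltac:(lra)) (Rle_abs (D' s)). lra. }
  assert (B : phi t1 + D t1 <= phi t + D t).
  { apply (nondec (fun s => phi s + D s) (fun s => c * exp (k * (s - t1)) + D' s)); [lra| |].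
    - intros s Hs. apply (is_derive_plus phi D); [apply Hphi|apply Hd; lra].
    - intros s Hs. generalize (HB s ltac:(lra)) (Rle_abs (- D' s)). rewrite Rabs_Ropp. lra. }
  apply Rabs_le. fold (phi t). lra.
Qed.

Lemma exp_growth (D D' : R -> R) t1 T c k : 0 <= c -> 0 < k -> D t1 = 0 ->
  (forall s, Rabs (s - t1) <= T -> is_derive D s (D' s)) ->
  (forall s, Rabs (s - t1) <= T -> Rabs (D' s) <= c * exp (k * Rabs (s - t1))) ->
  forall t, Rabs (t - t1) <= T -> Rabs (D t) <= c / k * exp (k * Rabs (t - t1)).
Proof.
  intros Hc Hk H0 Hd HB t Ht. destruct (Rle_dec t1 t) as [Hle|Hlt].
  - rewrite Rabs_pos_eq in Ht by lra. rewrite (Rabs_pos_eq (t - t1)) by lra. apply (exp_growth_fwd D D' t1 (t1 + T)); auto; try lra.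
    + intros s Hs. apply Hd. rewrite Rabs_pos_eq; lra.
    + intros s Hs. generalize (HB s). rewrite Rabs_pos_eq by lra. intros K; apply K. lra.
  - rewrite (Rabs_left (t - t1)) by lra. rewrite (Rabs_left (t - t1)) in Ht by lra.
    generalize (exp_growth_fwd (fun s => D (2 * t1 - s)) (fun s => - D' (2 * t1 - s)) t1 (t1 + T) c k Hc Hk).
    intros K. specialize (K ltac:(rewrite <- H0; f_equal; ring)).
    assert (K1 : forall s, t1 <= s <= t1 + T -> is_derive (fun s => D (2 * t1 - s)) s (- D' (2 * t1 - s))).
    { intros s Hs. evar_last.
      - apply (is_derive_comp D (fun s => 2 * t1 - s)); [apply Hd; apply Rabs_le; lra|auto_derive; [exact I|reflexivity]].
      - unfold scal; simpl; unfold mult; simpl. ring. }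
    specialize (K K1).
    assert (K2 : forall s, t1 <= s <= t1 + T -> Rabs (- D' (2 * t1 - s)) <= c * exp (k * (s - t1))).
    { intros s Hs. rewrite Rabs_Ropp. generalize (HB (2 * t1 - s)).
      rewrite Rabs_left1 by lra. replace (- (2 * t1 - s - t1)) with (s - t1) by ring. intros K'; apply K'. lra. }
    specialize (K K2 (2 * t1 - t) ltac:(lra)). replace (2 * t1 - (2 * t1 - t)) with t in K by ring.
    replace (- (t - t1)) with (2 * t1 - t - t1) by ring. exact K.
Qed.

(** The error bound is stated for every admissible constant K', so that the limit, taken
    pointwise in t, is approached locally uniformly in t. *)
Lemma geo_lim (u : nat -> R) K : (forall k, Rabs (u (S k) - u k) <= K / 2 ^ k) ->
  exists l, forall K', (forall k, Rabs (u (S k) - u k) <= K' / 2 ^ k) -> forall k, Rabs (u k - l) <= 2 * K' / 2 ^ k.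
Proof.
  intros H.
  assert (G : forall K, (forall k, Rabs (u (S k) - u k) <= K / 2 ^ k) -> forall j k,
     Rabs (u (k + j)%nat - u k) <= 2 * K / 2 ^ k - 2 * K / 2 ^ (k + j)).
  { clear K H. intros K H. induction j as [|j IH]; intros k.
    - rewrite Nat.add_0_r, !Rminus_diag, Rabs_R0. lra.
    - replace (u (k + S j)%nat - u k) with ((u (S (k + j)) - u (k + j)%nat) + (u (k + j)%nat - u k))
        by (rewrite Nat.add_succ_r; ring).
      eapply Rle_trans; [apply Rabs_triang|]. specialize (IH k). specialize (H (k + j)%nat).
      replace (2 * K / 2 ^ (k + S j)) with (K / 2 ^ (k + j)).
      + replace (2 * K / 2 ^ (k + j)) with (2 * (K / 2 ^ (k + j))) in IH by (unfold Rdiv; ring). lra.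
      + rewrite Nat.add_succ_r. simpl. field. apply pow_nonzero; lra. }
  assert (K0 : 0 <= K) by (generalize (H O) (Rabs_pos (u 1%nat - u O)); simpl; lra).
  assert (Gp : forall K, (forall k, Rabs (u (S k) - u k) <= K / 2 ^ k) -> forall j k, Rabs (u (k + j)%nat - u k) <= 2 * K / 2 ^ k).
  { intros K' H' j k. eapply Rle_trans; [apply G, H'|].
    assert (0 <= K') by (generalize (H' O) (Rabs_pos (u 1%nat - u O)); simpl; lra).
    assert (0 <= 2 * K' / 2 ^ (k + j)) by (apply Rdiv_le_0_compat; [lra|apply pow_lt; lra]). lra. }
  destruct (Rcomplete.R_complete u) as [l Hl].
  - intros eps He.
    destruct (pow_lt_1_zero (/ 2) ltac:(rewrite Rabs_pos_eq; lra) (eps / (4 * K + 1))) as [M HM].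
    { apply Rdiv_lt_0_compat; lra. }
    exists M. intros i j Hi Hj.
    assert (Hs : 4 * K / 2 ^ M < eps).
    { specialize (HM M ltac:(lia)). rewrite pow_inv, Rabs_pos_eq in HM by (apply Rlt_le, Rinv_0_lt_compat, pow_lt; lra).
      unfold Rdiv at 1. apply Rle_lt_trans with ((4 * K + 1) * / 2 ^ M).
      - apply Rmult_le_compat_r; [apply Rlt_le, Rinv_0_lt_compat, pow_lt; lra|lra].
      - apply Rlt_le_trans with ((4 * K + 1) * (eps / (4 * K + 1))); [apply Rmult_lt_compat_l; lra|].
        right. field. lra. }
    generalize (Gp K H (i - M)%nat M) (Gp K H (j - M)%nat M).
    replace (M + (i - M))%nat with i by lia. replace (M + (j - M))%nat with j by lia. intros A B.
    unfold Rdist. replace (u i - u j) with ((u i - u M) - (u j - u M)) by ring.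
    eapply Rle_lt_trans; [apply Rabs_triang|]. rewrite Rabs_Ropp.
    replace (4 * K / 2 ^ M) with (2 * K / 2 ^ M + 2 * K / 2 ^ M) in Hs by (unfold Rdiv; ring). lra.
  - exists l. intros K' H' k. apply Rnot_lt_le. intros Hlt.
    destruct (Hl (Rabs (u k - l) - 2 * K' / 2 ^ k)) as [M HM]; [lra|].
    specialize (HM (k + M)%nat ltac:(lia)). specialize (Gp K' H' M k). unfold Rdist in HM.
    generalize (Rabs_triang (- (u (k + M)%nat - u k)) (u (k + M)%nat - l)). rewrite Rabs_Ropp.
    replace (- (u (k + M)%nat - u k) + (u (k + M)%nat - l)) with (u k - l) by ring. lra.
Qed.

Definition ode_solution (g1 g2 : R -> R -> R -> R) (a b : R -> R) : Prop :=
  forall t, is_derive a t (g1 t (a t) (b t)) /\ is_derive b t (g2 t (a t) (b t)).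

(** Continuity is only needed along curves. The Lipschitz condition is global in the state and
    local in time, which is what clamping the state produces. *)
Record regular_field (g1 g2 : R -> R -> R -> R) : Prop := {
  rf_cont : forall a b : R -> R, (forall t, continuous a t) -> (forall t, continuous b t) -> forall t,
    continuous (fun t => g1 t (a t) (b t)) t /\ continuous (fun t => g2 t (a t) (b t)) t;
  rf_lip : forall T, exists L, 0 < L /\ forall t a b a' b', Rabs t <= T ->
    Rabs (g1 t a b - g1 t a' b') <= L * (Rabs (a - a') + Rabs (b - b')) /\
    Rabs (g2 t a b - g2 t a' b') <= L * (Rabs (a - a') + Rabs (b - b'))
}.

Lemma continuous_bound (f : R -> R) t1 T : (forall t, continuous f t) -> 0 <= T ->
  exists M, 0 <= M /\ forall t, Rabs (t - t1) <= T -> Rabs (f t) <= M.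
Proof.
  intros Hf HT. destruct (continuity_ab_maj (fun s => Rabs (f s)) (t1 - T) (t1 + T)) as (M & HM & _); [lra| |].
  - intros c _. apply continuity_pt_filterlim.
    apply (continuous_comp f Rabs); [apply Hf|apply continuous_Rabs].
  - exists (Rabs (f M)). split; [apply Rabs_pos|]. intros t Ht. apply HM. apply Rabs_le_between in Ht. lra.
Qed.

Lemma is_derive_RInt_cont (f : R -> R) c t1 t : (forall t, continuous f t) ->
  is_derive (fun t => c + RInt f t1 t) t (f t).
Proof.
  intros Hf. replace (f t) with (plus zero (f t)) by apply plus_zero_l.
  apply (is_derive_plus (fun _ => c) (fun t => RInt f t1 t)); [apply @is_derive_const|].
  apply (is_derive_RInt f (fun t => RInt f t1 t) t1); [|apply Hf].
  apply filter_forall. intros x. apply (RInt_correct f), (ex_RInt_continuous f). intros; apply Hf.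
Qed.

Lemma continuous_unif_lim (A : R -> R) t :
  (forall eps, 0 < eps -> exists h : R -> R, continuous h t /\ exists d, 0 < d /\
     forall s, Rabs (s - t) < d -> Rabs (h s - A s) <= eps) -> continuous A t.
Proof.
  intros H. apply filterlim_locally. intros eps.
  destruct (H (eps / 4) ltac:(generalize (cond_pos eps); lra)) as (h & Hh & d & Hd & K).
  assert (Hh' := proj1 (filterlim_locally _ _) Hh (mkposreal (eps / 4) ltac:(generalize (cond_pos eps); lra))).
  assert (Hl : locally t (fun s => Rabs (s - t) < d)).
  { exists (mkposreal d Hd). intros s Hs. exact Hs. }
  generalize (filter_and _ _ Hh' Hl). apply filter_imp. intros s [B1 B2].
  change (Rabs (h s - h t) < eps / 4) in B1. change (Rabs (A s - A t) < eps).
  assert (K1 := K s B2). assert (K2 := K t ltac:(rewrite Rminus_diag, Rabs_R0; lra)).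
  replace (A s - A t) with (- (h s - A s) + (h s - h t) + (h t - A t)) by ring.
  eapply Rle_lt_trans; [apply Rabs_triang|].
  eapply Rle_lt_trans; [apply Rplus_le_compat_r, Rabs_triang|]. rewrite Rabs_Ropp.
  generalize (cond_pos eps). lra.
Qed.

(** Picard iteration, in both time directions at once. The Lipschitz constant may grow
    with time, so the increments are measured against exp (4 L |t - t1|) on each bounded
    interval separately; in that weight every step halves them. *)
Theorem picard g1 g2 t1 a1 b1 : regular_field g1 g2 ->
  exists a b, a t1 = a1 /\ b t1 = b1 /\ ode_solution g1 g2 a b.
Proof.
  intros [Hc Hl].
  (* both components are treated together, indexed by a boolean *)
  set (g := fun i : bool => if i then g1 else g2).
  set (z0 := fun i : bool => if i then a1 else b1).
  set (Z := fix Z (k : nat) (i : bool) (t : R) {struct k} : R := match k with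
    | O => z0 i
    | S k => z0 i + RInt (fun s => g i s (Z k true s) (Z k false s)) t1 t end).
  assert (Hg : forall u v : R -> R, (forall t, continuous u t) -> (forall t, continuous v t) ->
    forall i t, continuous (fun t => g i t (u t) (v t)) t).
  { intros u v Hu Hv i t. destruct i; apply (Hc u v Hu Hv). }
  assert (Hlip : forall T, exists L, 0 < L /\ forall i t x y x' y', Rabs t <= T ->
    Rabs (g i t x y - g i t x' y') <= L * (Rabs (x - x') + Rabs (y - y'))).
  { intros T. destruct (Hl T) as (L & HL & H). exists L. split; [exact HL|].
    intros i t x y x' y' Ht. destruct i; apply (H t x y x' y' Ht). }
  assert (Cont : forall k i t, continuous (Z k i) t).
  { induction k as [|k IH]; intros i t.
    - apply continuous_const.
    - apply (ex_derive_continuous (Z (S k) i)). eexists.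
      apply (is_derive_RInt_cont (fun s => g i s (Z k true s) (Z k false s)) (z0 i) t1).
      intros r. apply Hg; apply IH. }
  assert (DZ : forall k i t, is_derive (Z (S k) i) t (g i t (Z k true t) (Z k false t))).
  { intros k i t. apply (is_derive_RInt_cont (fun s => g i s (Z k true s) (Z k false s)) (z0 i) t1).
    intros r. apply Hg; apply Cont. }
  assert (Zt1 : forall k i, Z k i t1 = z0 i).
  { intros [|k] i; [reflexivity|]. simpl. rewrite RInt_point. apply Rplus_0_r. }
  assert (near : forall T s, Rabs (s - t1) <= T -> Rabs s <= Rabs t1 + T).
  { intros T s Hs. generalize (Rabs_triang (s - t1) t1). replace (s - t1 + t1) with s by ring. lra. }
  assert (Geo : forall T, 0 <= T -> exists K, 0 <= K /\ forall k i t, Rabs (t - t1) <= T ->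
     Rabs (Z (S k) i t - Z k i t) <= K / 2 ^ k).
  { intros T HT. destruct (Hlip (Rabs t1 + T)) as (L & HL & HLip).
    assert (B0 : forall i, exists M, 0 <= M /\ forall t, Rabs (t - t1) <= T -> Rabs (Z 1%nat i t - Z 0%nat i t) <= M).
    { intros i. apply (continuous_bound (fun t => Z 1%nat i t - Z 0%nat i t)); [|exact HT].
      intros t. apply (continuous_minus (Z 1%nat i) (Z 0%nat i)); apply Cont. }
    destruct (B0 true) as (M1 & HM1 & BM1), (B0 false) as (M2 & HM2 & BM2).
    set (M := M1 + M2). assert (HM : 0 <= M) by (unfold M; lra).
    assert (Step : forall k i t, Rabs (t - t1) <= T ->
      Rabs (Z (S k) i t - Z k i t) <= M / 2 ^ k * exp (4 * L * Rabs (t - t1))).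
    { induction k as [|k IH]; intros i t Ht.
      - assert (HE : 1 <= exp (4 * L * Rabs (t - t1))).
        { generalize (exp_ineq1_le (4 * L * Rabs (t - t1))) (Rabs_pos (t - t1)). nra. }
        assert (Hi : Rabs (Z 1%nat i t - Z 0%nat i t) <= M).
        { unfold M. destruct i; [specialize (BM1 t Ht)|specialize (BM2 t Ht)]; lra. }
        eapply Rle_trans; [exact Hi|]. rewrite pow_O. unfold Rdiv. rewrite Rinv_1. nra.
      - assert (P2 : 0 < 2 ^ k) by (apply pow_lt; lra).
        assert (HMk : 0 <= M / 2 ^ k) by (apply Rdiv_le_0_compat; assumption).
        replace (M / 2 ^ S k) with (2 * L * (M / 2 ^ k) / (4 * L)) by (simpl; field; split; lra).
        apply (exp_growth (fun s => Z (S (S k)) i s - Z (S k) i s)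
          (fun s => g i s (Z (S k) true s) (Z (S k) false s) - g i s (Z k true s) (Z k false s)) t1 T); auto.
        + apply Rmult_le_pos; lra.
        + lra.
        + rewrite !Zt1. ring.
        + intros s _. apply (is_derive_minus (Z (S (S k)) i) (Z (S k) i)); apply DZ.
        + intros s Hs. eapply Rle_trans; [apply HLip, near, Hs|].
          generalize (IH true s Hs) (IH false s Hs). intros I1 I2.
          replace (2 * L * (M / 2 ^ k) * exp (4 * L * Rabs (s - t1))) with
            (L * (M / 2 ^ k * exp (4 * L * Rabs (s - t1)) + M / 2 ^ k * exp (4 * L * Rabs (s - t1)))) by ring.
          apply Rmult_le_compat_l; lra. }
    exists (M * exp (4 * L * T)). split; [apply Rmult_le_pos; [exact HM|apply Rlt_le, exp_pos]|].
    intros k i t Ht. eapply Rle_trans; [apply Step, Ht|].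
    replace (M * exp (4 * L * T) / 2 ^ k) with (M / 2 ^ k * exp (4 * L * T)) by (unfold Rdiv; ring).
    apply Rmult_le_compat_l; [apply Rdiv_le_0_compat; [exact HM|apply pow_lt; lra]|].
    assert (4 * L * Rabs (t - t1) <= 4 * L * T) by (apply Rmult_le_compat_l; lra).
    destruct (Req_dec (4 * L * Rabs (t - t1)) (4 * L * T)) as [->|Hne]; [lra|].
    apply Rlt_le, exp_increasing. lra. }
  assert (Lim : forall it : bool * R, exists l, forall K,
    (forall k, Rabs (Z (S k) (fst it) (snd it) - Z k (fst it) (snd it)) <= K / 2 ^ k) ->
    forall k, Rabs (Z k (fst it) (snd it) - l) <= 2 * K / 2 ^ k).
  { intros [i t]. destruct (Geo (Rabs (t - t1)) (Rabs_pos _)) as (K & HK & G).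
    apply (geo_lim (fun k => Z k i t) K). intros k. apply G. lra. }
  destruct (functional_choice _ Lim) as [lim Hlim]. set (z := fun i t => lim (i, t)).
  assert (Conv : forall T, 0 <= T -> exists K, 0 <= K /\ forall k i t, Rabs (t - t1) <= T ->
     Rabs (Z k i t - z i t) <= K / 2 ^ k).
  { intros T HT. destruct (Geo T HT) as (K & HK & G). exists (2 * K). split; [lra|].
    intros k i t Ht. apply (Hlim (i, t)). intros j. apply G, Ht. }
  assert (small : forall K eps, 0 <= K -> 0 < eps -> exists k, K / 2 ^ k <= eps).
  { intros K eps HK He. destruct (pow_lt_1_zero (/ 2) ltac:(rewrite Rabs_pos_eq; lra) (eps / (K + 1))) as [M HM].
    { apply Rdiv_lt_0_compat; lra. }
    exists M. specialize (HM M ltac:(lia)).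
    rewrite pow_inv, Rabs_pos_eq in HM by (apply Rlt_le, Rinv_0_lt_compat, pow_lt; lra).
    unfold Rdiv at 1. apply Rle_trans with ((K + 1) * / 2 ^ M).
    - apply Rmult_le_compat_r; [apply Rlt_le, Rinv_0_lt_compat, pow_lt; lra|lra].
    - apply Rle_trans with ((K + 1) * (eps / (K + 1))); [apply Rmult_le_compat_l; lra|].
      right. field. lra. }
  assert (Cz : forall i t, continuous (z i) t).
  { intros i t. apply continuous_unif_lim. intros eps He.
    destruct (Conv (Rabs (t - t1) + 1) ltac:(generalize (Rabs_pos (t - t1)); lra)) as (K & HK & G).
    destruct (small K eps HK He) as (k & Hk).
    exists (Z k i). split; [apply Cont|]. exists 1. split; [lra|]. intros s Hs.
    eapply Rle_trans; [apply G|exact Hk]. generalize (Rabs_triang (s - t) (t - t1)).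
    replace (s - t + (t - t1)) with (s - t1) by ring. lra. }
  assert (zt1 : forall i, z i t1 = z0 i).
  { intros i. apply Rminus_diag_uniq. apply Rabs_eq_0. apply Rle_antisym; [|apply Rabs_pos].
    apply le_epsilon. intros eps He.
    destruct (Conv 0 ltac:(lra)) as (K & HK & G). destruct (small K eps HK He) as (k & Hk).
    specialize (G k i t1 ltac:(rewrite Rminus_diag, Rabs_R0; lra)). rewrite Zt1 in G.
    rewrite Rabs_minus_sym. lra. }
  assert (Int : forall i t, z0 i + RInt (fun s => g i s (z true s) (z false s)) t1 t = z i t).
  { intros i t. apply Rminus_diag_uniq. apply Rabs_eq_0. apply Rle_antisym; [|apply Rabs_pos].
    apply le_epsilon. intros eps He.
    set (T := Rabs (t - t1)). assert (HT : 0 <= T) by apply Rabs_pos.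
    destruct (Conv T HT) as (K & HK & G). destruct (Hlip (Rabs t1 + T)) as (L & HL & HLip).
    destruct (small (2 * L * K * T + K) eps) as (k & Hk); [|exact He|].
    { assert (0 <= L * K * T) by (repeat apply Rmult_le_pos; lra). lra. }
    set (J := fun t => z0 i + RInt (fun s => g i s (z true s) (z false s)) t1 t).
    assert (BV : Rabs ((J t - Z (S k) i t) - (J t1 - Z (S k) i t1)) <= L * (2 * (K / 2 ^ k)) * Rabs (t - t1)).
    { apply (bounded_variation (fun t => J t - Z (S k) i t)
        (fun s => g i s (z true s) (z false s) - g i s (Z k true s) (Z k false s)) (L * (2 * (K / 2 ^ k))) t1 t).
      intros s Hs. split.
      - apply (is_derive_minus J (Z (S k) i)); [|apply DZ].
        apply (is_derive_RInt_cont (fun s => g i s (z true s) (z false s))). intros r. apply Hg; apply Cz.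
      - eapply Rle_trans; [apply HLip, near, Hs|].
        apply Rmult_le_compat_l; [lra|]. generalize (G k true s Hs) (G k false s Hs).
        rewrite (Rabs_minus_sym (z true s)), (Rabs_minus_sym (z false s)). lra. }
    assert (J1 : J t1 = z0 i) by (unfold J; rewrite RInt_point; apply Rplus_0_r).
    rewrite J1, Zt1, Rminus_diag, Rminus_0_r in BV. fold T in BV.
    specialize (G (S k) i t (Rle_refl _)).
    fold (J t). replace (J t - z i t) with ((J t - Z (S k) i t) + (Z (S k) i t - z i t)) by ring.
    eapply Rle_trans; [apply Rabs_triang|].
    assert (P2 : 0 < 2 ^ k) by (apply pow_lt; lra).
    assert (K / 2 ^ S k <= K / 2 ^ k).
    { apply Rmult_le_compat_l; [lra|]. apply Rinv_le_contravar; [exact P2|]. simpl. lra. }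
    replace ((2 * L * K * T + K) / 2 ^ k) with (L * (2 * (K / 2 ^ k)) * T + K / 2 ^ k) in Hk by (unfold Rdiv; ring).
    lra. }
  assert (Dz : forall i t, is_derive (z i) t (g i t (z true t) (z false t))).
  { intros i t. apply (is_derive_ext (fun t => z0 i + RInt (fun s => g i s (z true s) (z false s)) t1 t)); [apply Int|].
    apply (is_derive_RInt_cont (fun s => g i s (z true s) (z false s))). intros r. apply Hg; apply Cz. }
  exists (z true), (z false). split; [apply (zt1 true)|]. split; [apply (zt1 false)|].
  intros t. split; [apply (Dz true)|apply (Dz false)].
Qed.

(** Continuous dependence on the initial point, from the growth of the squared distance. *)
Lemma gronwall g1 g2 t0 T : regular_field g1 g2 -> t0 <= T -> exists M, 0 < M /\
  forall a b a' b', ode_solution g1 g2 a b -> ode_solution g1 g2 a' b' ->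
  (a T - a' T) ^ 2 + (b T - b' T) ^ 2 <= M * ((a t0 - a' t0) ^ 2 + (b t0 - b' t0) ^ 2).
Proof.
  intros [_ Hl] HT. destruct (Hl (Rabs t0 + Rabs T)) as (L & HL & HLip).
  exists (exp (4 * L * (T - t0))). split; [apply exp_pos|].
  intros a b a' b' S S'.
  set (E := fun t => (a t - a' t) ^ 2 + (b t - b' t) ^ 2).
  set (E' := fun t => 2 * (a t - a' t) * (g1 t (a t) (b t) - g1 t (a' t) (b' t)) +
                      2 * (b t - b' t) * (g2 t (a t) (b t) - g2 t (a' t) (b' t))).
  assert (HE : forall t, is_derive E t (E' t)).
  { intros t. destruct (S t) as [A1 A2], (S' t) as [B1 B2]. unfold E, E'.
    auto_derive.
    - repeat split; eexists; eassumption.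
    - apply is_derive_unique in A1, A2, B1, B2.
      assert (E1 : Derive (fun x : R => a x) t = g1 t (a t) (b t)) by exact A1.
      assert (E2 : Derive (fun x : R => b x) t = g2 t (a t) (b t)) by exact A2.
      assert (E3 : Derive (fun x : R => a' x) t = g1 t (a' t) (b' t)) by exact B1.
      assert (E4 : Derive (fun x : R => b' x) t = g2 t (a' t) (b' t)) by exact B2.
      rewrite E1, E2, E3, E4. ring. }
  assert (K : E T * exp (- (4 * L * (T - t0))) <= E t0).
  { generalize (nondec (fun t => - (E t * exp (- (4 * L * (t - t0)))))
      (fun t => - (E' t * exp (- (4 * L * (t - t0))) + E t * (- (4 * L) * exp (- (4 * L * (t - t0)))))) t0 T HT).
    intros N. cbv beta in N. replace (exp (- (4 * L * (t0 - t0)))) with 1 in N.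
    2:{ rewrite Rminus_diag, Rmult_0_r, Ropp_0, exp_0. reflexivity. }
    assert (N' : - (E t0 * 1) <= - (E T * exp (- (4 * L * (T - t0))))); [|lra].
    apply N.
    - intros t Ht. apply (is_derive_opp (fun t => E t * exp (- (4 * L * (t - t0))))).
      apply (is_derive_mult E (fun t => exp (- (4 * L * (t - t0))))); [apply HE| |intros; apply Rmult_comm].
      auto_derive; [exact I|]. fold (t - t0). ring.
    - intros t Ht.
      replace (- (E' t * exp (- (4 * L * (t - t0))) + E t * (- (4 * L) * exp (- (4 * L * (t - t0))))))
        with ((4 * L * E t - E' t) * exp (- (4 * L * (t - t0)))) by ring.
      apply Rmult_le_pos; [|apply Rlt_le, exp_pos].
      assert (Htt : Rabs t <= Rabs t0 + Rabs T).
      { unfold Rabs. destruct (Rcase_abs t), (Rcase_abs t0), (Rcase_abs T); lra. }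
      destruct (HLip t (a t) (b t) (a' t) (b' t) Htt) as [L1 L2].
      unfold E, E'. rewrite <- (pow2_abs (a t - a' t)), <- (pow2_abs (b t - b' t)).
      set (x := Rabs (a t - a' t)) in *. set (y := Rabs (b t - b' t)) in *.
      assert (X0 : 0 <= x) by apply Rabs_pos. assert (Y0 : 0 <= y) by apply Rabs_pos.
      assert (A1 : (a t - a' t) * (g1 t (a t) (b t) - g1 t (a' t) (b' t)) <= x * (L * (x + y))).
      { eapply Rle_trans; [apply Rle_abs|]. rewrite Rabs_mult. apply Rmult_le_compat_l; auto. }
      assert (A2 : (b t - b' t) * (g2 t (a t) (b t) - g2 t (a' t) (b' t)) <= y * (L * (x + y))).
      { eapply Rle_trans; [apply Rle_abs|]. rewrite Rabs_mult. apply Rmult_le_compat_l; auto. }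
      assert (0 <= L * (x - y) ^ 2) by (apply Rmult_le_pos; [lra|apply pow2_ge_0]). nra. }
  unfold E in K at 1. fold (E T). fold (E t0).
  replace (E T) with (exp (4 * L * (T - t0)) * (E T * exp (- (4 * L * (T - t0))))).
  - apply Rmult_le_compat_l; [apply Rlt_le, exp_pos|exact K].
  - rewrite exp_Ropp. field. apply Rgt_not_eq, exp_pos.
Qed.

(** Otherwise every initial point leaves the tube at some time, and by continuous dependence so do
    its neighbours; finitely many such neighbourhoods cover the square of initial points, so all
    solutions would leave before a common time. *)
Theorem stay_forever g1 g2 (Tube : R -> R -> R -> Prop) t0 B : regular_field g1 g2 ->
  (forall t a b, ~ Tube t a b -> exists d, 0 < d /\ forall a' b', (a' - a) ^ 2 + (b' - b) ^ 2 < d -> ~ Tube t a' b') ->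
  (forall T, t0 <= T -> exists a b, ode_solution g1 g2 a b /\ Rabs (a t0) <= B /\ Rabs (b t0) <= B /\
     forall t, t0 <= t <= T -> Tube t (a t) (b t)) ->
  exists a b, ode_solution g1 g2 a b /\ forall t, t0 <= t -> Tube t (a t) (b t).
Proof.
  intros Hrf Hcl Hfin. apply NNPP. intros Hno.
  assert (Hexit : forall v : Compactness.Tn 2 R, exists dt : posreal * R, t0 <= snd dt /\
     forall a b, ode_solution g1 g2 a b -> close_n 2 (fst dt) (a t0, (b t0, tt)) v -> ~ Tube (snd dt) (a (snd dt)) (b (snd dt))).
  { intros (x & y & []).
    destruct (picard g1 g2 t0 x y Hrf) as (a & b & Ea & Eb & Hs).
    destruct (classic (exists t, t0 <= t /\ ~ Tube t (a t) (b t))) as [(t & Ht & Hn)|Hall].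
    - destruct (Hcl _ _ _ Hn) as (d & Hd & Hopen).
      destruct (gronwall g1 g2 t0 t Hrf Ht) as (M & HM & HG).
      set (e := Rmin 1 (d / (4 * M))).
      assert (He : 0 < e) by (apply Rmin_pos; [lra|apply Rdiv_lt_0_compat; lra]).
      exists (mkposreal e He, t). split; [exact Ht|]. simpl. intros a' b' Hs' (C1 & C2 & _).
      apply Hopen. eapply Rle_lt_trans; [apply (HG _ _ _ _ Hs' Hs)|].
      rewrite Ea, Eb, <- (pow2_abs (a' t0 - x)), <- (pow2_abs (b' t0 - y)).
      assert (e <= 1) by apply Rmin_l. assert (E2 : e <= d / (4 * M)) by apply Rmin_r.
      generalize (Rabs_pos (a' t0 - x)) (Rabs_pos (b' t0 - y)). intros P1 P2.
      assert (Q1 : Rabs (a' t0 - x) ^ 2 <= e) by nra.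
      assert (Q2 : Rabs (b' t0 - y) ^ 2 <= e) by nra.
      apply Rle_lt_trans with (M * (2 * (d / (4 * M)))).
      + apply Rmult_le_compat_l; lra.
      + replace (M * (2 * (d / (4 * M)))) with (d / 2) by (field; lra). lra.
    - elim Hno. exists a, b. split; [exact Hs|]. intros t Ht. apply NNPP. intros Hn. apply Hall. exists t. auto. }
  destruct (functional_choice _ Hexit) as [dt Hdt].
  destruct (NNPP _ (compactness_list 2 (- B, (- B, tt)) (B, (B, tt)) (fun v => fst (dt v)))) as [l Hl].
  assert (Hmax : exists T, t0 <= T /\ forall v, In v l -> snd (dt v) <= T).
  { clear Hl. induction l as [|v l (T & HT & HTl)].
    - exists t0. split; [lra|]. intros v [].
    - exists (Rmax T (snd (dt v))). split; [eapply Rle_trans; [exact HT|apply Rmax_l]|].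
      intros v' [<-|Hv]; [apply Rmax_r|]. eapply Rle_trans; [apply HTl, Hv|apply Rmax_l]. }
  destruct Hmax as (T & HT & HTl).
  destruct (Hfin T HT) as (a & b & Hs & Ba & Bb & Hin).
  destruct (Hl (a t0, (b t0, tt))) as (v & V1 & _ & V3).
  { simpl. apply Rabs_le_between in Ba, Bb. auto. }
  destruct (Hdt v) as [K1 K2]. apply (K2 a b Hs V3). apply Hin. split; [exact K1|apply HTl, V1].
Qed.

Lemma sq_le_abs u w : 0 <= w -> u ^ 2 <= w ^ 2 -> Rabs u <= w.
Proof.
  intros Hw H. apply Rnot_lt_le. intros Hlt. rewrite <- pow2_abs in H.
  assert (w * w < Rabs u * Rabs u) by (apply Rmult_le_0_lt_compat; lra). simpl in H. lra.
Qed.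

Definition clamp (r x : R) : R := Rmax (- r) (Rmin r x).

Lemma clamp_bound r x : 0 <= r -> Rabs (clamp r x) <= r.
Proof.
  intros Hr. unfold clamp. apply Rabs_le. split; [apply Rmax_l|].
  apply Rmax_lub; [lra|apply Rmin_l].
Qed.

Lemma clamp_id r x : Rabs x <= r -> clamp r x = x.
Proof.
  intros H. apply Rabs_le_between in H. unfold clamp. rewrite Rmin_right by lra. apply Rmax_right. lra.
Qed.

Lemma clamp_lip r x y : 0 <= r -> Rabs (clamp r x - clamp r y) <= Rabs (x - y).
Proof.
  intros Hr. unfold clamp, Rmax, Rmin.
  repeat destruct (Rle_dec _ _); unfold Rabs; repeat destruct (Rcase_abs _); lra.
Qed.

Lemma continuous_clamp (r x : R -> R) t : continuous r t -> continuous x t ->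
  continuous (fun t => clamp (r t) (x t)) t.
Proof.
  intros Hr Hx. unfold clamp.
  assert (E : forall a b, Rmax (- a) (Rmin a b) =
     ((- a + (a + b - Rabs (a - b)) / 2) + Rabs (- a - (a + b - Rabs (a - b)) / 2)) / 2).
  { intros a b. unfold Rmax, Rmin, Rabs. repeat destruct (Rle_dec _ _); repeat destruct (Rcase_abs _); lra. }
  apply (continuous_ext (fun t => ((- r t + (r t + x t - Rabs (r t - x t)) / 2) + Rabs (- r t - (r t + x t - Rabs (r t - x t)) / 2)) / 2)).
  { intros u. symmetry. apply E. }
  assert (Hm : continuous (fun t => (r t + x t - Rabs (r t - x t)) / 2) t).
  { apply (continuous_mult (fun t => r t + x t - Rabs (r t - x t)) (fun _ => / 2)); [|apply continuous_const].
    apply (continuous_minus (fun t => r t + x t) (fun t => Rabs (r t - x t))).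
    - apply (continuous_plus r x); auto.
    - apply (continuous_comp (fun t => r t - x t) Rabs); [apply (continuous_minus r x); auto|apply continuous_Rabs]. }
  assert (Hn : continuous (fun t => - r t) t) by (apply (continuous_opp r); auto).
  apply (continuous_mult (fun t => (- r t + (r t + x t - Rabs (r t - x t)) / 2) + Rabs (- r t - (r t + x t - Rabs (r t - x t)) / 2)) (fun _ => / 2)); [|apply continuous_const].
  apply (continuous_plus (fun t => - r t + (r t + x t - Rabs (r t - x t)) / 2)).
  - apply (continuous_plus (fun t => - r t)); auto.
  - apply (continuous_comp (fun t => - r t - (r t + x t - Rabs (r t - x t)) / 2) Rabs); [|apply continuous_Rabs].
    apply (continuous_minus (fun t => - r t)); auto.
Qed.

Lemma continuous_Rmax_id t0 t : continuous (fun t => Rmax t t0) t.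
Proof.
  apply (continuous_ext (fun t => (t + t0 + Rabs (t - t0)) / 2)).
  { intros u. unfold Rmax, Rabs. destruct (Rle_dec _ _), (Rcase_abs _); lra. }
  apply (continuous_mult (fun t => t + t0 + Rabs (t - t0)) (fun _ => / 2)); [|apply continuous_const].
  apply (continuous_plus (fun t => t + t0)).
  - apply (continuous_plus (fun t : R => t) (fun _ => t0)); [apply continuous_id|apply continuous_const].
  - apply (continuous_comp (fun t => t - t0) Rabs); [|apply continuous_Rabs].
    apply (continuous_minus (fun t : R => t) (fun _ => t0)); [apply continuous_id|apply continuous_const].
Qed.

Lemma open_pos (F : R -> R -> R) a b : continuous (fun z : R * R => F (fst z) (snd z)) (a, b) -> 0 < F a b ->
  exists d, 0 < d /\ forall a' b', (a' - a) ^ 2 + (b' - b) ^ 2 < d -> 0 < F a' b'.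
Proof.
  intros Hc HF. destruct (proj1 (filterlim_locally _ _) Hc (mkposreal _ HF)) as [d Hd].
  exists (d ^ 2). assert (D := cond_pos d). split; [apply pow_lt, D|]. intros a' b' H.
  assert (K : forall z w, z ^ 2 + w ^ 2 < d ^ 2 -> Rabs z < d).
  { intros z w Hzw. apply Rnot_le_lt. intros Hle.
    assert (d ^ 2 <= Rabs z ^ 2) by (apply pow_incr; lra). rewrite pow2_abs in H0.
    generalize (pow2_ge_0 w). lra. }
  assert (B : Rabs (F a' b' - F a b) < F a b).
  { apply (Hd (a', b')). split.
    - apply (K (a' - a) (b' - b)). exact H.
    - apply (K (b' - b) (a' - a)). lra. }
  apply Rabs_lt_between in B. lra.
Qed.

Lemma continuous_quadratic A B C x0 y0 d (z : R * R) :
  continuous (fun z : R * R => A * (snd z - y0) ^ 2 + B * ((fst z - x0) * (snd z - y0)) + C * (fst z - x0) ^ 2 - d) z.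
Proof.
  assert (Hx : continuous (fun z : R * R => fst z - x0) z).
  { apply (continuous_minus (fun z : R * R => fst z) (fun _ => x0)); [apply continuous_fst|apply continuous_const]. }
  assert (Hy : continuous (fun z : R * R => snd z - y0) z).
  { apply (continuous_minus (fun z : R * R => snd z) (fun _ => y0)); [apply continuous_snd|apply continuous_const]. }
  assert (Hm : forall f g : R * R -> R, continuous f z -> continuous g z -> continuous (fun z => f z * g z) z).
  { intros f g Hf Hg. apply (continuous_mult f g); assumption. }
  assert (Hp : forall f g : R * R -> R, continuous f z -> continuous g z -> continuous (fun z => f z + g z) z).
  { intros f g Hf Hg. apply (continuous_plus f g); assumption. }
  assert (Hc : forall c : R, continuous (fun _ : R * R => c) z) by (intros; apply continuous_const).
  apply (continuous_ext (fun z : R * R => A * ((snd z - y0) * (snd z - y0)) + B * ((fst z - x0) * (snd z - y0)) + C * ((fst z - x0) * (fst z - x0)) + - d)).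
  { intros w. simpl. ring. }
  apply Hp; [|apply Hc]. apply Hp; [apply Hp|]; (apply Hm; [apply Hc|]); apply Hm; assumption.
Qed.

(** Shooting: the final value of the first component depends continuously on its initial value,
    and has opposite signs at the two ends of the interval. *)
Lemma shooting g1 g2 t0 T r : regular_field g1 g2 -> t0 <= T -> 0 <= r ->
  (forall a b, ode_solution g1 g2 a b -> r <= a t0 -> 0 <= a T) ->
  (forall a b, ode_solution g1 g2 a b -> a t0 <= - r -> a T <= 0) ->
  exists a b, ode_solution g1 g2 a b /\ Rabs (a t0) <= r /\ b t0 = 0 /\ a T = 0.
Proof.
  intros Hrf HT Hr Hup Hdown.
  assert (HS : forall a0 : R, exists ab : (R -> R) * (R -> R), fst ab t0 = a0 /\ snd ab t0 = 0 /\ ode_solution g1 g2 (fst ab) (snd ab)).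
  { intros a0. destruct (picard g1 g2 t0 a0 0 Hrf) as (a & b & H). exists (a, b). exact H. }
  destruct (functional_choice _ HS) as [S HSp].
  destruct (gronwall g1 g2 t0 T Hrf HT) as (M & HM & HG).
  set (end_ := fun a0 => fst (S a0) T).
  assert (Hlip : forall x y, Rabs (end_ x - end_ y) <= (M + 1) * Rabs (x - y)).
  { intros x y. destruct (HSp x) as (X1 & X2 & X3), (HSp y) as (Y1 & Y2 & Y3).
    specialize (HG _ _ _ _ X3 Y3). rewrite X1, X2, Y1, Y2 in HG. unfold end_.
    apply sq_le_abs; [apply Rmult_le_pos; [lra|apply Rabs_pos]|].
    rewrite Rpow_mult_distr, pow2_abs.
    assert (P1 := pow2_ge_0 (x - y)). assert (P2 := pow2_ge_0 (snd (S x) T - snd (S y) T)). 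
    assert (M * (x - y) ^ 2 <= (M + 1) ^ 2 * (x - y) ^ 2) by (apply Rmult_le_compat_r; [exact P1|nra]).
    replace ((0 - 0) ^ 2) with 0 in HG by ring. lra. }
  assert (Hcont : continuity end_).
  { intros x. apply continuity_pt_filterlim. apply filterlim_locally. intros eps.
    assert (Hd : 0 < eps / (M + 1)) by (apply Rdiv_lt_0_compat; [apply cond_pos|lra]).
    exists (mkposreal _ Hd). intros y Hy. change (Rabs (y - x) < eps / (M + 1)) in Hy. change (Rabs (end_ y - end_ x) < eps).
    eapply Rle_lt_trans; [apply Hlip|]. apply Rlt_le_trans with ((M + 1) * (eps / (M + 1))).
    - apply Rmult_lt_compat_l; lra.
    - right. field. lra. }
  destruct (HSp r) as (X1 & X2 & X3), (HSp (- r)) as (Y1 & Y2 & Y3).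
  assert (E1 : 0 <= end_ r) by (apply (Hup _ _ X3); lra).
  assert (E2 : end_ (- r) <= 0) by (apply (Hdown _ _ Y3); lra).
  destruct (IVT_gen end_ (- r) r 0 Hcont) as (x & Hx & Ex).
  { split; [eapply Rle_trans; [apply Rmin_l|exact E2]|eapply Rle_trans; [exact E1|apply Rmax_r]]. }
  destruct (HSp x) as (Z1 & Z2 & Z3). exists (fst (S x)), (snd (S x)).
  rewrite Rmin_left, Rmax_right in Hx by lra.
  split; [exact Z3|]. split; [rewrite Z1; apply Rabs_le; lra|]. split; assumption.
Qed.

(** * Scalar differential inequalities *)

Lemma derive_neg_right (f : R -> R) t l : is_derive f t l -> l < 0 ->
  exists d, 0 < d /\ forall h, 0 < h < d -> f (t + h) < f t.
Proof.
  intros H Hl. apply is_derive_Reals in H. destruct (H (- l / 2)) as [d Hd]; [lra|].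
  exists d. split; [apply cond_pos|]. intros h Hh.
  specialize (Hd h ltac:(lra) ltac:(rewrite Rabs_pos_eq; lra)). apply Rabs_lt_between in Hd.
  assert (E : (f (t + h) - f t) / h < 0) by lra.
  assert (K : (f (t + h) - f t) / h * h < 0 * h) by (apply Rmult_lt_compat_r; lra).
  unfold Rdiv in K. rewrite Rmult_assoc, Rinv_l in K by lra. lra.
Qed.

Lemma continuous_pos_near (f : R -> R) t : continuous f t -> 0 < f t ->
  exists d, 0 < d /\ forall s, Rabs (s - t) < d -> 0 < f s.
Proof.
  intros H Hf. destruct (proj1 (filterlim_locally _ _) H (mkposreal _ Hf)) as [d Hd].
  exists d. split; [apply cond_pos|]. intros s Hs. specialize (Hd s Hs).
  change (Rabs (f s - f t) < f t) in Hd. apply Rabs_lt_between in Hd. lra.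
Qed.

(** At the last time before t1 at which f is nonpositive, f would vanish with a negative
    derivative. *)
Lemma barrier (f f' : R -> R) t0 T :
  (forall t, t0 <= t <= T -> is_derive f t (f' t)) ->
  (forall t, t0 <= t <= T -> f t = 0 -> f' t < 0) -> f t0 <= 0 ->
  forall t, t0 <= t <= T -> f t <= 0.
Proof.
  intros Hd H0 Hs t1 Ht1. apply Rnot_lt_le. intros Hpos.
  destruct (completeness (fun t => t0 <= t <= t1 /\ f t <= 0)) as [m [Hub Hlub]].
  - exists t1. intros t [Ht _]. lra.
  - exists t0. split; [lra|exact Hs].
  - assert (Hm : t0 <= m <= t1).
    { split; [apply Hub; split; [lra|exact Hs]|]. apply Hlub. intros t [Ht _]. lra. }
    assert (Hc : continuous f m).
    { apply (ex_derive_continuous f). eexists. apply Hd. lra. }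
    assert (Hfm : f m <= 0).
    { apply Rnot_lt_le. intros Hp. destruct (continuous_pos_near f m Hc Hp) as (d & Hdp & K).
      assert (m <= m - d); [|lra]. apply Hlub. intros t [Ht Hft].
      apply Rnot_lt_le. intros Hlt. assert (t <= m) by (apply Hub; split; assumption).
      specialize (K t ltac:(apply Rabs_lt_between; lra)). lra. }
    assert (Hlt : m < t1).
    { destruct (Req_dec m t1) as [E|E]; [rewrite E in Hfm; lra|lra]. }
    assert (Hr : exists d, 0 < d /\ forall h, 0 < h < d -> f (m + h) <= 0).
    { destruct (Req_dec (f m) 0) as [E|E].
      - destruct (derive_neg_right f m (f' m)) as (d & Hdp & K); [apply Hd; lra|apply H0; [lra|exact E]|].
        exists d. split; [exact Hdp|]. intros h Hh. specialize (K h Hh). lra.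
      - destruct (continuous_pos_near (fun t => - f t) m) as (d & Hdp & K).
        + apply (continuous_opp f), Hc.
        + lra.
        + exists d. split; [exact Hdp|]. intros h Hh.
          specialize (K (m + h) ltac:(apply Rabs_lt_between; lra)). lra. }
    destruct Hr as (d & Hdp & K). set (h := Rmin (d / 2) (t1 - m)).
    assert (Hh : 0 < h) by (apply Rmin_pos; lra).
    assert (h <= d / 2) by apply Rmin_l. assert (h <= t1 - m) by apply Rmin_r.
    assert (m + h <= m); [|lra]. apply Hub. split; [lra|]. apply K. lra.
Qed.

Lemma barrier_back (f f' : R -> R) t0 T :
  (forall t, t0 <= t <= T -> is_derive f t (f' t)) ->
  (forall t, t0 <= t <= T -> f t = 0 -> 0 < f' t) -> f T <= 0 ->
  forall t, t0 <= t <= T -> f t <= 0.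
Proof.
  intros Hd H0 Hs t Ht.
  generalize (barrier (fun s => f (t0 + T - s)) (fun s => - f' (t0 + T - s)) t0 T). intros B.
  replace t with (t0 + T - (t0 + T - t)) by ring. apply B; try lra.
  - intros s Hs'. evar_last.
    + apply (is_derive_comp f (fun s => t0 + T - s)); [apply Hd; lra|auto_derive; [exact I|reflexivity]].
    + unfold scal; simpl; unfold mult; simpl. ring.
  - intros s Hs' E. specialize (H0 (t0 + T - s) ltac:(lra) E). lra.
  - replace (t0 + T - t0) with T by ring. exact Hs.
Qed.

Lemma is_derive_svpow p j t : (0 < p)%nat -> 0 < t ->
  is_derive (fun t => sv p t ^ j) t (- (INR j / INR p) * sv p t ^ (j + p)).
Proof.
  intros Hp Ht. assert (INR p <> 0) by (apply not_0_INR; lia).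
  evar_last; [apply is_derive_pow, is_derive_sv; auto|].
  destruct j as [|j].
  - simpl. unfold Rdiv. ring.
  - simpl pred. replace (S j + p)%nat with (j + (p + 1))%nat by lia. rewrite (pow_add _ j (p + 1)). field. auto.
Qed.

Lemma is_derive_svinv p j t : (0 < p)%nat -> 0 < t ->
  is_derive (fun t => / sv p t ^ j) t (INR j / INR p * sv p t ^ p * / sv p t ^ j).
Proof.
  intros Hp Ht. assert (INR p <> 0) by (apply not_0_INR; lia).
  assert (Hs : sv p t ^ j <> 0) by (apply pow_nonzero, Rgt_not_eq, sv_pos).
  evar_last; [apply is_derive_inv; [apply is_derive_svpow; auto|exact Hs]|].
  rewrite pow_add. field. auto.
Qed.

(** The weight s^(-c) turns the admitted loss into monotonicity up to the forcing, and the a priori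
    bound s^M with M > c lets the weighted function start from 0 at infinity. *)
Lemma decay_from_infinity p c M J B T0 (f f' : R -> R) : (0 < p)%nat -> (c < M)%nat -> (c + p + 1 <= J)%nat ->
  0 < T0 -> 0 <= B -> (forall t, T0 < t -> is_derive f t (f' t)) ->
  (forall t, T0 < t -> - (INR c / INR p) * sv p t ^ p * f t - B * sv p t ^ J <= f' t) ->
  bigO p M f -> forall t, T0 < t -> f t <= B * INR p * sv p t ^ (J - p).
Proof.
  intros Hp HcM HJ HT0 HB Hd Hf HM t Ht.
  assert (Hp0 : 0 < INR p) by (apply lt_0_INR; lia).
  set (j := (J - c - p)%nat).
  set (phi := fun t => f t * / sv p t ^ c - B * INR p * sv p t ^ j).
  assert (Hphi : forall u, t <= u -> phi t <= phi u).
  { intros u Hu. apply (nondec phi (fun t => (f' t * / sv p t ^ c + f t * (INR c / INR p * sv p t ^ p * / sv p t ^ c))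
       - B * INR p * (- (INR j / INR p) * sv p t ^ (j + p)))); [exact Hu| |].
    - intros x Hx. apply (is_derive_minus (fun t => f t * / sv p t ^ c) (fun t => B * INR p * sv p t ^ j)).
      + apply (is_derive_mult f (fun t => / sv p t ^ c)); [apply Hd; lra|apply is_derive_svinv; [exact Hp|lra]|intros; apply Rmult_comm].
      + apply (is_derive_scal (fun t => sv p t ^ j)). apply is_derive_svpow; [exact Hp|lra].
    - intros x Hx. set (s := sv p x). assert (Hs : 0 < s) by apply sv_pos.
      specialize (Hf x ltac:(lra)). fold s in Hf.
      assert (Hj : 1 <= INR j) by (apply (le_INR 1); unfold j; lia).
      replace (f' x * / s ^ c + f x * (INR c / INR p * s ^ p * / s ^ c) - B * INR p * (- (INR j / INR p) * s ^ (j + p)))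
        with ((f' x + INR c / INR p * s ^ p * f x + B * INR j * s ^ J) * / s ^ c).
      + apply Rmult_le_pos; [|apply Rlt_le, Rinv_0_lt_compat, pow_lt, Hs].
        assert (0 <= B * (INR j - 1) * s ^ J).
        { apply Rmult_le_pos; [apply Rmult_le_pos; lra|apply pow_le; lra]. } lra.
      + replace J with (j + p + c)%nat by (unfold j; lia). rewrite (pow_add s (j + p) c). field.
        repeat split; try apply pow_nonzero; lra. }
  assert (Hlim : phi t <= 0).
  { apply le_epsilon. intros eps He. rewrite Rplus_0_l.
    destruct HM as (C & HC & HM).
    destruct (sv_eventually p (eps / (C + 1)) Hp ltac:(apply Rdiv_lt_0_compat; lra)) as [T1 H1].
    destruct HM as [T2 H2].
    set (u := Rmax t (Rmax T1 T2) + 1).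
    assert (t <= Rmax t (Rmax T1 T2)) by apply Rmax_l.
    assert (Rmax T1 T2 <= Rmax t (Rmax T1 T2)) by apply Rmax_r.
    assert (T1 <= Rmax T1 T2) by apply Rmax_l. assert (T2 <= Rmax T1 T2) by apply Rmax_r.
    specialize (H1 u ltac:(unfold u; lra)). specialize (H2 u ltac:(unfold u; lra)).
    eapply Rle_trans; [apply (Hphi u); unfold u; lra|]. unfold phi.
    set (s := sv p u) in *. assert (Hs : 0 < s) by lra.
    assert (f u * / s ^ c <= C * s).
    { apply Rle_div_l; [apply pow_lt, Hs|].
      eapply Rle_trans; [apply Rle_abs|]. eapply Rle_trans; [exact H2|].
      replace (C * s * s ^ c) with (C * s ^ (S c)) by (simpl; ring).
      apply Rmult_le_compat_l; [exact HC|]. apply pow_le_pow; [lra|lia]. }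
    assert (C * s <= eps).
    { apply Rle_trans with ((C + 1) * (eps / (C + 1))); [apply Rmult_le_compat; lra|]. right; field; lra. }
    assert (0 <= B * INR p * s ^ j).
    { apply Rmult_le_pos; [apply Rmult_le_pos; lra|apply pow_le; lra]. } lra. }
  unfold phi in Hlim. assert (Hs : 0 < sv p t) by apply sv_pos.
  replace (J - p)%nat with (j + c)%nat by (unfold j; lia). rewrite pow_add.
  assert (Hc : 0 < sv p t ^ c) by (apply pow_lt, Hs).
  replace (f t) with (f t * / sv p t ^ c * sv p t ^ c) by (field; lra).
  rewrite <- Rmult_assoc. apply Rmult_le_compat_r; lra.
Qed.

(** Multiplied by s^(-J), the function grows at most linearly in t = s^(-p). *)
Lemma decay_by_damping p J B T0 (f f' : R -> R) : (0 < p)%nat -> (p <= J)%nat ->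
  0 < T0 -> 0 <= B -> (forall t, T0 < t -> is_derive f t (f' t)) ->
  (forall t, T0 < t -> f' t <= - (INR J / INR p) * sv p t ^ p * f t + B * sv p t ^ J) ->
  exists C, 0 <= C /\ at_infty (fun t => f t <= C * sv p t ^ (J - p)).
Proof.
  intros Hp HJ HT0 HB Hd Hf.
  assert (Hp0 : 0 < INR p) by (apply lt_0_INR; lia).
  set (T1 := T0 + 1).
  set (phi := fun t => B * t - f t * / sv p t ^ J).
  assert (Hphi : forall u, T1 <= u -> phi T1 <= phi u).
  { intros u Hu. apply (nondec phi (fun t => B * 1 - (f' t * / sv p t ^ J + f t * (INR J / INR p * sv p t ^ p * / sv p t ^ J)))); [exact Hu| |].
    - intros x Hx. unfold T1 in Hx. apply (is_derive_minus (fun t => B * t) (fun t => f t * / sv p t ^ J)).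
      + apply (is_derive_scal (fun t => t)). apply @is_derive_id.
      + apply (is_derive_mult f (fun t => / sv p t ^ J)); [apply Hd; lra|apply is_derive_svinv; [exact Hp|lra]|intros; apply Rmult_comm].
    - intros x Hx. unfold T1 in Hx. set (s := sv p x). assert (Hs : 0 < s) by apply sv_pos.
      specialize (Hf x ltac:(lra)). fold s in Hf.
      replace (B * 1 - (f' x * / s ^ J + f x * (INR J / INR p * s ^ p * / s ^ J))) with
        ((B * s ^ J - (f' x + INR J / INR p * s ^ p * f x)) * / s ^ J).
      + apply Rmult_le_pos; [lra|apply Rlt_le, Rinv_0_lt_compat, pow_lt, Hs].
      + field. repeat split; try apply pow_nonzero; lra. }
  exists (Rabs (phi T1) + B). split; [generalize (Rabs_pos (phi T1)); lra|].
  generalize (filter_and _ _ (sv_eventually p 1 Hp Rlt_0_1) (ex_intro _ T1 (fun t (H : T1 < t) => H) : at_infty (fun t => T1 < t))).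
  apply filter_imp. intros t [H1 H2].
  specialize (Hphi t ltac:(lra)). unfold phi at 2 in Hphi.
  assert (HJp : 0 < sv p t ^ J) by (apply pow_lt; lra).
  assert (E : f t * / sv p t ^ J <= Rabs (phi T1) + B * t).
  { generalize (Rle_abs (- phi T1)). rewrite Rabs_Ropp. lra. }
  replace (f t) with (f t * / sv p t ^ J * sv p t ^ J) by (field; lra).
  apply Rle_trans with ((Rabs (phi T1) + B * t) * sv p t ^ J); [apply Rmult_le_compat_r; lra|].
  rewrite !Rmult_plus_distr_r. apply Rplus_le_compat.
  - apply Rmult_le_compat_l; [apply Rabs_pos|]. apply pow_le_pow; [lra|lia].
  - right. replace J with (J - p + p)%nat at 1 by lia. rewrite pow_add, sv_pow_p by (lia || lra). field. lra.
Qed.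

(** * Pointwise estimates for rotations and saddles *)

Lemma abs_mult_le x y X Y : Rabs x <= X -> Rabs y <= Y -> Rabs (x * y) <= X * Y.
Proof. intros H K. rewrite Rabs_mult. apply Rmult_le_compat; auto using Rabs_pos. Qed.

(** The natural size of (u, v) is v^2 + h u^2, with h = s^nu the size of ka. *)
Lemma quadratic_form_bounds h u v P Q R c : 0 <= h <= 1 -> 0 <= c ->
  Rabs P <= c * h -> Rabs Q <= 2 * c * h -> Rabs R <= c * h ->
  Rabs (P * v ^ 2 + Q * (u * v) + R * u ^ 2) <= 3 * c * (v ^ 2 + h * u ^ 2).
Proof.
  intros Hh Hc HP HQ HR.
  assert (U2 : 0 <= u ^ 2) by apply pow2_ge_0. assert (V2 : 0 <= v ^ 2) by apply pow2_ge_0.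
  assert (A1 : Rabs (P * v ^ 2) <= c * (v ^ 2 + h * u ^ 2)).
  { rewrite Rabs_mult, (Rabs_pos_eq (v ^ 2)) by exact V2.
    apply Rle_trans with (c * h * v ^ 2); [apply Rmult_le_compat_r; auto|].
    rewrite Rmult_assoc. apply Rmult_le_compat_l; [exact Hc|]. nra. }
  assert (A3 : Rabs (R * u ^ 2) <= c * (v ^ 2 + h * u ^ 2)).
  { rewrite Rabs_mult, (Rabs_pos_eq (u ^ 2)) by exact U2.
    apply Rle_trans with (c * h * u ^ 2); [apply Rmult_le_compat_r; auto|].
    rewrite Rmult_assoc. apply Rmult_le_compat_l; [exact Hc|]. nra. }
  assert (A2 : Rabs (Q * (u * v)) <= c * (v ^ 2 + h * u ^ 2)).
  { rewrite Rabs_mult. apply Rle_trans with (2 * c * h * Rabs (u * v)); [apply Rmult_le_compat_r; auto using Rabs_pos|].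
    replace (2 * c * h * Rabs (u * v)) with (c * (2 * h * Rabs (u * v))) by ring.
    apply Rmult_le_compat_l; [exact Hc|]. rewrite Rabs_mult, <- (pow2_abs u), <- (pow2_abs v).
    generalize (Rabs_pos u) (Rabs_pos v). set (U := Rabs u). set (W := Rabs v). intros.
    assert (0 <= h * (U - W) ^ 2) by (apply Rmult_le_pos; [lra|apply pow2_ge_0]).
    assert (h * W ^ 2 <= 1 * W ^ 2) by (apply Rmult_le_compat_r; [apply pow2_ge_0|lra]). lra. }
  eapply Rle_trans; [apply Rabs_triang|]. eapply Rle_trans; [apply Rplus_le_compat_r, Rabs_triang|]. lra.
Qed.

(** The weights w1, w2 are the derivatives of the quadratic form; the mixed products are balanced
    so that no negative power of h is lost. *)
Lemma forcing_bound h u v w1 w2 e1 e2 K0 c z : 0 <= h <= 1 -> 0 <= K0 -> 0 <= c ->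
  Rabs w1 <= K0 * (Rabs v + h * Rabs u) -> Rabs w2 <= K0 * (Rabs v + h * Rabs u) ->
  Rabs e1 <= c * h * (Rabs u + Rabs v) + c * z -> Rabs e2 <= c * h * (Rabs u + Rabs v) + c * z -> 0 <= z ->
  Rabs (w1 * e1 + w2 * e2) <= 2 * K0 * c * (4 * (v ^ 2 + h * u ^ 2) + z ^ 2).
Proof.
  intros Hh HK Hc H1 H2 G1 G2 Hz.
  rewrite <- (pow2_abs u), <- (pow2_abs v).
  assert (U0 := Rabs_pos u). assert (V0 := Rabs_pos v).
  set (U := Rabs u) in *. set (W := Rabs v) in *.
  assert (B : forall w e, Rabs w <= K0 * (W + h * U) -> Rabs e <= c * h * (U + W) + c * z ->
     Rabs (w * e) <= K0 * c * (4 * (W ^ 2 + h * U ^ 2) + z ^ 2)).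
  { intros w e Hw He. eapply Rle_trans; [apply (abs_mult_le _ _ _ _ Hw He)|].
    replace (K0 * (W + h * U) * (c * h * (U + W) + c * z)) with (K0 * c * ((W + h * U) * (h * (U + W) + z))) by ring.
    apply Rmult_le_compat_l; [apply Rmult_le_pos; auto|].
    assert (Q0 : 0 <= h * (U - W) ^ 2) by (apply Rmult_le_pos; [lra|apply pow2_ge_0]).
    assert (Q1 : h * W ^ 2 <= W ^ 2) by (generalize (pow2_ge_0 W); nra).
    assert (Q2 : h * (h * U ^ 2) <= h * U ^ 2).
    { assert (0 <= h * U ^ 2) by (apply Rmult_le_pos; [lra|apply pow2_ge_0]). nra. }
    assert (Q3 : h * (h * (U * W)) <= h * (U * W)).
    { assert (0 <= h * (U * W)) by (repeat apply Rmult_le_pos; lra). nra. }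
    assert (Q4 : 0 <= (W - z) ^ 2) by apply pow2_ge_0.
    assert (Q5 : 0 <= (h * U - z) ^ 2) by apply pow2_ge_0.
    assert (Q6 : 0 <= h * U ^ 2) by (apply Rmult_le_pos; [lra|apply pow2_ge_0]).
    assert (Q7 : 0 <= W ^ 2) by apply pow2_ge_0.
    replace ((W + h * U) * (h * (U + W) + z)) with
      (h * (U * W) + h * W ^ 2 + h * (h * U ^ 2) + h * (h * (U * W)) + W * z + h * U * z) by ring.
    nra. }
  eapply Rle_trans; [apply Rabs_triang|].
  generalize (B _ _ H1 G1) (B _ _ H2 G2). lra.
Qed.

(** All terms of the velocity of v + sg k u other than the eigenvalue term are smaller than the
    latter by a factor s, since kap0 w = s k^2 and |u| is at most (|P| + |Q|) / (2k). *)
Lemma hyperbolic_error kap0 kap1 s k k' w C Cn z A B D K u v e1 e2 sg :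
  0 < kap0 -> 0 < k <= kap1 -> 0 <= s -> 0 <= w -> kap0 * w = s * k ^ 2 -> 0 <= C -> 0 <= Cn -> 0 <= z ->
  Rabs A <= C * w -> Rabs (B - 1) <= C * w -> Rabs D <= C * w -> Rabs (K + k ^ 2) <= C * w -> Rabs k' <= w * k ->
  Rabs e1 <= Cn * w * (Rabs u + Rabs v) + Cn * z -> Rabs e2 <= Cn * w * (Rabs u + Rabs v) + Cn * z ->
  Rabs sg <= 1 ->
  Rabs ((- K - k ^ 2) * u + D * v + e2 + sg * (k * (A * u + (B - 1) * v + e1) + k' * u)) <=
    (C * (1 + kap1) + (1 + kap1) * Cn + kap1) * (1 + kap1) / (2 * kap0) * s * k * (Rabs (v + k * u) + Rabs (v - k * u))
     + (1 + kap1) * Cn * z.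
Proof.
  intros Hk0 Hk Hs Hw Ew HC HCn Hz HA HB HD HK Hk' H1 H2 Hsg.
  assert (U0 := Rabs_pos u). assert (V0 := Rabs_pos v).
  set (m := C * (1 + kap1) + (1 + kap1) * Cn + kap1).
  assert (Hm : 0 <= m).
  { unfold m. assert (0 <= C * (1 + kap1)) by (apply Rmult_le_pos; lra).
    assert (0 <= (1 + kap1) * Cn) by (apply Rmult_le_pos; lra). lra. }
  apply Rle_trans with (m * (w * (Rabs u + Rabs v)) + (1 + kap1) * Cn * z).
  - assert (T1 : Rabs ((- K - k ^ 2) * u) <= C * w * Rabs u).
    { rewrite Rabs_mult. apply Rmult_le_compat_r; [exact U0|]. replace (- K - k ^ 2) with (- (K + k ^ 2)) by ring.
      rewrite Rabs_Ropp. exact HK. }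
    assert (T2 : Rabs (D * v) <= C * w * Rabs v) by (rewrite Rabs_mult; apply Rmult_le_compat_r; auto).
    assert (T3 : Rabs (A * u + (B - 1) * v + e1) <= C * w * Rabs u + C * w * Rabs v + (Cn * w * (Rabs u + Rabs v) + Cn * z)).
    { eapply Rle_trans; [apply Rabs_triang|]. apply Rplus_le_compat; [|exact H1].
      eapply Rle_trans; [apply Rabs_triang|]. rewrite !Rabs_mult.
      apply Rplus_le_compat; apply Rmult_le_compat_r; auto. }
    assert (T4 : Rabs (k * (A * u + (B - 1) * v + e1) + k' * u) <=
       kap1 * (C * w * Rabs u + C * w * Rabs v + (Cn * w * (Rabs u + Rabs v) + Cn * z)) + w * kap1 * Rabs u).
    { eapply Rle_trans; [apply Rabs_triang|]. rewrite !Rabs_mult. apply Rplus_le_compat.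
      - apply Rmult_le_compat; auto using Rabs_pos. rewrite Rabs_pos_eq; lra.
      - apply Rmult_le_compat_r; [exact U0|]. eapply Rle_trans; [exact Hk'|]. apply Rmult_le_compat_l; lra. }
    assert (T5 : Rabs (sg * (k * (A * u + (B - 1) * v + e1) + k' * u)) <= Rabs (k * (A * u + (B - 1) * v + e1) + k' * u)).
    { rewrite Rabs_mult. rewrite <- (Rmult_1_l (Rabs (k * _ + _))) at 2. apply Rmult_le_compat_r; [apply Rabs_pos|exact Hsg]. }
    eapply Rle_trans; [apply Rabs_triang|]. eapply Rle_trans; [apply Rplus_le_compat_r, Rabs_triang|].
    eapply Rle_trans; [apply Rplus_le_compat_r, Rplus_le_compat_r, Rabs_triang|].
    assert (0 <= w * kap1 * Rabs v) by (repeat apply Rmult_le_pos; lra).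
    unfold m. lra.
  - apply Rplus_le_compat_r.
    set (P := v + k * u). set (Q := v - k * u). set (S := Rabs P + Rabs Q).
    assert (HS : 0 <= S) by (unfold S; generalize (Rabs_pos P) (Rabs_pos Q); lra).
    assert (Hv : 2 * Rabs v <= S).
    { replace v with ((P + Q) / 2) by (unfold P, Q; field). unfold Rdiv. rewrite Rabs_mult, (Rabs_pos_eq (/ 2)) by lra.
      generalize (Rabs_triang P Q). unfold S. lra. }
    assert (Hu : 2 * k * Rabs u <= S).
    { replace (2 * k * Rabs u) with (Rabs (P - Q)).
      - generalize (Rabs_triang P (- Q)). rewrite Rabs_Ropp. unfold S, Rminus. lra.
      - unfold P, Q. replace (v + k * u - (v - k * u)) with (2 * k * u) by ring.
        rewrite !Rabs_mult, (Rabs_pos_eq 2), (Rabs_pos_eq k) by lra. ring. }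
    replace (m * (1 + kap1) / (2 * kap0) * s * k * S) with (m * (s * k * ((1 + kap1) * S) / (2 * kap0))) by (field; lra).
    apply Rmult_le_compat_l; [exact Hm|]. assert (Hk2 : 0 < 2 * kap0) by lra. apply (Rle_div_r _ _ _ Hk2).
    replace (w * (Rabs u + Rabs v) * (2 * kap0)) with (kap0 * w * (2 * Rabs u + 2 * Rabs v)) by ring. rewrite Ew.
    replace (s * k ^ 2 * (2 * Rabs u + 2 * Rabs v)) with (s * k * (2 * k * Rabs u + k * (2 * Rabs v))) by ring.
    apply Rmult_le_compat_l; [apply Rmult_le_pos; lra|].
    assert (k * (2 * Rabs v) <= kap1 * S) by (apply Rmult_le_compat; lra). lra.
Qed.

(** P^2 - Q^2 decreases at most by the forcing, and Q^2 is damped as soon as P^2 - Q^2 is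
    controlled. *)
Lemma saddle_cone k P Q P' Q' z : 0 < k -> 0 <= z ->
  Rabs (P' - k * P) <= k / 8 * (Rabs P + Rabs Q) + z -> Rabs (Q' + k * Q) <= k / 8 * (Rabs P + Rabs Q) + z ->
  - (4 * (z ^ 2 / k)) <= 2 * P * P' - 2 * Q * Q' /\
  2 * Q * Q' <= - k * Q ^ 2 + k / 8 * (P ^ 2 - Q ^ 2) + 4 * (z ^ 2 / k).
Proof.
  intros Hk Hz H1 H2.
  set (e1 := P' - k * P) in *. set (e2 := Q' + k * Q) in *.
  replace P' with (k * P + e1) by (unfold e1; ring). replace Q' with (- k * Q + e2) by (unfold e2; ring).
  assert (A1 : Rabs (P * e1) <= Rabs P * (k / 8 * (Rabs P + Rabs Q) + z)).
  { rewrite Rabs_mult. apply Rmult_le_compat_l; [apply Rabs_pos|exact H1]. }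
  assert (A2 : Rabs (Q * e2) <= Rabs Q * (k / 8 * (Rabs P + Rabs Q) + z)).
  { rewrite Rabs_mult. apply Rmult_le_compat_l; [apply Rabs_pos|exact H2]. }
  apply Rabs_le_between in A1, A2. rewrite <- (pow2_abs P), <- (pow2_abs Q).
  replace (2 * P * (k * P + e1) - 2 * Q * (- k * Q + e2)) with (2 * k * (P ^ 2 + Q ^ 2) + 2 * (P * e1) - 2 * (Q * e2)) by ring.
  replace (2 * Q * (- k * Q + e2)) with (- 2 * k * Q ^ 2 + 2 * (Q * e2)) by ring.
  rewrite <- (pow2_abs P), <- (pow2_abs Q). assert (P0 := Rabs_pos P). assert (Q0 := Rabs_pos Q).
  set (A := Rabs P) in *. set (B := Rabs Q) in *.
  assert (Y : forall w, 2 * w * z <= k / 4 * w ^ 2 + 4 * (z ^ 2 / k)).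
  { intros w. assert (0 <= (k * w / 2 - 2 * z) ^ 2 / k) by (apply Rdiv_le_0_compat; [apply pow2_ge_0|exact Hk]).
    replace ((k * w / 2 - 2 * z) ^ 2 / k) with (k / 4 * w ^ 2 - 2 * w * z + 4 * (z ^ 2 / k)) in H by (field; lra). lra. }
  assert (KA : 0 <= k * (A - B) ^ 2) by (apply Rmult_le_pos; [lra|apply pow2_ge_0]).
  assert (KA2 : 0 <= k * A ^ 2) by (apply Rmult_le_pos; [lra|apply pow2_ge_0]).
  assert (KB2 : 0 <= k * B ^ 2) by (apply Rmult_le_pos; [lra|apply pow2_ge_0]).
  split.
  - generalize (Y (A + B)). lra.
  - generalize (Y B). lra.
Qed.

(** * Deviation from the partial sums *)

Definition expanding_solution (p : nat) (f1 f2 : R -> R -> R -> R) (a b : nat -> R) : Prop :=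
  exists t0 x y, 0 < t0 /\
    (forall t, t0 < t -> is_derive x t (f1 (x t) (y t) t) /\ is_derive y t (f2 (x t) (y t) t)) /\
    forall N, bigO p (S N) (fun t => x t - spoly a N (sv p t)) /\ bigO p (S N) (fun t => y t - spoly b N (sv p t)).

(** A bound by a power that grows with N, even with a fixed delay i0, gives the expansion: the
    partial sum at N is compared with one that lies i0 orders further. *)
Lemma all_orders p i0 N1 a b (x y : R -> R) : (0 < p)%nat ->
  (forall N, (N1 <= N)%nat -> bigO p (N - i0) (fun t => x t - spoly a N (sv p t)) /\
                              bigO p (N - i0) (fun t => y t - spoly b N (sv p t))) ->
  forall N, bigO p (S N) (fun t => x t - spoly a N (sv p t)) /\ bigO p (S N) (fun t => y t - spoly b N (sv p t)).
Proof.
  intros Hp H N. set (N' := (N + N1 + i0 + 1)%nat).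
  destruct (H N' ltac:(unfold N'; lia)) as [HX HY].
  apply (bigO_weak p _ (S N)) in HX; [|exact Hp|unfold N'; lia].
  apply (bigO_weak p _ (S N)) in HY; [|exact Hp|unfold N'; lia].
  split.
  - generalize (bigO_plus _ _ _ _ HX (spoly_tail p a N N' Hp ltac:(unfold N'; lia))). apply bigO_ext'. intros; ring.
  - generalize (bigO_plus _ _ _ _ HY (spoly_tail p b N N' Hp ltac:(unfold N'; lia))). apply bigO_ext'. intros; ring.
Qed.

Section Deviation.
Context {p n nu : nat} {k0 : R} {f1 f2 : R -> R -> R -> R} {a b : nat -> R} {al be ka de : R -> R}.
Hypothesis DS : deviation_system p n nu k0 f1 f2 a b al be ka de.

Lemma ds_p_pos : (0 < p)%nat.
Proof. destruct DS. lia. Qed.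

Lemma INR_p_ge1 : 1 <= INR p.
Proof. apply (le_INR 1). apply ds_p_pos. Qed.

(** Clamping makes the field globally Lipschitz in the state without changing it near the origin,
    where all trajectories of interest live; freezing it before t0 extends it to all times. *)
Lemma clamped_regular t0 : 0 < t0 ->
  regular_field (fun t x y => f1 (clamp 1 x) (clamp 1 y) (Rmax t t0)) (fun t x y => f2 (clamp 1 x) (clamp 1 y) (Rmax t t0)).
Proof.
  intros Ht0. split.
  - intros x y Hx Hy t.
    assert (Cx : continuous (fun t => clamp 1 (x t)) t) by (apply (continuous_clamp (fun _ => 1)); [apply continuous_const|apply Hx]).
    assert (Cy : continuous (fun t => clamp 1 (y t)) t) by (apply (continuous_clamp (fun _ => 1)); [apply continuous_const|apply Hy]).
    assert (Hm : 0 < Rmax t t0) by (eapply Rlt_le_trans; [exact Ht0|apply Rmax_r]).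
    split.
    + apply (ds_cont1 DS (fun t => clamp 1 (x t)) (fun t => clamp 1 (y t)) (fun t => Rmax t t0)); auto using continuous_Rmax_id.
    + apply (ds_cont2 DS (fun t => clamp 1 (x t)) (fun t => clamp 1 (y t)) (fun t => Rmax t t0)); auto using continuous_Rmax_id.
  - intros T.
    destruct (ds_lip1 DS t0 (Rmax T t0) Ht0) as (A & HA & LA).
    destruct (ds_lip2 DS t0 (Rmax T t0) Ht0) as (B & HB & LB).
    exists (A + B + 1). split; [lra|]. intros t x y x' y' Ht.
    assert (Hm : t0 <= Rmax t t0 <= Rmax T t0).
    { split; [apply Rmax_r|]. apply Rle_max_compat_r. generalize (Rle_abs t). lra. }
    assert (Bd : forall z, Rabs (clamp 1 z) <= 1) by (intros; apply clamp_bound; lra).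
    specialize (LA _ (clamp 1 x) (clamp 1 y) (clamp 1 x') (clamp 1 y') Hm (Bd _) (Bd _) (Bd _) (Bd _)).
    specialize (LB _ (clamp 1 x) (clamp 1 y) (clamp 1 x') (clamp 1 y') Hm (Bd _) (Bd _) (Bd _) (Bd _)).
    assert (K : Rabs (clamp 1 x - clamp 1 x') + Rabs (clamp 1 y - clamp 1 y') <= Rabs (x - x') + Rabs (y - y')).
    { generalize (clamp_lip 1 x x' ltac:(lra)) (clamp_lip 1 y y' ltac:(lra)). lra. }
    assert (P : 0 <= Rabs (x - x') + Rabs (y - y')) by (generalize (Rabs_pos (x - x')) (Rabs_pos (y - y')); lra).
    split; (eapply Rle_trans; [eassumption|]).
    + apply Rle_trans with (A * (Rabs (x - x') + Rabs (y - y'))); [apply Rmult_le_compat_l; auto|]. nra.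
    + apply Rle_trans with (B * (Rabs (x - x') + Rabs (y - y'))); [apply Rmult_le_compat_l; auto|]. nra.
Qed.

Lemma ds_OX N : bigO p 1 (fun t => spoly a N (sv p t)).
Proof. destruct DS. apply (bigO_weak p nu); [apply ds_p_pos|lia|apply spoly_head; auto; lia]. Qed.
Lemma ds_OY N : bigO p 1 (fun t => spoly b N (sv p t)).
Proof. destruct DS. apply (bigO_weak p (2 * n)); [apply ds_p_pos|lia|apply spoly_head; auto; lia]. Qed.

Lemma ds_dX N t : 0 < t -> is_derive (fun t => spoly a N (sv p t)) t (Derive (fun t => spoly a N (sv p t)) t).
Proof. intros Ht. apply Derive_correct. eexists. apply is_derive_comp_sv; auto using spoly_smooth, ds_p_pos. Qed.
Lemma ds_dY N t : 0 < t -> is_derive (fun t => spoly b N (sv p t)) t (Derive (fun t => spoly b N (sv p t)) t).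
Proof. intros Ht. apply Derive_correct. eexists. apply is_derive_comp_sv; auto using spoly_smooth, ds_p_pos. Qed.

(** The derivatives in s are multiplied by s, since d/dt is s^p (s d/ds) up to a constant. *)
Definition coef_ok (C s : R) : Prop :=
  Rabs (al s) <= C * s ^ (2 * n) /\ Rabs (be s - 1) <= C * s ^ (2 * n) /\ Rabs (de s) <= C * s ^ (2 * n) /\
  Rabs (ka s - k0 * s ^ nu) <= C * s ^ S nu /\
  Rabs (Derive al s) * s <= C * s ^ (2 * n) /\ Rabs (Derive be s) * s <= C * s ^ (2 * n) /\
  Rabs (Derive de s) * s <= C * s ^ (2 * n) /\ Rabs (Derive ka s) * s <= C * s ^ nu.

Lemma coef_bounds : exists C, 0 <= C /\ at_infty (fun t => coef_ok C (sv p t)).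
Proof.
  assert (Hp := ds_p_pos). destruct DS as [Hn Hnu1 Hnu Hpn _ _ sal sbe ska sde oal obe ode oka _ _ _ _ _].
  assert (dal : germO (2 * n - 1) (Derive al)).
  { apply smooth1_germO_derive; [exact sal|]. replace (S (2 * n - 1)) with (2 * n)%nat by lia. exact oal. }
  assert (dde : germO (2 * n - 1) (Derive de)).
  { apply smooth1_germO_derive; [exact sde|]. replace (S (2 * n - 1)) with (2 * n)%nat by lia. exact ode. }
  assert (dbe : germO (2 * n - 1) (Derive be)).
  { assert (D : germO (2 * n - 1) (Derive (fun s => be s - 1))).
    { apply smooth1_germO_derive; [apply (smooth1_minus be (fun _ => 1)); [exact sbe|apply smooth1_const]|].
      replace (S (2 * n - 1)) with (2 * n)%nat by lia. exact obe. }
    revert D. rewrite !germO_iff. apply bigO_ext'. intros t.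
    rewrite (Derive_minus be (fun _ => 1)); [rewrite Derive_const; ring|apply smooth1_ex, sbe|apply ex_derive_const]. }
  assert (dka : germO (nu - 1) (Derive ka)).
  { apply smooth1_germO_derive; [exact ska|]. replace (S (nu - 1)) with nu by lia.
    apply (bigO_germO p); [exact Hp|]. apply (germO_bigO p) in oka; [|exact Hp].
    apply (bigO_weak p _ nu) in oka; [|exact Hp|lia].
    generalize (bigO_plus _ _ _ _ oka (bigO_scal _ _ k0 _ (bigO_sv p nu))). apply bigO_ext'. intros; ring. }
  apply (germO_bigO p) in oal, obe, ode, oka, dal, dbe, dde, dka; auto.
  destruct (bigO_elim _ _ _ oal) as (C1 & P1 & H1), (bigO_elim _ _ _ obe) as (C2 & P2 & H2),
    (bigO_elim _ _ _ ode) as (C3 & P3 & H3), (bigO_elim _ _ _ oka) as (C4 & P4 & H4),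
    (bigO_elim _ _ _ dal) as (C5 & P5 & H5), (bigO_elim _ _ _ dbe) as (C6 & P6 & H6),
    (bigO_elim _ _ _ dde) as (C7 & P7 & H7), (bigO_elim _ _ _ dka) as (C8 & P8 & H8).
  set (C := C1 + C2 + C3 + C4 + C5 + C6 + C7 + C8).
  exists C. split; [unfold C; lra|].
  assert (Q1 : C1 <= C) by (unfold C; lra).
  assert (Q2 : C2 <= C) by (unfold C; lra).
  assert (Q3 : C3 <= C) by (unfold C; lra).
  assert (Q4 : C4 <= C) by (unfold C; lra).
  assert (Q5 : C5 <= C) by (unfold C; lra).
  assert (Q6 : C6 <= C) by (unfold C; lra).
  assert (Q7 : C7 <= C) by (unfold C; lra).
  assert (Q8 : C8 <= C) by (unfold C; lra).
  generalize (filter_and _ _ (H1 C Q1) (filter_and _ _ (H2 C Q2)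
   (filter_and _ _ (H3 C Q3) (filter_and _ _ (H4 C Q4)
   (filter_and _ _ (H5 C Q5) (filter_and _ _ (H6 C Q6)
   (filter_and _ _ (H7 C Q7) (H8 C Q8)))))))).
  apply filter_imp. intros t (K1 & K2 & K3 & K4 & K5 & K6 & K7 & K8).
  assert (Hs := sv_pos p t).
  assert (E1 : C * sv p t ^ (2 * n) = C * sv p t ^ (2 * n - 1) * sv p t).
  { replace (2 * n)%nat with (S (2 * n - 1)) at 1 by lia. simpl. ring. }
  assert (E2 : C * sv p t ^ nu = C * sv p t ^ (nu - 1) * sv p t).
  { replace nu with (S (nu - 1)) at 1 by lia. simpl. ring. }
  unfold coef_ok. repeat split; try assumption; try (rewrite E1; apply Rmult_le_compat_r; lra).
  rewrite E2; apply Rmult_le_compat_r; lra.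
Qed.

(** * The oscillating branch *)

Section Oscillation.
Hypothesis k0_pos : 0 < k0.

(** For a trace-free matrix A0 the form z |-> det (A0 z, z) is invariant under z' = A0 z. This is
    that form for the trace-free part of the matrix with rows (al, be) and (- ka, de), up to sign. *)
Definition qform (t u v : R) : R :=
  let s := sv p t in be s * v ^ 2 + (al s - de s) * (u * v) + ka s * u ^ 2.

Definition qdot (t u v u' v' : R) : R :=
  let s := sv p t in let ds := - / INR p * s ^ (p + 1) in
  (Derive be s * ds * v ^ 2 + (Derive al s * ds - Derive de s * ds) * (u * v) + Derive ka s * ds * u ^ 2)
  + (2 * be s * v * v' + (al s - de s) * (u' * v + u * v') + 2 * ka s * u * u').

Lemma is_derive_qform (u v : R -> R) u' v' t : 0 < t -> is_derive u t u' -> is_derive v t v' ->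
  is_derive (fun t => qform t (u t) (v t)) t (qdot t (u t) (v t) u' v').
Proof.
  intros Ht Hu Hv. assert (Hp := ds_p_pos).
  assert (C : forall g, smooth1 g -> is_derive (fun t => g (sv p t)) t (- / INR p * sv p t ^ (p + 1) * Derive g (sv p t))).
  { intros g Hg. apply is_derive_comp_sv; auto. }
  assert (Cal := C _ (ds_al DS)). assert (Cbe := C _ (ds_be DS)).
  assert (Cka := C _ (ds_ka DS)). assert (Cde := C _ (ds_de DS)).
  unfold qform, qdot. set (ds := - / INR p * sv p t ^ (p + 1)) in *.
  evar_last.
  - apply (is_derive_plus (fun t => be (sv p t) * v t ^ 2 + (al (sv p t) - de (sv p t)) * (u t * v t)) (fun t => ka (sv p t) * u t ^ 2)).
    + apply (is_derive_plus (fun t => be (sv p t) * v t ^ 2) (fun t => (al (sv p t) - de (sv p t)) * (u t * v t))).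
      * apply (is_derive_mult (fun t => be (sv p t)) (fun t => v t ^ 2)); [exact Cbe|apply is_derive_pow, Hv|intros; apply Rmult_comm].
      * apply (is_derive_mult (fun t => al (sv p t) - de (sv p t)) (fun t => u t * v t)); [| |intros; apply Rmult_comm].
        -- apply (is_derive_minus (fun t => al (sv p t)) (fun t => de (sv p t))); [exact Cal|exact Cde].
        -- apply (is_derive_mult u v); [exact Hu|exact Hv|intros; apply Rmult_comm].
    + apply (is_derive_mult (fun t => ka (sv p t)) (fun t => u t ^ 2)); [exact Cka|apply is_derive_pow, Hu|intros; apply Rmult_comm].
  - unfold plus, minus, opp, mult, plus; simpl. unfold plus, mult; simpl. ring.
Qed.

Definition small_dev (t u v : R) : Prop := Rabs u <= sv p t ^ (p + nu + 1) /\ Rabs v <= sv p t ^ (p + nu + 1).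

Definition udot (N : nat) (t u v : R) : R :=
  f1 (spoly a N (sv p t) + u) (spoly b N (sv p t) + v) t - Derive (fun t => spoly a N (sv p t)) t.
Definition vdot (N : nat) (t u v : R) : R :=
  f2 (spoly a N (sv p t) + u) (spoly b N (sv p t) + v) t - Derive (fun t => spoly b N (sv p t)) t.

Definition form_const : R := Rmin 1 k0 / 2.

Lemma form_const_pos : 0 < form_const.
Proof. unfold form_const. assert (0 < Rmin 1 k0) by (apply Rmin_pos; lra). lra. Qed.

Lemma qform_equiv : at_infty (fun t => forall u v,
  form_const * (v ^ 2 + sv p t ^ nu * u ^ 2) <= qform t u v <= (k0 + 2) * (v ^ 2 + sv p t ^ nu * u ^ 2)).
Proof.
  assert (Hp := ds_p_pos). destruct (coef_bounds) as (C & HC & K). assert (Hc1 := form_const_pos).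
  assert (He : 0 < form_const / (3 * C + 1)) by (apply Rdiv_lt_0_compat; lra).
  generalize (filter_and _ _ K (sv_eventually p _ Hp He)). apply filter_imp.
  intros t [(K1 & K2 & K3 & K4 & _) (H1 & H2 & H3)] u v. unfold qform. set (s := sv p t) in *.
  assert (Hh : 0 < s ^ nu <= 1).
  { split; [apply pow_lt; lra|]. rewrite <- (pow_O s). apply pow_le_pow; [lra|lia]. }
  assert (E1 : C * s ^ (2 * n) <= C * s * s ^ nu).
  { rewrite Rmult_assoc. apply Rmult_le_compat_l; [exact HC|]. change (s * s ^ nu) with (s ^ S nu).
    apply pow_le_pow; [lra|]. destruct DS; lia. }
  set (h := s ^ nu) in *. set (E := v ^ 2 + h * u ^ 2).
  assert (HE : 0 <= E).
  { unfold E. assert (0 <= h * u ^ 2) by (apply Rmult_le_pos; [lra|apply pow2_ge_0]). generalize (pow2_ge_0 v). lra. }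
  assert (Q : Rabs ((be s - 1) * v ^ 2 + (al s - de s) * (u * v) + (ka s - k0 * h) * u ^ 2) <= 3 * (C * s) * E).
  { apply quadratic_form_bounds; [lra|apply Rmult_le_pos; lra|lra| |].
    - replace (2 * (C * s) * h) with (C * s * h + C * s * h) by ring. unfold Rminus.
      eapply Rle_trans; [apply Rabs_triang|]. rewrite Rabs_Ropp. lra.
    - eapply Rle_trans; [exact K4|]. right. unfold h. simpl. ring. }
  assert (Hs : 3 * (C * s) <= form_const).
  { apply Rle_trans with ((3 * C + 1) * (form_const / (3 * C + 1))).
    - replace (3 * (C * s)) with (3 * C * s) by ring. apply Rmult_le_compat; lra.
    - right. field. lra. }
  assert (Hs2 : 3 * (C * s) * E <= form_const * E) by (apply Rmult_le_compat_r; lra).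
  apply Rabs_le_between in Q.
  assert (L : 2 * form_const * E <= v ^ 2 + k0 * (h * u ^ 2) <= (k0 + 1) * E).
  { unfold form_const, E. assert (Rmin 1 k0 <= 1) by apply Rmin_l. assert (Rmin 1 k0 <= k0) by apply Rmin_r.
    assert (P1 : 0 <= h * u ^ 2) by (apply Rmult_le_pos; [lra|apply pow2_ge_0]). assert (P2 := pow2_ge_0 v). nra. }
  assert (form_const <= 1) by (unfold form_const; generalize (Rmin_l 1 k0); lra).
  assert (form_const * E <= E) by nra.
  replace (be s * v ^ 2 + (al s - de s) * (u * v) + ka s * u ^ 2) with
   (((be s - 1) * v ^ 2 + (al s - de s) * (u * v) + (ka s - k0 * h) * u ^ 2) + (v ^ 2 + k0 * (h * u ^ 2))) by ring.
  lra.
Qed.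

(** The invariance of the form leaves the trace, the slow variation of the coefficients, which is
    O(1/t), and the forcing. The constant C1 bounds the second contribution only and so does not
    depend on N. *)
Lemma energy_balance : exists C1, 0 <= C1 /\ forall N, (p + nu + 1 <= N)%nat -> at_infty (fun t => forall u v,
  small_dev t u v -> Rabs (qdot t u v (udot N t u v) (vdot N t u v) - (al (sv p t) + de (sv p t)) * qform t u v)
    <= C1 * sv p t ^ p * qform t u v + sv p t ^ (2 * N - p - 2)).
Proof.
  assert (Hp := ds_p_pos). destruct (coef_bounds) as (C & HC & K). assert (Hc1 := form_const_pos).
  exists ((3 * C + 1) / form_const). split; [apply Rlt_le, Rdiv_lt_0_compat; lra|].
  intros N HN. destruct (ds_lin DS N ltac:(lia)) as (Cn & HCn & HL).
  set (K0 := 4 + 2 * k0).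
  assert (He : 0 < 1 / (C + 8 * K0 * Cn + 1)).
  { apply Rdiv_lt_0_compat; [lra|]. assert (0 <= 8 * K0 * Cn) by (repeat apply Rmult_le_pos; unfold K0; lra). lra. }
  generalize (filter_and _ _ K (filter_and _ _ HL (filter_and _ _ (sv_eventually p _ Hp He) qform_equiv))). apply filter_imp.
  intros t ((K1 & K2 & K3 & K4 & K5 & K6 & K7 & K8) & HLt & (H1 & H2 & H3) & HQ) u v [Hu Hv].
  destruct (HLt u v Hu Hv) as [L1 L2]. destruct (HQ u v) as [Q1 _]. clear HLt HQ.
  fold (udot N t u v) in L1. fold (vdot N t u v) in L2.
  set (u' := udot N t u v) in *. set (v' := vdot N t u v) in *.
  set (q := qform t u v) in *. set (s := sv p t) in *.
  assert (Hh : 0 < s ^ nu <= 1).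
  { split; [apply pow_lt; lra|]. rewrite <- (pow_O s). apply pow_le_pow; [lra|lia]. }
  assert (E1 : C * s ^ (2 * n) <= C * s * s ^ nu).
  { rewrite Rmult_assoc. apply Rmult_le_compat_l; [exact HC|]. change (s * s ^ nu) with (s ^ S nu).
    apply pow_le_pow; [lra|]. destruct DS; lia. }
  assert (E2 : C * s ^ (2 * n) <= C * s ^ nu).
  { apply Rmult_le_compat_l; [exact HC|]. apply pow_le_pow; [lra|]. destruct DS; lia. }
  assert (Er : s ^ (p + nu + 1) = s ^ p * s * s ^ nu) by (rewrite !pow_add; simpl; ring).
  set (z := s ^ (N - p - 1)).
  assert (EN : s ^ N = s ^ p * s * z).
  { unfold z. rewrite <- (pow_1 s) at 3. rewrite <- !pow_add. f_equal. lia. }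
  assert (Ez : s ^ (2 * N - p - 2) = s ^ p * z ^ 2).
  { unfold z. rewrite <- pow_mult, <- pow_add. f_equal. lia. }
  assert (Hz : 0 <= z) by (apply pow_le; lra).
  assert (Hpi : 0 < s ^ p) by (apply pow_lt; lra).
  rewrite Er, EN in L1, L2. rewrite Ez.
  set (h := s ^ nu) in *. set (E := v ^ 2 + h * u ^ 2) in *. set (P := s ^ p) in *.
  set (e1 := u' - (al s * u + be s * v)) in *. set (e2 := v' - (- ka s * u + de s * v)) in *.
  assert (HE : 0 <= E).
  { unfold E. assert (0 <= h * u ^ 2) by (apply Rmult_le_pos; [lra|apply pow2_ge_0]). generalize (pow2_ge_0 v). lra. }
  assert (HK : 0 <= K0 * Cn) by (apply Rmult_le_pos; unfold K0; lra).
  assert (Hsall : s * (C + 8 * K0 * Cn + 1) <= 1).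
  { apply Rle_trans with (1 / (C + 8 * K0 * Cn + 1) * (C + 8 * K0 * Cn + 1)); [apply Rmult_le_compat_r; lra|].
    right; field; lra. }
  assert (HsC : C * s <= 1) by nra.
  assert (HsK : 8 * K0 * Cn * s <= 1) by nra.
  set (ds := - / INR p * s ^ (p + 1)).
  assert (Hds : forall d X, Rabs d * s <= X -> Rabs (d * ds) <= P * X).
  { intros d X Hd. unfold ds. rewrite !Rabs_mult, Rabs_Ropp.
    rewrite (Rabs_pos_eq (s ^ (p + 1))) by (apply pow_le; lra). rewrite pow_add, pow_1. fold P.
    assert (G := INR_p_ge1). rewrite (Rabs_pos_eq (/ INR p)) by (apply Rlt_le, Rinv_0_lt_compat; lra).
    assert (/ INR p <= 1) by (rewrite <- Rinv_1; apply Rinv_le_contravar; lra).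
    assert (0 < / INR p) by (apply Rinv_0_lt_compat; lra).
    replace (Rabs d * (/ INR p * (P * s))) with (/ INR p * (P * (Rabs d * s))) by ring.
    assert (0 <= Rabs d * s) by (apply Rmult_le_pos; [apply Rabs_pos|lra]).
    assert (0 <= P * (Rabs d * s)) by (apply Rmult_le_pos; lra).
    apply Rle_trans with (1 * (P * (Rabs d * s))); [apply Rmult_le_compat_r; lra|].
    rewrite Rmult_1_l. apply Rmult_le_compat_l; lra. }
  assert (D1 : Rabs (Derive be s * ds * v ^ 2 + (Derive al s * ds - Derive de s * ds) * (u * v) + Derive ka s * ds * u ^ 2)
     <= 3 * (P * C) * E).
  { apply quadratic_form_bounds; [lra|apply Rmult_le_pos; lra| | |].
    - rewrite Rmult_assoc. apply Hds. lra.
    - unfold Rminus. eapply Rle_trans; [apply Rabs_triang|]. rewrite Rabs_Ropp.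
      generalize (Hds _ _ K5) (Hds _ _ K7).
      assert (P * (C * s ^ (2 * n)) <= P * (C * h)) by (apply Rmult_le_compat_l; lra). lra.
    - rewrite Rmult_assoc. apply Hds. lra. }
  (* the trace-free part of the linear system drops out *)
  assert (ID : qdot t u v u' v' - (al s + de s) * q =
     (Derive be s * ds * v ^ 2 + (Derive al s * ds - Derive de s * ds) * (u * v) + Derive ka s * ds * u ^ 2)
     + (((al s - de s) * v + 2 * ka s * u) * e1 + (2 * be s * v + (al s - de s) * u) * e2)).
  { unfold qdot, q, qform, e1, e2. fold s. fold ds. ring. }
  rewrite ID.
  assert (U0 := Rabs_pos u). assert (V0 := Rabs_pos v).
  assert (Cs0 : 0 <= C * s) by (apply Rmult_le_pos; lra).
  assert (Csh : C * s * h <= h) by nra.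
  assert (Hh1 : C * s * h <= 1) by lra.
  assert (B1 : Rabs (al s - de s) <= 2 * h).
  { unfold Rminus. eapply Rle_trans; [apply Rabs_triang|]. rewrite Rabs_Ropp. lra. }
  assert (B2 : Rabs (be s) <= 2).
  { replace (be s) with ((be s - 1) + 1) by ring. eapply Rle_trans; [apply Rabs_triang|]. rewrite Rabs_R1. lra. }
  assert (B3 : Rabs (ka s) <= (k0 + 1) * h).
  { replace (ka s) with ((ka s - k0 * h) + k0 * h) by ring. eapply Rle_trans; [apply Rabs_triang|].
    rewrite (Rabs_pos_eq (k0 * h)) by (apply Rmult_le_pos; lra).
    change (s ^ S nu) with (s * h) in K4. lra. }
  assert (F := forcing_bound h u v ((al s - de s) * v + 2 * ka s * u) (2 * be s * v + (al s - de s) * u) e1 e2 K0 (Cn * (P * s)) z).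
  assert (D2 : Rabs (((al s - de s) * v + 2 * ka s * u) * e1 + (2 * be s * v + (al s - de s) * u) * e2)
     <= 2 * K0 * (Cn * (P * s)) * (4 * E + z ^ 2)).
  { apply F; auto; try lra.
    - unfold K0; lra.
    - repeat apply Rmult_le_pos; lra.
    - eapply Rle_trans; [apply Rabs_triang|]. rewrite !Rabs_mult, (Rabs_pos_eq 2) by lra.
      assert (Rabs (al s - de s) * Rabs v <= 2 * Rabs v) by (apply Rmult_le_compat_r; lra).
      assert (Rabs (ka s) * Rabs u <= (k0 + 1) * h * Rabs u) by (apply Rmult_le_compat_r; lra).
      assert (0 <= h * Rabs u) by (apply Rmult_le_pos; lra).
      assert (0 <= k0 * Rabs v) by (apply Rmult_le_pos; lra). unfold K0. lra.
    - eapply Rle_trans; [apply Rabs_triang|]. rewrite !Rabs_mult, (Rabs_pos_eq 2) by lra.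
      assert (Rabs (al s - de s) * Rabs u <= 2 * h * Rabs u) by (apply Rmult_le_compat_r; lra).
      assert (Rabs (be s) * Rabs v <= 2 * Rabs v) by (apply Rmult_le_compat_r; lra).
      assert (0 <= h * Rabs u) by (apply Rmult_le_pos; lra).
      assert (0 <= k0 * (h * Rabs u)) by (apply Rmult_le_pos; lra).
      assert (0 <= k0 * Rabs v) by (apply Rmult_le_pos; lra). unfold K0. lra. }
  eapply Rle_trans; [apply Rabs_triang|].
  apply Rle_trans with (3 * (P * C) * E + (P * E + P * z ^ 2)).
  - apply Rplus_le_compat; [exact D1|]. eapply Rle_trans; [exact D2|].
    replace (2 * K0 * (Cn * (P * s)) * (4 * E + z ^ 2)) with
      (8 * K0 * Cn * s * (P * E) + 2 * K0 * Cn * s * (P * z ^ 2)) by ring.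
    assert (0 <= P * E) by (apply Rmult_le_pos; lra).
    assert (0 <= P * z ^ 2) by (apply Rmult_le_pos; [lra|apply pow2_ge_0]).
    assert (0 <= K0 * Cn * s) by (apply Rmult_le_pos; lra).
    apply Rplus_le_compat.
    + rewrite <- (Rmult_1_l (P * E)) at 2. apply Rmult_le_compat_r; lra.
    + rewrite <- (Rmult_1_l (P * z ^ 2)) at 2. apply Rmult_le_compat_r; lra.
  - assert (EQ : E <= q / form_const) by (apply Rle_div_r; [exact Hc1|lra]).
    assert ((3 * C + 1) * (P * E) <= (3 * C + 1) * (P * (q / form_const))).
    { apply Rmult_le_compat_l; [lra|]. apply Rmult_le_compat_l; lra. }
    replace ((3 * C + 1) / form_const * P * q) with ((3 * C + 1) * (P * (q / form_const))) by (field; lra). lra.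
Qed.

Definition slow_loss (c : nat) : Prop := forall N, (p + nu + 1 <= N)%nat -> at_infty (fun t => forall u v, small_dev t u v ->
     - (INR c / INR p) * sv p t ^ p * qform t u v - sv p t ^ (2 * N - p - 2) <= qdot t u v (udot N t u v) (vdot N t u v)).
Definition fast_damping : Prop := forall L N, (p + nu + 1 <= N)%nat -> at_infty (fun t => forall u v, small_dev t u v ->
     qdot t u v (udot N t u v) (vdot N t u v) <= - (INR L / INR p) * sv p t ^ p * qform t u v + sv p t ^ (2 * N - p - 2)).

(** The trace is a smooth germ in s. If it is O(s^p) = O(1/t) or has a positive leading term, the
    form decreases at most like a power of t; a negative leading term below s^p damps it faster
    than any power of t. *)
Lemma energy_alternative : (exists c, slow_loss c) \/ fast_damping.
Proof.
  assert (Hp := ds_p_pos). assert (Hp1 := INR_p_ge1). destruct energy_balance as (C1 & HC1 & HB).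
  assert (Hc1 := form_const_pos).
  assert (Hq0 : at_infty (fun t => forall u v, 0 <= qform t u v)).
  { generalize (filter_and _ _ qform_equiv (sv_eventually p 1 Hp Rlt_0_1)). apply filter_imp. intros t [H Hs] u v.
    eapply Rle_trans; [|apply H]. apply Rmult_le_pos; [lra|].
    assert (0 <= sv p t ^ nu * u ^ 2) by (apply Rmult_le_pos; [apply pow_le; lra|apply pow2_ge_0]).
    generalize (pow2_ge_0 v). lra. }
  assert (from_lower : forall C2, 0 <= C2 -> at_infty (fun t => - C2 * sv p t ^ p <= al (sv p t) + de (sv p t)) ->
    exists c, forall N, (p + nu + 1 <= N)%nat -> at_infty (fun t => forall u v, small_dev t u v ->
     - (INR c / INR p) * sv p t ^ p * qform t u v - sv p t ^ (2 * N - p - 2) <= qdot t u v (udot N t u v) (vdot N t u v))).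
  { intros C2 HC2 Hlow. destruct (nfloor_ex ((C1 + C2) * INR p)) as [m Hm]; [apply Rmult_le_pos; lra|].
    exists (S m). intros N HN.
    generalize (filter_and _ _ (HB N HN) (filter_and _ _ Hlow (filter_and _ _ Hq0 (sv_eventually p 1 Hp Rlt_0_1)))).
    apply filter_imp. intros t (H1 & H2 & H3 & H4) u v Huv. specialize (H1 u v Huv). specialize (H3 u v).
    apply Rabs_le_between in H1. destruct H1 as [H1 _].
    assert (P0 : 0 < sv p t ^ p) by (apply pow_lt; lra).
    assert (Hc : C1 + C2 <= INR (S m) / INR p) by (apply Rle_div_r; [lra|]; rewrite S_INR; lra).
    assert (A1 : - C2 * sv p t ^ p * qform t u v <= (al (sv p t) + de (sv p t)) * qform t u v) by (apply Rmult_le_compat_r; lra).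
    assert (A2 : (C1 + C2) * (sv p t ^ p * qform t u v) <= INR (S m) / INR p * (sv p t ^ p * qform t u v)).
    { apply Rmult_le_compat_r; [apply Rmult_le_pos; lra|exact Hc]. }
    lra. }
  set (tau := fun s => al s + de s).
  assert (Ht : smooth1 tau) by (apply smooth1_plus; apply DS).
  destruct (smooth1_dichotomy tau p Ht) as [HO|(j & c & Hj & Hc & HO)].
  - left. apply (germO_bigO p) in HO; [|exact Hp]. destruct HO as (C2 & HC2 & H). apply (from_lower C2 HC2).
    revert H. apply filter_imp. intros t H. apply Rabs_le_between in H. unfold tau in H. lra.
  - assert (Hac : 0 < Rabs c) by (apply Rabs_pos_lt, Hc).
    apply (germO_bigO p) in HO; [|exact Hp].
    assert (Hlead := bigO_small p j _ (Rabs c / 2) Hp ltac:(lra) HO).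
    destruct (Rlt_le_dec 0 c) as [Hpos|Hneg].
    + left. apply (from_lower 0 (Rle_refl 0)).
      generalize (filter_and _ _ Hlead (sv_eventually p 1 Hp Rlt_0_1)). apply filter_imp. intros t [H Hs].
      rewrite (Rabs_pos_eq c) in H by lra. apply Rabs_le_between in H.
      assert (0 < c * sv p t ^ j) by (apply Rmult_lt_0_compat; [exact Hpos|apply pow_lt; lra]). unfold tau in H. lra.
    + right. intros L N HN.
      assert (He : 0 < Rabs c / (2 * (C1 + INR L) + 1)).
      { apply Rdiv_lt_0_compat; [exact Hac|]. generalize (pos_INR L). lra. }
      generalize (filter_and _ _ (HB N HN) (filter_and _ _ Hlead (filter_and _ _ Hq0 (sv_eventually p _ Hp He)))).
      apply filter_imp. intros t (H1 & H2 & H3 & H4) u v Huv. specialize (H1 u v Huv). specialize (H3 u v).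
      apply Rabs_le_between in H1. destruct H1 as [_ H1].
      assert (Pj : 0 < sv p t ^ j) by (apply pow_lt; lra).
      assert (P0 : 0 < sv p t ^ p) by (apply pow_lt; lra).
      rewrite (Rabs_left1 c) in H2, H4, He by exact Hneg.
      apply Rabs_le_between in H2. unfold tau in H2.
      assert (Hr : (C1 + INR L) * sv p t ^ p <= - c / 2 * sv p t ^ j).
      { apply Rle_trans with ((C1 + INR L) * (sv p t * sv p t ^ j)).
        - apply Rmult_le_compat_l; [generalize (pos_INR L); lra|]. change (sv p t * sv p t ^ j) with (sv p t ^ S j).
          apply pow_le_pow; [lra|lia].
        - rewrite <- Rmult_assoc. apply Rmult_le_compat_r; [lra|].
          assert (HL := pos_INR L).
          assert (sv p t * (2 * (C1 + INR L) + 1) <= - c / (2 * (C1 + INR L) + 1) * (2 * (C1 + INR L) + 1))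
            by (apply Rmult_le_compat_r; lra).
          replace (- c / (2 * (C1 + INR L) + 1) * (2 * (C1 + INR L) + 1)) with (- c) in H by (field; lra). lra. }
      assert (HLp : INR L / INR p <= INR L).
      { apply Rle_div_l; [lra|]. generalize (pos_INR L). nra. }
      assert (A1 : (al (sv p t) + de (sv p t)) * qform t u v <= - (C1 + INR L) * sv p t ^ p * qform t u v).
      { apply Rmult_le_compat_r; [exact H3|]. lra. }
      assert (A2 : INR L / INR p * (sv p t ^ p * qform t u v) <= INR L * (sv p t ^ p * qform t u v)).
      { apply Rmult_le_compat_r; [apply Rmult_le_pos; lra|exact HLp]. }
      lra.
Qed.

Lemma form_small C i : 0 <= C -> at_infty (fun t => forall u v, qform t u v <= C * sv p t ^ (2 * i + nu + 1) ->
  Rabs u <= sv p t ^ i /\ Rabs v <= sv p t ^ i).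
Proof.
  intros HC. assert (Hp := ds_p_pos). assert (Hc1 := form_const_pos). set (c := form_const) in *.
  assert (He : 0 < c / (C + 1)) by (apply Rdiv_lt_0_compat; lra).
  generalize (filter_and _ _ (qform_equiv) (sv_eventually p _ Hp He)). apply filter_imp.
  intros t [HQ (H1 & H2 & H3)] u v Hq. destruct (HQ u v) as [Q _]. fold c in Q.
  set (s := sv p t) in *. assert (Hh : 0 < s ^ nu) by (apply pow_lt; lra).
  assert (Hh1 : s ^ nu <= 1) by (rewrite <- (pow_O s); apply pow_le_pow; [lra|lia]).
  assert (Hi : 0 < s ^ i) by (apply pow_lt; lra).
  assert (HCs : C * s <= c).
  { apply Rle_trans with ((C + 1) * (c / (C + 1))); [apply Rmult_le_compat; lra|]. right; field; lra. }
  assert (E : C * s ^ (2 * i + nu + 1) = C * s * (s ^ nu * (s ^ i) ^ 2)).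
  { rewrite <- pow_mult, !pow_add. replace (i * 2)%nat with (2 * i)%nat by lia. ring. }
  rewrite E in Hq.
  assert (Hw : 0 <= s ^ nu * (s ^ i) ^ 2) by (apply Rmult_le_pos; [lra|apply pow2_ge_0]).
  assert (B : c * (v ^ 2 + s ^ nu * u ^ 2) <= c * (s ^ nu * (s ^ i) ^ 2)).
  { eapply Rle_trans; [exact Q|]. eapply Rle_trans; [exact Hq|]. apply Rmult_le_compat_r; lra. }
  apply Rmult_le_reg_l in B; [|exact Hc1].
  assert (V2 := pow2_ge_0 v). assert (U2 := pow2_ge_0 u).
  split; apply sq_le_abs; try lra.
  - apply (Rmult_le_reg_l (s ^ nu)); [exact Hh|]. lra.
  - apply Rle_trans with (s ^ nu * (s ^ i) ^ 2).
    + assert (0 <= s ^ nu * u ^ 2) by (apply Rmult_le_pos; lra). lra.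
    + rewrite <- (Rmult_1_l ((s ^ i) ^ 2)) at 2. apply Rmult_le_compat_r; [apply pow2_ge_0|exact Hh1].
Qed.

Lemma form_bigO u v i : bigO p i u -> bigO p i v -> bigO p (2 * i) (fun t => qform t (u t) (v t)).
Proof.
  intros Hu Hv. assert (Hp := ds_p_pos). assert (Hc1 := form_const_pos).
  apply (bigO_le p _ _ (fun t => (k0 + 2) * (v t * v t + u t * u t))).
  - apply bigO_scal. replace (2 * i)%nat with (i + i)%nat by lia. apply bigO_plus; apply bigO_mult; assumption.
  - generalize (filter_and _ _ (qform_equiv) (sv_eventually p 1 Hp Rlt_0_1)). apply filter_imp.
    intros t [HQ Hs]. destruct (HQ (u t) (v t)) as [Q1 Q2].
    assert (Hh : 0 <= sv p t ^ nu <= 1).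
    { split; [apply pow_le; lra|]. rewrite <- (pow_O (sv p t)). apply pow_le_pow; [lra|lia]. }
    assert (U2 := pow2_ge_0 (u t)). assert (V2 := pow2_ge_0 (v t)).
    assert (W : 0 <= sv p t ^ nu * u t ^ 2 <= u t ^ 2) by nra.
    assert (0 <= qform t (u t) (v t)).
    { eapply Rle_trans; [|exact Q1]. apply Rmult_le_pos; lra. }
    rewrite (Rabs_pos_eq (qform _ _ _)) by assumption. eapply Rle_trans; [|apply Rle_abs].
    eapply Rle_trans; [exact Q2|]. apply Rmult_le_compat_l; lra.
Qed.

(** The quadratic form of the deviation from the N-th partial sums obeys the same inequality for
    every N, with a forcing of order 2N - p - 2, and is a priori small because the solution lies in
    the tube around the partial sums of order N0. *)
Lemma oscillating_bootstrap c N0 i t0 (x y : R -> R) : slow_loss c \/ fast_damping -> 0 < t0 ->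
  (p + nu + 2 + c <= i)%nat -> (i <= N0)%nat ->
  (forall t, t0 < t -> is_derive x t (f1 (x t) (y t) t) /\ is_derive y t (f2 (x t) (y t) t)) ->
  bigO p i (fun t => x t - spoly a N0 (sv p t)) -> bigO p i (fun t => y t - spoly b N0 (sv p t)) ->
  forall N, (N0 + p + 2 <= N)%nat -> bigO p (N - (p + nu + 2)) (fun t => x t - spoly a N (sv p t)) /\
    bigO p (N - (p + nu + 2)) (fun t => y t - spoly b N (sv p t)).
Proof.
  intros Halt Ht0 Hi Hi0 Hsol HX HY N HN. assert (Hp := ds_p_pos).
  set (u := fun t => x t - spoly a N (sv p t)). set (v := fun t => y t - spoly b N (sv p t)).
  assert (Hu : bigO p i u).
  { assert (T := spoly_tail p a N0 N Hp ltac:(lia)). apply (bigO_weak p _ i) in T; [|exact Hp|lia].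
    generalize (bigO_minus _ _ _ _ HX T). apply bigO_ext'. intros t. unfold u. ring. }
  assert (Hv : bigO p i v).
  { assert (T := spoly_tail p b N0 N Hp ltac:(lia)). apply (bigO_weak p _ i) in T; [|exact Hp|lia].
    generalize (bigO_minus _ _ _ _ HY T). apply bigO_ext'. intros t. unfold v. ring. }
  assert (Hreg : at_infty (fun t => small_dev t (u t) (v t))).
  { assert (A : bigO p (S (p + nu + 1)) u) by (apply (bigO_weak p i); auto; lia).
    assert (B : bigO p (S (p + nu + 1)) v) by (apply (bigO_weak p i); auto; lia).
    generalize (filter_and _ _ (bigO_small p _ _ 1 Hp Rlt_0_1 A) (bigO_small p _ _ 1 Hp Rlt_0_1 B)).
    apply filter_imp. intros t [K1 K2]. rewrite Rmult_1_l in K1, K2. split; assumption. }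
  assert (HQ := form_bigO u v i Hu Hv).
  set (q := fun t => qform t (u t) (v t)) in *.
  set (q' := fun t => qdot t (u t) (v t) (udot N t (u t) (v t)) (vdot N t (u t) (v t))).
  assert (Hd : forall t, t0 < t -> is_derive q t (q' t)).
  { intros t Ht. destruct (Hsol t Ht) as [Dx Dy].
    assert (Ex : spoly a N (sv p t) + u t = x t) by (unfold u; ring).
    assert (Ey : spoly b N (sv p t) + v t = y t) by (unfold v; ring).
    apply (is_derive_qform); [lra| |].
    - unfold udot. rewrite Ex, Ey.
      apply (is_derive_minus x (fun t => spoly a N (sv p t))); [exact Dx|apply (ds_dX); lra].
    - unfold vdot. rewrite Ex, Ey.
      apply (is_derive_minus y (fun t => spoly b N (sv p t))); [exact Dy|apply (ds_dY); lra]. }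
  set (K := (2 * N - p - 2)%nat).
  assert (Hdecay : exists C, 0 <= C /\ at_infty (fun t => q t <= C * sv p t ^ (K - p))).
  { destruct Halt as [HG|HD].
    - destruct (filter_and _ _ Hreg (HG N ltac:(lia))) as [T HT].
      set (T0 := Rmax T t0). assert (T <= T0) by apply Rmax_l. assert (t0 <= T0) by apply Rmax_r.
      exists (1 * INR p). split; [generalize (pos_INR p); lra|]. exists T0. intros t Ht.
      apply (decay_from_infinity p c (2 * i) K 1 T0 q q'); auto; unfold K; try lia; try lra.
      + intros r Hr. apply Hd. lra.
      + intros r Hr. destruct (HT r ltac:(lra)) as [R1 R2]. generalize (R2 _ _ R1). fold K. unfold q, q'. lra.
    - destruct (filter_and _ _ Hreg (HD K N ltac:(lia))) as [T HT].
      set (T0 := Rmax T t0). assert (T <= T0) by apply Rmax_l. assert (t0 <= T0) by apply Rmax_r.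
      apply (decay_by_damping p K 1 T0 q q'); auto; unfold K; try lia; try lra.
      + intros r Hr. apply Hd. lra.
      + intros r Hr. destruct (HT r ltac:(lra)) as [R1 R2]. generalize (R2 _ _ R1). fold K. unfold q, q'. lra. }
  destruct Hdecay as (C & HC & HE).
  set (j := (N - (p + nu + 2))%nat).
  assert (HF : at_infty (fun t => Rabs (u t) <= sv p t ^ j /\ Rabs (v t) <= sv p t ^ j)).
  { generalize (filter_and _ _ HE (filter_and _ _ (form_small C j HC) (sv_eventually p 1 Hp Rlt_0_1))). apply filter_imp.
    intros t (E1 & E2 & E3). apply E2. eapply Rle_trans; [exact E1|]. apply Rmult_le_compat_l; [exact HC|].
    apply pow_le_pow; [lra|]. unfold K, j. lia. }
  split; exists 1; (split; [lra|]); revert HF; apply filter_imp; intros t [F1 F2]; rewrite Rmult_1_l; assumption.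
Qed.

(** The tube is qform <= s^m around a partial sum. Under [slow_loss] the choice of m makes the
    form decay less rapidly than s^m, so on the boundary trajectories leave the tube and those
    started on the axis at a late time T lie in it at all earlier times. Under [fast_damping] they
    enter the tube on the boundary, and the trajectory started on the axis at t0 stays. *)
Theorem oscillating_solution : expanding_solution p f1 f2 a b.
Proof.
  assert (Hp := ds_p_pos). assert (Hp1 := INR_p_ge1).
  assert (Halt : exists c, slow_loss c \/ fast_damping).
  { destruct (energy_alternative) as [[c Hc]|H]; [exists c; left; exact Hc|exists O; right; exact H]. }
  destruct Halt as [c Halt].
  set (i := (p + nu + 2 + c)%nat). set (m := (2 * i + nu + 1)%nat). set (N := (m + p + 2)%nat).
  set (K := (2 * N - p - 2)%nat).
  assert (He : 0 < / (INR p + 1)) by (apply Rinv_0_lt_compat; lra).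
  assert (Hcross : at_infty (fun t => forall u v, small_dev t u v -> qform t u v = sv p t ^ m ->
     (slow_loss c -> 0 < qdot t u v (udot N t u v) (vdot N t u v) + INR m / INR p * sv p t ^ (m + p)) /\
     (~ slow_loss c -> qdot t u v (udot N t u v) (vdot N t u v) + INR m / INR p * sv p t ^ (m + p) < 0))).
  { assert (small : at_infty (fun t => 0 < sv p t /\ sv p t ^ K < / INR p * sv p t ^ (m + p))).
    { generalize (sv_eventually p _ Hp He). apply filter_imp. intros t (H1 & H2 & H3). split; [lra|].
      assert (P0 : 0 < sv p t ^ (m + p)) by (apply pow_lt; lra).
      apply Rle_lt_trans with (sv p t * sv p t ^ (m + p)).
      - change (sv p t * sv p t ^ (m + p)) with (sv p t ^ S (m + p)). apply pow_le_pow; [lra|]. unfold K, N; lia.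
      - apply Rmult_lt_compat_r; [exact P0|]. apply Rlt_le_trans with (/ (INR p + 1)); [lra|].
        apply Rinv_le_contravar; lra. }
    destruct (classic (slow_loss c)) as [HG|HnG].
    - generalize (filter_and _ _ small (HG N ltac:(unfold N, m, i; lia))). apply filter_imp.
      intros t [[H0 H1] H2] u v Hr Hq. split; [intros _|intros Hn; elim (Hn HG)].
      specialize (H2 u v Hr). rewrite Hq in H2. fold K in H2.
      assert (Hmc : INR c + 1 <= INR m) by (rewrite <- S_INR; apply le_INR; unfold m, i; lia).
      rewrite (pow_add _ m p) in *. set (w := sv p t ^ m * sv p t ^ p) in *.
      assert (P0 : 0 < w) by (unfold w; apply Rmult_lt_0_compat; apply pow_lt; lra).
      replace (- (INR c / INR p) * sv p t ^ p * sv p t ^ m) with (- (INR c / INR p) * w) in H2 by (unfold w; ring).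
      assert (0 <= / INR p * w * (INR m - INR c - 1)).
      { apply Rmult_le_pos; [|lra]. apply Rmult_le_pos; [apply Rlt_le, Rinv_0_lt_compat|]; lra. }
      unfold Rdiv in *. lra.
    - destruct Halt as [HG|HD]; [elim (HnG HG)|].
      generalize (filter_and _ _ small (HD (S m) N ltac:(unfold N, m, i; lia))). apply filter_imp.
      intros t [[H0 H1] H2] u v Hr Hq. split; [intros HG; elim (HnG HG)|intros _].
      specialize (H2 u v Hr). rewrite Hq in H2. fold K in H2. rewrite S_INR in H2.
      rewrite (pow_add _ m p) in *. set (w := sv p t ^ m * sv p t ^ p) in *.
      replace (- ((INR m + 1) / INR p) * sv p t ^ p * sv p t ^ m) with (- ((INR m + 1) / INR p) * w) in H2 by (unfold w; ring).
      unfold Rdiv in *. lra. }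
  assert (Hall := filter_and _ _ Hcross (filter_and _ _ (form_small 1 i Rle_0_1)
     (filter_and _ _ (bigO_half _ _ Hp (ds_OX N)) (filter_and _ _ (bigO_half _ _ Hp (ds_OY N))
     (sv_eventually p (1 / 2) Hp ltac:(lra)))))).
  destruct (at_infty_from _ Hall) as (t0 & Ht0 & H0). clear Hall Hcross.
  set (X := fun t => spoly a N (sv p t)) in *. set (Y := fun t => spoly b N (sv p t)) in *.
  set (Tube := fun t x y => qform t (x - X t) (y - Y t) <= sv p t ^ m).
  assert (Hthin : forall t x y, t0 <= t -> Tube t x y -> Rabs (x - X t) <= sv p t ^ i /\ Rabs (y - Y t) <= sv p t ^ i).
  { intros t x y Ht HT. destruct (H0 t Ht) as (_ & H2 & _). apply H2. rewrite Rmult_1_l. exact HT. }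
  assert (Hbox : forall t x y, t0 <= t -> Tube t x y -> small_dev t (x - X t) (y - Y t) /\ Rabs x <= 1 /\ Rabs y <= 1).
  { intros t x y Ht HT. destruct (Hthin t x y Ht HT) as [A B]. destruct (H0 t Ht) as (_ & _ & H3 & H4 & H5).
    assert (E1 : sv p t ^ i <= sv p t ^ (p + nu + 1)) by (apply pow_le_pow; [lra|unfold i; lia]).
    assert (E2 : sv p t ^ i <= sv p t ^ 1) by (apply pow_le_pow; [lra|unfold i; lia]). rewrite pow_1 in E2.
    split; [split; lra|].
    fold (X t) in H3. fold (Y t) in H4.
    split.
    - replace x with ((x - X t) + X t) by ring. eapply Rle_trans; [apply Rabs_triang|]. lra.
    - replace y with ((y - Y t) + Y t) by ring. eapply Rle_trans; [apply Rabs_triang|]. lra. }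
  set (g1 := fun t x y => f1 (clamp 1 x) (clamp 1 y) (Rmax t t0)).
  set (g2 := fun t x y => f2 (clamp 1 x) (clamp 1 y) (Rmax t t0)).
  assert (Hrf : regular_field g1 g2) by (apply (clamped_regular); lra).
  assert (Hg : forall t x y, t0 <= t -> Tube t x y -> g1 t x y = f1 x y t /\ g2 t x y = f2 x y t).
  { intros t x y Ht HT. destruct (Hbox t x y Ht HT) as (_ & A & B). unfold g1, g2.
    rewrite !clamp_id, Rmax_left by lra. auto. }
  set (phi := fun (x y : R -> R) t => qform t (x t - X t) (y t - Y t) - sv p t ^ m).
  set (phi' := fun (x y : R -> R) t => qdot t (x t - X t) (y t - Y t) (g1 t (x t) (y t) - Derive X t) (g2 t (x t) (y t) - Derive Y t)
     - (- (INR m / INR p) * sv p t ^ (m + p))).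
  assert (Hphi : forall x y, ode_solution g1 g2 x y -> forall t, t0 <= t -> is_derive (phi x y) t (phi' x y t)).
  { intros x y Hs t Ht. destruct (Hs t) as [Sx Sy].
    apply (is_derive_minus (fun t => qform t (x t - X t) (y t - Y t)) (fun t => sv p t ^ m)).
    - apply (is_derive_qform (fun t => x t - X t) (fun t => y t - Y t)); [lra| |].
      + apply (is_derive_minus x X); [exact Sx|apply (ds_dX); lra].
      + apply (is_derive_minus y Y); [exact Sy|apply (ds_dY); lra].
    - apply is_derive_svpow; [exact Hp|lra]. }
  assert (Hsign : forall x y t, t0 <= t -> phi x y t = 0 -> (slow_loss c -> 0 < phi' x y t) /\ (~ slow_loss c -> phi' x y t < 0)).
  { intros x y t Ht Hz. unfold phi in Hz.
    assert (HT : Tube t (x t) (y t)) by (unfold Tube; lra).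
    destruct (Hbox _ _ _ Ht HT) as [Hr _]. destruct (Hg _ _ _ Ht HT) as [G1 G2].
    destruct (H0 t Ht) as (H1 & _). specialize (H1 _ _ Hr ltac:(lra)).
    assert (E1 : udot N t (x t - X t) (y t - Y t) = g1 t (x t) (y t) - Derive X t).
    { unfold udot. rewrite G1. fold X. f_equal. f_equal; unfold X, Y; ring. }
    assert (E2 : vdot N t (x t - X t) (y t - Y t) = g2 t (x t) (y t) - Derive Y t).
    { unfold vdot. rewrite G2. fold Y. f_equal. f_equal; unfold X, Y; ring. }
    rewrite E1, E2 in H1. unfold phi'. destruct H1 as [A B].
    split; intros HH; [specialize (A HH)|specialize (B HH)]; lra. }
  assert (Hcenter : forall t, phi (fun _ => X t) (fun _ => Y t) t <= 0).
  { intros t. unfold phi, qform. rewrite !Rminus_diag. assert (0 < sv p t ^ m) by apply pow_lt, sv_pos.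
    replace (be (sv p t) * 0 ^ 2 + (al (sv p t) - de (sv p t)) * (0 * 0) + ka (sv p t) * 0 ^ 2) with 0 by ring. lra. }
  assert (Hstay : exists x y, ode_solution g1 g2 x y /\ forall t, t0 <= t -> Tube t (x t) (y t)).
  { destruct (classic (slow_loss c)) as [HG|HnG].
    - apply (stay_forever g1 g2 Tube t0 1 Hrf).
      + intros t x y Hn. unfold Tube, qform in Hn.
        destruct (open_pos (fun x y => be (sv p t) * (y - Y t) ^ 2 + (al (sv p t) - de (sv p t)) * ((x - X t) * (y - Y t)) + ka (sv p t) * (x - X t) ^ 2 - sv p t ^ m) x y) as (d & Hd & HO).
        * apply (continuous_quadratic _ _ _ (X t) (Y t) (sv p t ^ m) (x, y)).
        * lra.
        * exists d. split; [exact Hd|]. intros x' y' Hxy Hin. unfold Tube, qform in Hin. specialize (HO x' y' Hxy). lra.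
      + intros T HT. destruct (picard g1 g2 T (X T) (Y T) Hrf) as (x & y & Ex & Ey & Hs).
        assert (Hin : forall t, t0 <= t <= T -> Tube t (x t) (y t)).
        { intros t Ht. assert (phi x y t <= 0); [|unfold phi, Tube in *; lra].
          apply (barrier_back (phi x y) (phi' x y) t0 T); [| | |exact Ht].
          - intros r Hr. apply Hphi; [exact Hs|lra].
          - intros r Hr Hz. apply (Hsign x y r ltac:(lra) Hz), HG.
          - generalize (Hcenter T). unfold phi. rewrite Ex, Ey. auto. }
        exists x, y. split; [exact Hs|].
        destruct (Hbox t0 (x t0) (y t0)) as (_ & A & B); [lra|apply Hin; lra|]. auto.
    - destruct (picard g1 g2 t0 (X t0) (Y t0) Hrf) as (x & y & Ex & Ey & Hs).
      exists x, y. split; [exact Hs|]. intros t Ht. assert (phi x y t <= 0); [|unfold phi, Tube in *; lra].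
      apply (barrier (phi x y) (phi' x y) t0 t); [| | |lra].
      + intros r Hr. apply Hphi; [exact Hs|lra].
      + intros r Hr Hz. apply (Hsign x y r ltac:(lra) Hz), HnG.
      + generalize (Hcenter t0). unfold phi. rewrite Ex, Ey. auto. }
  destruct Hstay as (x & y & Hs & Hin).
  assert (Hsol : forall t, t0 < t -> is_derive x t (f1 (x t) (y t) t) /\ is_derive y t (f2 (x t) (y t) t)).
  { intros t Ht. destruct (Hg t (x t) (y t) ltac:(lra) (Hin t ltac:(lra))) as [G1 G2]. rewrite <- G1, <- G2. apply Hs. }
  exists t0, x, y. split; [lra|]. split; [exact Hsol|].
  apply (all_orders p (p + nu + 2) (N + p + 2)); [exact Hp|]. intros N' HN'.
  apply (oscillating_bootstrap c N i t0); auto; try lra.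
  - unfold N, m. lia.
  - exists 1. split; [lra|]. exists t0. intros t Ht. rewrite Rmult_1_l. apply (Hthin t (x t) (y t)); [lra|apply Hin; lra].
  - exists 1. split; [lra|]. exists t0. intros t Ht. rewrite Rmult_1_l. apply (Hthin t (x t) (y t)); [lra|apply Hin; lra].
Qed.

End Oscillation.

(** * The saddle branch *)

Section Saddle.
Hypothesis k0_neg : k0 < 0.

Definition rate0 : R := sqrt (- k0).
(** The square root of - k0 s^nu, the leading part of - ka. *)
Definition rate (t : R) : R := rate0 * sv (2 * p) t ^ nu.

Lemma rate0_pos : 0 < rate0.
Proof. unfold rate0. apply sqrt_lt_R0. lra. Qed.

Lemma rate0_sq : rate0 ^ 2 = - k0.
Proof. unfold rate0. apply pow2_sqrt. lra. Qed.

Lemma rate_pos t : 0 < rate t.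
Proof. unfold rate. apply Rmult_lt_0_compat; [apply rate0_pos|apply pow_lt, sv_pos]. Qed.

Lemma rate_sq t : rate t ^ 2 = - k0 * sv p t ^ nu.
Proof.
  unfold rate. rewrite Rpow_mult_distr, rate0_sq, <- pow_mult, (Nat.mul_comm nu 2), pow_mult, (sv_double p t ds_p_pos). reflexivity.
Qed.

Lemma rate_bounds t : sv p t <= 1 -> rate0 * sv p t ^ nu <= rate t <= rate0.
Proof.
  intros Hs. assert (Hk := rate0_pos). assert (P1 := sv_pos p t). assert (P2 := sv_pos (2 * p) t).
  assert (E := sv_double p t ds_p_pos).
  assert (H1 : sv (2 * p) t <= 1).
  { apply Rnot_lt_le. intros H. replace (sv (2 * p) t ^ 2) with (sv (2 * p) t * sv (2 * p) t) in E by ring. nra. }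
  unfold rate. split.
  - apply Rmult_le_compat_l; [lra|]. rewrite <- E. apply pow_incr. split; [apply pow_le; lra|].
    replace (sv (2 * p) t ^ 2) with (sv (2 * p) t * sv (2 * p) t) by ring. nra.
  - rewrite <- (Rmult_1_r rate0) at 2. apply Rmult_le_compat_l; [lra|]. rewrite <- (pow1 nu). apply pow_incr. lra.
Qed.

Definition rate' (t : R) : R := - (INR nu / INR (2 * p)) * sv p t ^ p * rate t.

Lemma is_derive_rate t : 0 < t -> is_derive rate t (rate' t).
Proof.
  intros Ht. assert (Hp := ds_p_pos). evar_last.
  - apply (is_derive_scal (fun t => sv (2 * p) t ^ nu)). apply is_derive_svpow; [lia|exact Ht].
  - unfold rate', rate. rewrite pow_add, (sv_pow_p (2 * p)), (sv_pow_p p) by (lia || lra).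
    unfold scal; simpl. unfold mult; simpl. ring.
Qed.

Lemma rate'_bound t : 0 < sv p t <= 1 -> Rabs (rate' t) <= sv p t * sv p t ^ nu * rate t.
Proof.
  intros Hs. assert (Hp := ds_p_pos). assert (Hk := rate_pos t). unfold rate'.
  rewrite !Rabs_mult, Rabs_Ropp, (Rabs_pos_eq (rate t)) by lra. apply Rmult_le_compat_r; [lra|].
  rewrite (Rabs_pos_eq (sv p t ^ p)) by (apply pow_le; lra).
  assert (H2p : 0 < INR (2 * p)) by (apply lt_0_INR; lia).
  rewrite Rabs_pos_eq by (apply Rdiv_le_0_compat; [apply pos_INR|exact H2p]).
  assert (INR nu / INR (2 * p) <= 1).
  { apply Rle_div_l; [exact H2p|]. rewrite Rmult_1_l. apply le_INR. destruct DS. lia. }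
  assert (sv p t ^ p <= sv p t ^ S nu) by (apply pow_le_pow; [lra|destruct DS; lia]).
  assert (0 <= INR nu / INR (2 * p)) by (apply Rdiv_le_0_compat; [apply pos_INR|exact H2p]).
  apply Rle_trans with (1 * sv p t ^ S nu); [|simpl; lra].
  apply Rmult_le_compat; auto. apply pow_le; lra.
Qed.

Definition u_of (t P Q : R) : R := (P - Q) / (2 * rate t).
Definition v_of (P Q : R) : R := (P + Q) / 2.

(** For sg = 1 the velocity of P = v + k u, for sg = -1 that of Q = v - k u.
    The coordinates u and v are recovered by [u_of] and [v_of]. *)
Definition pq_dot (sg : R) (N : nat) (t P Q : R) : R :=
  vdot N t (u_of t P Q) (v_of P Q) + sg * (rate t * udot N t (u_of t P Q) (v_of P Q) + rate' t * u_of t P Q).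

(** The rate k is of size s^(nu/2), and all other terms are smaller by a factor s.
    Dividing P - Q by k loses s^nu, hence the exponent p + 2 nu + 2. *)
Lemma saddle_estimate N : (p + nu + 1 <= N)%nat -> at_infty (fun t => forall P Q,
  Rabs P <= sv p t ^ (p + 2 * nu + 2) -> Rabs Q <= sv p t ^ (p + 2 * nu + 2) ->
  Rabs (pq_dot 1 N t P Q - rate t * P) <= rate t / 8 * (Rabs P + Rabs Q) + sv p t ^ (N - 1) /\
  Rabs (pq_dot (-1) N t P Q + rate t * Q) <= rate t / 8 * (Rabs P + Rabs Q) + sv p t ^ (N - 1)).
Proof.
  intros HN. assert (Hp := ds_p_pos). destruct (coef_bounds) as (C & HC & HK).
  destruct (ds_lin DS N ltac:(lia)) as (Cn & HCn & HL).
  assert (Hk1 := rate0_pos).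
  set (Mc := (C * (1 + rate0) + (1 + rate0) * Cn + rate0) * (1 + rate0) / (2 * (- k0))).
  assert (HMc : 0 <= Mc).
  { unfold Mc. apply Rdiv_le_0_compat; [|lra]. apply Rmult_le_pos; [|lra].
    assert (0 <= C * (1 + rate0)) by (apply Rmult_le_pos; lra).
    assert (0 <= (1 + rate0) * Cn) by (apply Rmult_le_pos; lra). lra. }
  assert (HCn' : 0 <= (1 + rate0) * Cn) by (apply Rmult_le_pos; lra).
  set (D := 8 * Mc + (1 + rate0) * Cn + 1 + / rate0).
  assert (Hik : 0 < / rate0) by (apply Rinv_0_lt_compat, Hk1).
  assert (He : 0 < / D) by (apply Rinv_0_lt_compat; unfold D; lra).
  generalize (filter_and _ _ HK (filter_and _ _ HL (sv_eventually p _ Hp He))). apply filter_imp.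
  intros t ((K1 & K2 & K3 & K4 & _) & HLt & (H1 & H2 & H3)) P Q HP HQ.
  set (u := u_of t P Q). set (v := v_of P Q).
  assert (Hk := rate_pos t). destruct (rate_bounds t H3) as [Hkl Hku].
  assert (Eu : rate t * u = (P - Q) / 2) by (unfold u, u_of; field; lra).
  assert (EP : v + rate t * u = P) by (rewrite Eu; unfold v, v_of; field).
  assert (EQ : v - rate t * u = Q) by (rewrite Eu; unfold v, v_of; field).
  set (s := sv p t) in *.
  assert (Hs1 : s * D <= 1).
  { apply Rle_trans with (/ D * D); [apply Rmult_le_compat_r; unfold D in *; lra|]. right. field. unfold D; lra. }
  assert (B1 : s * (8 * Mc) <= 1) by (unfold D in Hs1; nra).
  assert (B2 : s * ((1 + rate0) * Cn) <= 1) by (unfold D in Hs1; nra).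
  assert (B3 : s * / rate0 <= 1) by (unfold D in Hs1; nra).
  assert (Hh : 0 < s ^ nu) by (apply pow_lt; lra).
  assert (Hr : 0 < s ^ (p + nu + 1)) by (apply pow_lt; lra).
  assert (Er : s ^ (p + 2 * nu + 2) = s * s ^ nu * s ^ (p + nu + 1)).
  { change (s * s ^ nu) with (s ^ S nu). rewrite <- pow_add. f_equal. lia. }
  assert (Hu : Rabs u <= s ^ (p + nu + 1)).
  { apply (Rmult_le_reg_l (rate t)); [exact Hk|].
    rewrite <- (Rabs_pos_eq (rate t)) at 1 by lra. rewrite <- Rabs_mult, Eu. unfold Rdiv.
    rewrite Rabs_mult, (Rabs_pos_eq (/ 2)) by lra.
    generalize (Rabs_triang P (- Q)). rewrite Rabs_Ropp. intros T.
    apply Rle_trans with (s * s ^ nu * s ^ (p + nu + 1)); [unfold Rminus; lra|].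
    apply Rmult_le_compat_r; [lra|].
    apply Rle_trans with (rate0 * s ^ nu); [|exact Hkl]. apply Rmult_le_compat_r; [lra|].
    apply (Rmult_le_reg_r (/ rate0)); [exact Hik|]. rewrite Rinv_r by lra. exact B3. }
  assert (Hv : Rabs v <= s ^ (p + nu + 1)).
  { unfold v, v_of, Rdiv. rewrite Rabs_mult, (Rabs_pos_eq (/ 2)) by lra.
    generalize (Rabs_triang P Q). intros T.
    assert (s ^ (p + 2 * nu + 2) <= s ^ (p + nu + 1)) by (apply pow_le_pow; [lra|lia]). lra. }
  destruct (HLt u v Hu Hv) as [L1 L2]. fold (udot N t u v) in L1. fold (vdot N t u v) in L2.
  set (w := s * s ^ nu).
  assert (Ww : 0 < w) by (unfold w; apply Rmult_lt_0_compat; lra).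
  assert (E2 : s ^ (2 * n) <= w) by (unfold w; change (s * s ^ nu) with (s ^ S nu); apply pow_le_pow; [lra|destruct DS; lia]).
  assert (E3 : C * s ^ (2 * n) <= C * w) by (apply Rmult_le_compat_l; lra).
  assert (E4 : s ^ (p + nu + 1) <= w) by (unfold w; change (s * s ^ nu) with (s ^ S nu); apply pow_le_pow; [lra|lia]).
  assert (UV : 0 <= Rabs u + Rabs v) by (generalize (Rabs_pos u) (Rabs_pos v); lra).
  assert (E5 : Cn * s ^ (p + nu + 1) * (Rabs u + Rabs v) <= Cn * w * (Rabs u + Rabs v)).
  { apply Rmult_le_compat_r; [exact UV|]. apply Rmult_le_compat_l; lra. }
  assert (EN : s ^ N = s * s ^ (N - 1)).
  { replace N with (S (N - 1)) at 1 by lia. reflexivity. }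
  assert (HN1 : 0 <= s ^ (N - 1)) by (apply pow_le; lra).
  set (e1 := udot N t u v - (al s * u + be s * v)) in *.
  set (e2 := vdot N t u v - (- ka s * u + de s * v)) in *.
  assert (main : forall sg, Rabs sg <= 1 ->
    Rabs ((- ka s - rate t ^ 2) * u + de s * v + e2 + sg * (rate t * (al s * u + (be s - 1) * v + e1) + rate' t * u))
     <= rate t / 8 * (Rabs P + Rabs Q) + s ^ (N - 1)).
  { intros sg Hsg. eapply Rle_trans.
    - apply (hyperbolic_error (- k0) rate0 s (rate t) (rate' t) w C Cn (s ^ N)); try assumption; try lra.
      + rewrite rate_sq. fold s. unfold w. ring.
      + apply pow_le; lra.
      + rewrite rate_sq. fold s. replace (ka s + - k0 * s ^ nu) with (ka s - k0 * s ^ nu) by ring. exact K4.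
      + apply rate'_bound. fold s. lra.
      + eapply Rle_trans; [exact L1|]. apply Rplus_le_compat_r. exact E5.
      + eapply Rle_trans; [exact L2|]. apply Rplus_le_compat_r. exact E5.
    - rewrite EP, EQ. fold Mc. rewrite EN.
      assert (PQ : 0 <= rate t * (Rabs P + Rabs Q)).
      { apply Rmult_le_pos; [lra|]. generalize (Rabs_pos P) (Rabs_pos Q). lra. }
      apply Rplus_le_compat.
      + replace (Mc * s * rate t * (Rabs P + Rabs Q)) with (s * (8 * Mc) * (rate t * (Rabs P + Rabs Q) / 8)) by field.
        replace (rate t / 8 * (Rabs P + Rabs Q)) with (1 * (rate t * (Rabs P + Rabs Q) / 8)) by field.
        apply Rmult_le_compat_r; [lra|exact B1].
      + replace ((1 + rate0) * Cn * (s * s ^ (N - 1))) with (s * ((1 + rate0) * Cn) * s ^ (N - 1)) by ring.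
        rewrite <- (Rmult_1_l (s ^ (N - 1))) at 2. apply Rmult_le_compat_r; [exact HN1|exact B2]. }
  split.
  - replace (pq_dot 1 N t P Q - rate t * P) with
      ((- ka s - rate t ^ 2) * u + de s * v + e2 + 1 * (rate t * (al s * u + (be s - 1) * v + e1) + rate' t * u)).
    + apply main. rewrite Rabs_R1. lra.
    + unfold pq_dot. fold u v. rewrite <- EP. unfold e1, e2. ring.
  - replace (pq_dot (-1) N t P Q + rate t * Q) with
      ((- ka s - rate t ^ 2) * u + de s * v + e2 + -1 * (rate t * (al s * u + (be s - 1) * v + e1) + rate' t * u)).
    + apply main. rewrite Rabs_left; lra.
    + unfold pq_dot. fold u v. rewrite <- EQ. unfold e1, e2. ring.
Qed.

Lemma u_of_coord t u v : u_of t (v + rate t * u) (v - rate t * u) = u.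
Proof. unfold u_of. field. apply Rgt_not_eq, (rate_pos). Qed.

Lemma v_of_coord t u v : v_of (v + rate t * u) (v - rate t * u) = v.
Proof. unfold v_of. field. Qed.

Lemma rate_bigO : bigO p 0 rate.
Proof.
  assert (Hp := ds_p_pos). exists rate0. split; [apply Rlt_le, (rate0_pos)|].
  generalize (sv_eventually p 1 Hp Rlt_0_1). apply filter_imp. intros t Ht. simpl.
  generalize (rate_pos t) (rate_bounds t ltac:(lra)). intros A [_ B].
  rewrite Rabs_pos_eq; lra.
Qed.

(** The exponent of the rate is at most nu, and nu < p. *)
Lemma rate_dominates c : 0 <= c -> at_infty (fun t => c * sv p t ^ p <= rate t).
Proof.
  intros Hc. assert (Hp := ds_p_pos). assert (Hk := rate0_pos).
  assert (He : 0 < rate0 / (c + 1)) by (apply Rdiv_lt_0_compat; lra).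
  generalize (sv_eventually p _ Hp He). apply filter_imp. intros t (H1 & H2 & H3).
  destruct (rate_bounds t H3) as [B _]. eapply Rle_trans; [|exact B].
  apply Rle_trans with (c * (sv p t * sv p t ^ nu)).
  - apply Rmult_le_compat_l; [exact Hc|]. change (sv p t * sv p t ^ nu) with (sv p t ^ S nu).
    apply pow_le_pow; [lra|destruct DS; lia].
  - rewrite <- Rmult_assoc. apply Rmult_le_compat_r; [apply pow_le; lra|].
    apply Rle_trans with ((c + 1) * (rate0 / (c + 1))); [apply Rmult_le_compat; lra|]. right; field; lra.
Qed.

Lemma is_derive_coords N (x y : R -> R) dx dy sg t : 0 < t -> is_derive x t dx -> is_derive y t dy ->
  is_derive (fun t => (y t - spoly b N (sv p t)) + sg * (rate t * (x t - spoly a N (sv p t)))) t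
   ((dy - Derive (fun t => spoly b N (sv p t)) t)
    + sg * (rate t * (dx - Derive (fun t => spoly a N (sv p t)) t) + rate' t * (x t - spoly a N (sv p t)))).
Proof.
  intros Ht Hx Hy.
  apply (is_derive_plus (fun t => y t - spoly b N (sv p t)) (fun t => sg * (rate t * (x t - spoly a N (sv p t))))).
  - apply (is_derive_minus y (fun t => spoly b N (sv p t))); [exact Hy|apply (ds_dY); exact Ht].
  - apply (is_derive_scal (fun t => rate t * (x t - spoly a N (sv p t)))). evar_last.
    + apply (is_derive_mult rate (fun t => x t - spoly a N (sv p t))); [apply (is_derive_rate); exact Ht| |intros; apply Rmult_comm].
      apply (is_derive_minus x (fun t => spoly a N (sv p t))); [exact Hx|apply (ds_dX); exact Ht].
    + unfold plus, mult, minus, opp, plus; simpl. unfold mult; simpl. ring.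
Qed.

(** As for the oscillating branch, but in two steps: P^2 - Q^2 cannot have been large, since it
    would not have decayed afterwards; given that, Q^2 is damped at the rate k. *)
Lemma saddle_bootstrap N0 i t0 (x y : R -> R) : 0 < t0 -> (p + 2 * nu + 3 <= i)%nat -> (i <= N0)%nat ->
  (forall t, t0 < t -> is_derive x t (f1 (x t) (y t) t) /\ is_derive y t (f2 (x t) (y t) t)) ->
  bigO p i (fun t => x t - spoly a N0 (sv p t)) -> bigO p i (fun t => y t - spoly b N0 (sv p t)) ->
  forall N, (N0 + p + 2 <= N)%nat -> bigO p (N - (p + nu + 2)) (fun t => x t - spoly a N (sv p t)) /\
    bigO p (N - (p + nu + 2)) (fun t => y t - spoly b N (sv p t)).
Proof.
  intros Ht0 Hi Hi0 Hsol HX HY N HN. assert (Hp := ds_p_pos). assert (Hp1 := INR_p_ge1).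
  assert (Hnu : (nu <= p)%nat) by (destruct DS; lia). assert (Hk1 := rate0_pos).
  set (u := fun t => x t - spoly a N (sv p t)). set (v := fun t => y t - spoly b N (sv p t)).
  assert (Hu : bigO p i u).
  { assert (T := spoly_tail p a N0 N Hp ltac:(lia)). apply (bigO_weak p _ i) in T; [|exact Hp|lia].
    generalize (bigO_minus _ _ _ _ HX T). apply bigO_ext'. intros t. unfold u. ring. }
  assert (Hv : bigO p i v).
  { assert (T := spoly_tail p b N0 N Hp ltac:(lia)). apply (bigO_weak p _ i) in T; [|exact Hp|lia].
    generalize (bigO_minus _ _ _ _ HY T). apply bigO_ext'. intros t. unfold v. ring. }
  set (P := fun t => v t + rate t * u t). set (Q := fun t => v t - rate t * u t).
  assert (HKu : bigO p i (fun t => rate t * u t)) by apply (bigO_mult p 0 i _ _ rate_bigO Hu).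
  assert (HP : bigO p i P) by (apply bigO_plus; assumption).
  assert (HQ : bigO p i Q) by (apply bigO_minus; assumption).
  set (P' := fun t => pq_dot 1 N t (P t) (Q t)). set (Q' := fun t => pq_dot (-1) N t (P t) (Q t)).
  assert (Evel : forall sg t, pq_dot sg N t (P t) (Q t) =
     (f2 (x t) (y t) t - Derive (fun t => spoly b N (sv p t)) t)
      + sg * (rate t * (f1 (x t) (y t) t - Derive (fun t => spoly a N (sv p t)) t) + rate' t * u t)).
  { intros sg t. unfold pq_dot. unfold P, Q. rewrite u_of_coord, v_of_coord. unfold udot, vdot.
    replace (spoly a N (sv p t) + u t) with (x t) by (unfold u; ring).
    replace (spoly b N (sv p t) + v t) with (y t) by (unfold v; ring). reflexivity. }
  assert (DP : forall t, t0 < t -> is_derive P t (P' t)).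
  { intros t Ht. destruct (Hsol t Ht) as [Dx Dy]. unfold P'. rewrite Evel.
    assert (E : forall r : R, (y r - spoly b N (sv p r)) + 1 * (rate r * (x r - spoly a N (sv p r))) = P r)
      by (intros; unfold P, u, v; ring).
    apply (is_derive_ext _ _ _ _ E), (is_derive_coords N x y _ _ 1 t ltac:(lra) Dx Dy). }
  assert (DQ : forall t, t0 < t -> is_derive Q t (Q' t)).
  { intros t Ht. destruct (Hsol t Ht) as [Dx Dy]. unfold Q'. rewrite Evel.
    assert (E : forall r : R, (y r - spoly b N (sv p r)) + -1 * (rate r * (x r - spoly a N (sv p r))) = Q r)
      by (intros; unfold Q, u, v; ring).
    apply (is_derive_ext _ _ _ _ E), (is_derive_coords N x y _ _ (-1) t ltac:(lra) Dx Dy). }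
  set (J := (2 * N - 3 - nu)%nat).
  assert (Hcone : at_infty (fun t => - sv p t ^ J <= 2 * P t * P' t - 2 * Q t * Q' t /\
     2 * Q t * Q' t <= - rate t * Q t ^ 2 + rate t / 8 * (P t ^ 2 - Q t ^ 2) + sv p t ^ J)).
  { assert (A : bigO p (S (p + 2 * nu + 2)) P) by (apply (bigO_weak p i); auto; lia).
    assert (B : bigO p (S (p + 2 * nu + 2)) Q) by (apply (bigO_weak p i); auto; lia).
    assert (He : 0 < rate0 / 4) by lra.
    assert (HNp : (p + nu + 1 <= N)%nat) by lia.
    generalize (filter_and _ _ (bigO_small p _ _ 1 Hp Rlt_0_1 A) (filter_and _ _ (bigO_small p _ _ 1 Hp Rlt_0_1 B)
      (filter_and _ _ (saddle_estimate N HNp) (sv_eventually p _ Hp He)))).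
    apply filter_imp. intros t (K1 & K2 & K3 & (H1 & H2 & H3)). rewrite Rmult_1_l in K1, K2.
    destruct (K3 _ _ K1 K2) as [L1 L2]. fold (P' t) in L1. fold (Q' t) in L2.
    assert (Hk := rate_pos t). destruct (rate_bounds t H3) as [Hkl _].
    destruct (saddle_cone (rate t) (P t) (Q t) (P' t) (Q' t) (sv p t ^ (N - 1)) Hk ltac:(apply pow_le; lra) L1 L2) as [M1 M2].
    assert (Hz : 4 * ((sv p t ^ (N - 1)) ^ 2 / rate t) <= sv p t ^ J).
    { replace (4 * ((sv p t ^ (N - 1)) ^ 2 / rate t)) with (4 * (sv p t ^ (N - 1)) ^ 2 / rate t) by (unfold Rdiv; ring).
      apply Rle_div_l; [exact Hk|].
      apply Rle_trans with (sv p t ^ J * (rate0 * sv p t ^ nu)).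
      - replace ((sv p t ^ (N - 1)) ^ 2) with (sv p t ^ J * (sv p t * sv p t ^ nu)).
        + assert (0 < sv p t ^ J * sv p t ^ nu) by (apply Rmult_lt_0_compat; apply pow_lt; lra).
          replace (4 * (sv p t ^ J * (sv p t * sv p t ^ nu))) with (4 * sv p t * (sv p t ^ J * sv p t ^ nu)) by ring.
          replace (sv p t ^ J * (rate0 * sv p t ^ nu)) with (rate0 * (sv p t ^ J * sv p t ^ nu)) by ring.
          apply Rmult_le_compat_r; lra.
        + change (sv p t * sv p t ^ nu) with (sv p t ^ S nu). rewrite <- pow_add, <- pow_mult. f_equal. unfold J. lia.
      - apply Rmult_le_compat_l; [apply pow_le; lra|exact Hkl]. }
    split; lra. }
  assert (HD : bigO p (2 * i) (fun t => P t ^ 2 - Q t ^ 2)).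
  { apply (bigO_ext' p (2 * i) (fun t => P t * P t - Q t * Q t)); [intros; ring|].
    replace (2 * i)%nat with (i + i)%nat by lia. apply bigO_minus; apply bigO_mult; assumption. }
  destruct Hcone as [T1 HT1].
  assert (HDle : forall t, Rmax T1 t0 < t -> P t ^ 2 - Q t ^ 2 <= 1 * INR p * sv p t ^ (J - p)).
  { generalize (Rmax_l T1 t0) (Rmax_r T1 t0). intros M1 M2.
    apply (decay_from_infinity p 0 (2 * i) J 1 (Rmax T1 t0) (fun t => P t ^ 2 - Q t ^ 2) (fun t => 2 * P t * P' t - 2 * Q t * Q' t)); auto;
      try lia; try lra; try (unfold J; lia).
    - intros t Ht. evar_last.
      + apply (is_derive_minus (fun t => P t ^ 2) (fun t => Q t ^ 2)); apply is_derive_pow; [apply DP; lra|apply DQ; lra].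
      + unfold minus, plus, opp; simpl. ring.
    - intros t Ht. destruct (HT1 t ltac:(lra)) as [A _]. simpl INR. unfold Rdiv. rewrite Rmult_0_l. lra. }
  assert (HQ2 : exists C, 0 <= C /\ at_infty (fun t => Q t ^ 2 <= C * sv p t ^ (J - p - p))).
  { destruct (filter_and _ _ (rate_dominates (INR (J - p)) (pos_INR _)) (sv_eventually p 1 Hp Rlt_0_1)) as [T2 HT2].
    set (T0 := Rmax (Rmax T1 t0) T2).
    assert (M1 : Rmax T1 t0 <= T0) by apply Rmax_l. assert (M2 : T2 <= T0) by apply Rmax_r.
    assert (M3 : T1 <= Rmax T1 t0) by apply Rmax_l. assert (M4 : t0 <= Rmax T1 t0) by apply Rmax_r.
    apply (decay_by_damping p (J - p) (rate0 * INR p + 1) T0 (fun t => Q t ^ 2) (fun t => 2 * Q t * Q' t)); auto; try lra.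
    - unfold J. lia.
    - assert (0 <= rate0 * INR p) by (apply Rmult_le_pos; lra). lra.
    - intros t Ht. evar_last; [apply is_derive_pow, DQ; lra|]. simpl. ring.
    - intros t Ht. destruct (HT1 t ltac:(lra)) as [_ A]. specialize (HDle t ltac:(lra)).
      destruct (HT2 t ltac:(lra)) as [B1 (B2 & B3 & B4)].
      assert (Hk := rate_pos t). destruct (rate_bounds t B4) as [_ Hku].
      assert (S1 : 0 < sv p t ^ (J - p)) by (apply pow_lt; lra).
      assert (S2 : sv p t ^ J <= sv p t ^ (J - p)) by (apply pow_le_pow; [lra|lia]).
      assert (Q2 := pow2_ge_0 (Q t)).
      assert (C1 : rate t / 8 * (P t ^ 2 - Q t ^ 2) <= rate t / 8 * (1 * INR p * sv p t ^ (J - p))) by (apply Rmult_le_compat_l; lra).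
      assert (C2 : rate t * (INR p * sv p t ^ (J - p)) <= rate0 * (INR p * sv p t ^ (J - p))).
      { apply Rmult_le_compat_r; [apply Rmult_le_pos; lra|exact Hku]. }
      assert (C3 : 0 <= rate0 * (INR p * sv p t ^ (J - p))) by (apply Rmult_le_pos; [lra|apply Rmult_le_pos; lra]).
      assert (C4 : INR (J - p) / INR p * sv p t ^ p * Q t ^ 2 <= rate t * Q t ^ 2).
      { apply Rmult_le_compat_r; [exact Q2|]. eapply Rle_trans; [|exact B1].
        apply Rmult_le_compat_r; [apply pow_le; lra|]. apply Rle_div_l; [lra|].
        generalize (pos_INR (J - p)). nra. }
      lra. }
  destruct HQ2 as (C & HC & HQ2).
  set (j := (N - (p + nu + 2))%nat).
  assert (HF : at_infty (fun t => Rabs (u t) <= sv p t ^ j /\ Rabs (v t) <= sv p t ^ j)).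
  { set (C' := C + INR p).
    assert (He : 0 < Rmin 1 (rate0 ^ 2) / (C' + 1)).
    { apply Rdiv_lt_0_compat; [apply Rmin_pos; [lra|apply pow_lt; lra]|unfold C'; lra]. }
    destruct (filter_and _ _ HQ2 (sv_eventually p _ Hp He)) as [T2 HT2].
    exists (Rmax (Rmax T1 t0) T2). intros t Ht.
    assert (M1 : Rmax T1 t0 <= Rmax (Rmax T1 t0) T2) by apply Rmax_l. assert (M2 : T2 <= Rmax (Rmax T1 t0) T2) by apply Rmax_r.
    specialize (HDle t ltac:(lra)). destruct (HT2 t ltac:(lra)) as [B1 (B2 & B3 & B4)].
    set (s := sv p t) in *.
    assert (S2 : s ^ (J - p) <= s ^ (J - p - p)) by (apply pow_le_pow; [lra|lia]).
    assert (S3 : INR p * s ^ (J - p) <= INR p * s ^ (J - p - p)) by (apply Rmult_le_compat_l; lra).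
    assert (Hcs : C' * s <= Rmin 1 (rate0 ^ 2)).
    { apply Rle_trans with ((C' + 1) * (Rmin 1 (rate0 ^ 2) / (C' + 1))).
      - apply Rmult_le_compat; unfold C' in *; lra.
      - right. field. unfold C'; lra. }
    assert (Hc1 : C' * s <= 1) by (eapply Rle_trans; [exact Hcs|apply Rmin_l]).
    assert (Hc2 : C' * s <= rate0 ^ 2) by (eapply Rle_trans; [exact Hcs|apply Rmin_r]).
    assert (EJ : s ^ (J - p - p) = s * (s ^ nu * (s ^ j) ^ 2)).
    { rewrite <- pow_mult, <- pow_add. change (s * s ^ (nu + j * 2)) with (s ^ S (nu + j * 2)). f_equal. unfold J, j. lia. }
    assert (Hh : 0 < s ^ nu <= 1).
    { split; [apply pow_lt; lra|]. rewrite <- (pow_O s). apply pow_le_pow; [lra|lia]. }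
    assert (Hj : 0 <= s ^ j) by (apply pow_le; lra).
    assert (W0 : 0 <= s ^ nu * (s ^ j) ^ 2) by (apply Rmult_le_pos; [lra|apply pow2_ge_0]).
    assert (PQ : v t ^ 2 + rate t ^ 2 * u t ^ 2 <= C' * s * (s ^ nu * (s ^ j) ^ 2)).
    { replace (v t ^ 2 + rate t ^ 2 * u t ^ 2) with ((P t ^ 2 + Q t ^ 2) / 2) by (unfold P, Q; field).
      rewrite EJ in *. unfold C'.
      assert (0 <= INR p * (s * (s ^ nu * (s ^ j) ^ 2))) by (repeat apply Rmult_le_pos; lra). lra. }
    rewrite (rate_sq), <- (rate0_sq) in PQ. fold s in PQ.
    assert (U2 : 0 <= rate0 ^ 2 * s ^ nu * u t ^ 2).
    { apply Rmult_le_pos; [|apply pow2_ge_0]. apply Rmult_le_pos; [apply pow2_ge_0|lra]. }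
    split; apply sq_le_abs; try exact Hj.
    - apply (Rmult_le_reg_l (rate0 ^ 2 * s ^ nu)); [apply Rmult_lt_0_compat; [apply pow_lt; lra|lra]|].
      apply Rle_trans with (C' * s * (s ^ nu * (s ^ j) ^ 2)); [generalize (pow2_ge_0 (v t)); lra|].
      rewrite (Rmult_assoc (rate0 ^ 2)). apply Rmult_le_compat_r; [exact W0|exact Hc2].
    - apply Rle_trans with (C' * s * (s ^ nu * (s ^ j) ^ 2)); [lra|].
      apply Rle_trans with (1 * (s ^ nu * (s ^ j) ^ 2)); [apply Rmult_le_compat_r; [exact W0|exact Hc1]|].
      rewrite Rmult_1_l. rewrite <- (Rmult_1_l ((s ^ j) ^ 2)) at 2. apply Rmult_le_compat_r; [apply pow2_ge_0|lra]. }
  split; exists 1; (split; [lra|]); revert HF; apply filter_imp; intros t [F1 F2]; rewrite Rmult_1_l; assumption.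
Qed.

Lemma pq_dot_continuous sg N (tau P Q : R -> R) t : continuous tau t -> continuous P t -> continuous Q t -> 0 < tau t ->
  continuous (fun t => pq_dot sg N (tau t) (P t) (Q t)) t.
Proof.
  intros Ht HP HQ H0. assert (Hp := ds_p_pos).
  assert (Hcomp : forall h : R -> R, continuous h (tau t) -> continuous (fun t => h (tau t)) t).
  { intros h Hh. apply (continuous_comp tau h); assumption. }
  assert (Hm : forall f g : R -> R, continuous f t -> continuous g t -> continuous (fun t => f t * g t) t).
  { intros f g Hf Hg. apply (continuous_mult f g); assumption. }
  assert (Hpl : forall f g : R -> R, continuous f t -> continuous g t -> continuous (fun t => f t + g t) t).
  { intros f g Hf Hg. apply (continuous_plus f g); assumption. }
  assert (Hmi : forall f g : R -> R, continuous f t -> continuous g t -> continuous (fun t => f t - g t) t).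
  { intros f g Hf Hg. apply (continuous_minus f g); assumption. }
  assert (Hc : forall c : R, continuous (fun _ : R => c) t) by (intros; apply continuous_const).
  assert (CX : continuous (fun t => spoly a N (sv p (tau t))) t).
  { apply (Hcomp (fun t => spoly a N (sv p t))). apply (ex_derive_continuous (fun t => spoly a N (sv p t))).
    eexists. apply (ds_dX), H0. }
  assert (CY : continuous (fun t => spoly b N (sv p (tau t))) t).
  { apply (Hcomp (fun t => spoly b N (sv p t))). apply (ex_derive_continuous (fun t => spoly b N (sv p t))).
    eexists. apply (ds_dY), H0. }
  assert (CDX : continuous (fun t => Derive (fun t => spoly a N (sv p t)) (tau t)) t).
  { apply (Hcomp (Derive (fun t => spoly a N (sv p t)))). apply continuous_Derive_sv; auto using spoly_smooth. }
  assert (CDY : continuous (fun t => Derive (fun t => spoly b N (sv p t)) (tau t)) t).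
  { apply (Hcomp (Derive (fun t => spoly b N (sv p t)))). apply continuous_Derive_sv; auto using spoly_smooth. }
  assert (CK : continuous (fun t => rate (tau t)) t).
  { apply (Hcomp rate). apply (ex_derive_continuous rate). eexists. apply (is_derive_rate), H0. }
  assert (Cs : continuous (fun t => sv p (tau t) ^ p) t).
  { apply (Hcomp (fun t => sv p t ^ p)). apply (ex_derive_continuous (fun t => sv p t ^ p)). eexists. apply is_derive_svpow; auto. }
  assert (CK' : continuous (fun t => rate' (tau t)) t).
  { unfold rate'. apply Hm; [apply Hm; [apply Hc|exact Cs]|exact CK]. }
  assert (Cu : continuous (fun t => u_of (tau t) (P t) (Q t)) t).
  { unfold u_of, Rdiv. apply Hm; [apply Hmi; assumption|].
    apply (continuous_comp (fun t => 2 * rate (tau t)) Rinv); [apply Hm; [apply Hc|exact CK]|].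
    apply continuous_Rinv. assert (H := rate_pos (tau t)). lra. }
  assert (Cw : continuous (fun t => v_of (P t) (Q t)) t).
  { unfold v_of, Rdiv. apply Hm; [apply Hpl; assumption|apply Hc]. }
  assert (C1 : continuous (fun t => f1 (spoly a N (sv p (tau t)) + u_of (tau t) (P t) (Q t)) (spoly b N (sv p (tau t)) + v_of (P t) (Q t)) (tau t)) t).
  { apply (ds_cont1 DS (fun t => spoly a N (sv p (tau t)) + u_of (tau t) (P t) (Q t)) (fun t => spoly b N (sv p (tau t)) + v_of (P t) (Q t)) tau); auto. }
  assert (C2 : continuous (fun t => f2 (spoly a N (sv p (tau t)) + u_of (tau t) (P t) (Q t)) (spoly b N (sv p (tau t)) + v_of (P t) (Q t)) (tau t)) t).
  { apply (ds_cont2 DS (fun t => spoly a N (sv p (tau t)) + u_of (tau t) (P t) (Q t)) (fun t => spoly b N (sv p (tau t)) + v_of (P t) (Q t)) tau); auto. }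
  unfold pq_dot, udot, vdot.
  apply Hpl; [apply Hmi; [exact C2|exact CDY]|]. apply Hm; [apply Hc|].
  apply Hpl; [apply Hm; [exact CK|apply Hmi; [exact C1|exact CDX]]|]. apply Hm; [exact CK'|exact Cu].
Qed.

(** The tube is |P|, |Q| <= s^tube_order; the order exceeds p + 2 nu + 3 by nu + 1 since u is
    obtained from P - Q by dividing by k. *)
Definition tube_order : nat := p + 3 * nu + 4.
Definition base_order : nat := tube_order + nu + 3.
Definition tube (t : R) : R := sv p t ^ tube_order.

Definition good_time (t : R) : Prop :=
  0 < sv p t <= 1 / 2 /\
  (forall P Q, Rabs P <= tube t -> Rabs Q <= tube t ->
    Rabs (pq_dot 1 base_order t P Q - rate t * P) <= rate t / 2 * tube t /\
    Rabs (pq_dot (-1) base_order t P Q + rate t * Q) <= rate t / 2 * tube t) /\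
  INR tube_order / INR p * sv p t ^ (tube_order + p) < rate t / 2 * tube t /\
  Rabs (spoly a base_order (sv p t)) <= 1 / 2 /\ Rabs (spoly b base_order (sv p t)) <= 1 / 2 /\
  (forall P Q, Rabs P <= tube t -> Rabs Q <= tube t ->
    Rabs (u_of t P Q) <= sv p t ^ (p + 2 * nu + 3) /\ Rabs (v_of P Q) <= sv p t ^ (p + 2 * nu + 3)).

Lemma at_infty_good : at_infty good_time.
Proof.
  assert (Hp := ds_p_pos). assert (Hp1 := INR_p_ge1). assert (Hk1 := rate0_pos).
  assert (HN : (p + nu + 1 <= base_order)%nat) by (unfold base_order, tube_order; lia).
  assert (Hd0 : 0 <= 2 * INR tube_order + 2) by (generalize (pos_INR tube_order); lra).
  assert (He : 0 < Rmin (1 / 2) (rate0 / 8)) by (apply Rmin_pos; lra).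
  generalize (filter_and _ _ (saddle_estimate base_order HN) (filter_and _ _ (rate_dominates _ Hd0)
    (filter_and _ _ (bigO_half _ _ Hp (ds_OX base_order)) (filter_and _ _ (bigO_half _ _ Hp (ds_OY base_order)) (sv_eventually p _ Hp He))))).
  apply filter_imp. intros t (H1 & H2 & H3 & H4 & (H5 & H6 & H7)).
  assert (M1 := Rmin_l (1 / 2) (rate0 / 8)). assert (M2 := Rmin_r (1 / 2) (rate0 / 8)).
  assert (Hk := rate_pos t). destruct (rate_bounds t H7) as [Hkl Hku].
  unfold good_time. set (s := sv p t) in *.
  assert (Hrho : 0 < tube t) by (unfold tube; apply pow_lt; fold s; lra).
  assert (Hh : 0 < s ^ nu) by (apply pow_lt; lra).
  assert (HP0 : 0 < s ^ p) by (apply pow_lt; lra).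
  assert (Hz : s ^ (base_order - 1) <= rate t / 4 * tube t).
  { unfold tube. fold s. replace (base_order - 1)%nat with (tube_order + (nu + 2))%nat by (unfold base_order; lia). rewrite pow_add, Rmult_comm.
    apply Rmult_le_compat_r; [apply pow_le; lra|]. rewrite pow_add.
    apply Rle_trans with (s ^ nu * (rate0 / 4)); [|lra]. apply Rmult_le_compat_l; [lra|]. simpl. nra. }
  assert (Hin : tube t <= s ^ (p + 2 * nu + 2)) by (unfold tube; fold s; apply pow_le_pow; [lra|unfold tube_order; lia]).
  split; [lra|]. split; [|split; [|split; [exact H3|split; [exact H4|]]]].
  - intros P Q HP HQ. destruct (H1 P Q ltac:(lra) ltac:(lra)) as [A B].
    assert (rate t / 8 * (Rabs P + Rabs Q) <= rate t / 8 * (2 * tube t)) by (apply Rmult_le_compat_l; lra).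
    split; lra.
  - unfold tube. fold s. rewrite pow_add.
    assert (Hm : INR tube_order / INR p <= INR tube_order) by (apply Rle_div_l; [lra|]; generalize (pos_INR tube_order); nra).
    apply Rlt_le_trans with ((INR tube_order + 1) * s ^ p * s ^ tube_order).
    + replace (INR tube_order / INR p * (s ^ tube_order * s ^ p)) with (INR tube_order / INR p * s ^ p * s ^ tube_order) by ring.
      apply Rmult_lt_compat_r; [exact Hrho|]. apply Rmult_lt_compat_r; lra.
    + apply Rmult_le_compat_r; [unfold tube in Hrho; fold s in Hrho; lra|]. lra.
  - intros P Q HP HQ.
    assert (Ei : tube t = s ^ nu * (s * s ^ (p + 2 * nu + 3))).
    { unfold tube. fold s. change (s * s ^ (p + 2 * nu + 3)) with (s ^ S (p + 2 * nu + 3)). rewrite <- pow_add. f_equal. unfold tube_order; lia. }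
    assert (Hi : 0 < s ^ (p + 2 * nu + 3)) by (apply pow_lt; lra).
    split.
    + apply (Rmult_le_reg_l (rate t)); [exact Hk|].
      rewrite <- (Rabs_pos_eq (rate t)) at 1 by lra. rewrite <- Rabs_mult.
      replace (rate t * u_of t P Q) with ((P - Q) * / 2) by (unfold u_of; field; lra).
      rewrite Rabs_mult, (Rabs_pos_eq (/ 2)) by lra.
      generalize (Rabs_triang P (- Q)). rewrite Rabs_Ropp. intros T. fold (P - Q) in T.
      apply Rle_trans with (tube t); [lra|]. rewrite Ei, <- Rmult_assoc. apply Rmult_le_compat_r; [lra|].
      apply Rle_trans with (rate0 * s ^ nu); [|exact Hkl]. rewrite Rmult_comm. apply Rmult_le_compat_r; lra.
    + unfold v_of, Rdiv. rewrite Rabs_mult, (Rabs_pos_eq (/ 2)) by lra.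
      generalize (Rabs_triang P Q). intros T.
      assert (tube t <= s ^ (p + 2 * nu + 3)) by (unfold tube; fold s; apply pow_le_pow; [lra|unfold tube_order; lia]). lra.
Qed.

(** Only the perturbation is clamped to the tube, while the linear saddle acts globally. Outside
    the tube |P| therefore keeps growing and no trajectory returns, as shooting requires. *)
Definition clampedP (t0 t P Q : R) : R := let r := Rmax t t0 in
  rate r * P + (pq_dot 1 base_order r (clamp (tube r) P) (clamp (tube r) Q) - rate r * clamp (tube r) P).
Definition clampedQ (t0 t P Q : R) : R := let r := Rmax t t0 in
  - rate r * Q + (pq_dot (-1) base_order r (clamp (tube r) P) (clamp (tube r) Q) + rate r * clamp (tube r) Q).

Lemma tube_pos t : 0 < tube t.
Proof. apply pow_lt, sv_pos. Qed.

Lemma tube_in_square t P Q : good_time t -> Rabs P <= tube t -> Rabs Q <= tube t ->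
  Rabs (spoly a base_order (sv p t) + u_of t P Q) <= 1 /\ Rabs (spoly b base_order (sv p t) + v_of P Q) <= 1.
Proof.
  intros (G1 & _ & _ & G4 & G5 & G6) HP HQ. destruct (G6 P Q HP HQ) as [A B].
  assert (E : sv p t ^ (p + 2 * nu + 3) <= sv p t ^ 1) by (apply pow_le_pow; [lra|lia]). rewrite pow_1 in E.
  split; (eapply Rle_trans; [apply Rabs_triang|]; lra).
Qed.

Lemma saddle_regular t0 : 0 < t0 -> (forall t, t0 <= t -> good_time t) -> regular_field (clampedP t0) (clampedQ t0).
Proof.
  intros Ht0 Hgood. assert (Hp := ds_p_pos). assert (Hk1 := rate0_pos). split.
  - intros P Q HP HQ t.
    assert (Hm : forall f g : R -> R, continuous f t -> continuous g t -> continuous (fun t => f t * g t) t).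
    { intros f g Hf Hg. apply (continuous_mult f g); assumption. }
    assert (Hpl : forall f g : R -> R, continuous f t -> continuous g t -> continuous (fun t => f t + g t) t).
    { intros f g Hf Hg. apply (continuous_plus f g); assumption. }
    assert (Hmi : forall f g : R -> R, continuous f t -> continuous g t -> continuous (fun t => f t - g t) t).
    { intros f g Hf Hg. apply (continuous_minus f g); assumption. }
    assert (Ct := continuous_Rmax_id t0 t).
    assert (Hr : 0 < Rmax t t0) by (eapply Rlt_le_trans; [exact Ht0|apply Rmax_r]).
    assert (CK : continuous (fun t => rate (Rmax t t0)) t).
    { apply (continuous_comp (fun t => Rmax t t0) rate); [exact Ct|]. apply (ex_derive_continuous rate). eexists. apply (is_derive_rate), Hr. }
    assert (Cr : continuous (fun t => tube (Rmax t t0)) t).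
    { apply (continuous_comp (fun t => Rmax t t0) tube); [exact Ct|]. apply (ex_derive_continuous tube). eexists. apply is_derive_svpow; auto. }
    assert (CP : continuous (fun t => clamp (tube (Rmax t t0)) (P t)) t) by (apply continuous_clamp; [exact Cr|apply HP]).
    assert (CQ : continuous (fun t => clamp (tube (Rmax t t0)) (Q t)) t) by (apply continuous_clamp; [exact Cr|apply HQ]).
    assert (CV : forall sg, continuous (fun t => pq_dot sg base_order (Rmax t t0) (clamp (tube (Rmax t t0)) (P t)) (clamp (tube (Rmax t t0)) (Q t))) t).
    { intros sg. apply (pq_dot_continuous sg base_order (fun t => Rmax t t0) (fun t => clamp (tube (Rmax t t0)) (P t)) (fun t => clamp (tube (Rmax t t0)) (Q t))); assumption. }
    split; unfold clampedP, clampedQ.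
    + apply Hpl; [apply Hm; [exact CK|apply HP]|]. apply Hmi; [apply CV|]. apply Hm; assumption.
    + apply Hpl; [apply Hm; [apply (continuous_opp (fun t => rate (Rmax t t0))), CK|apply HQ]|]. apply Hpl; [apply CV|]. apply Hm; assumption.
  - intros T. set (Tm := Rmax T t0).
    destruct (ds_lip1 DS t0 Tm Ht0) as (A & HA & LA).
    destruct (ds_lip2 DS t0 Tm Ht0) as (B & HB & LB).
    set (km := rate0 * sv p Tm ^ nu).
    assert (Hkm : 0 < km) by (apply Rmult_lt_0_compat; [exact Hk1|apply pow_lt, sv_pos]).
    assert (Hikm : 0 < / km) by (apply Rinv_0_lt_compat, Hkm).
    set (L := (B + rate0 * A + rate0) * (/ km + 1)).
    assert (HkA : 0 <= rate0 * A) by (apply Rmult_le_pos; lra).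
    assert (HL : 0 <= L) by (apply Rmult_le_pos; lra).
    exists (L + 2 * rate0 + 1). split; [lra|]. intros t P Q P' Q' Ht.
    set (r := Rmax t t0).
    assert (Hr0 : t0 <= r) by apply Rmax_r.
    assert (HrT : r <= Tm) by (apply Rle_max_compat_r; generalize (Rle_abs t); lra).
    assert (G := Hgood r Hr0). assert (Hs := proj1 G).
    assert (Hk := rate_pos r). destruct (rate_bounds r ltac:(lra)) as [Hkl Hku].
    assert (Hkmr : km <= rate r).
    { eapply Rle_trans; [|exact Hkl]. apply Rmult_le_compat_l; [lra|]. apply pow_incr.
      split; [apply Rlt_le, sv_pos|]. apply sv_anti; [exact Hp|lra|exact HrT]. }
    assert (Hk' : Rabs (rate' r) <= rate0).
    { eapply Rle_trans; [apply rate'_bound; lra|]. 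
      assert (sv p r * sv p r ^ nu <= 1).
      { change (sv p r * sv p r ^ nu) with (sv p r ^ S nu). rewrite <- (pow_O (sv p r)). apply pow_le_pow; [lra|lia]. }
      apply Rle_trans with (1 * rate r); [apply Rmult_le_compat_r; lra|lra]. }
    assert (Hrho := tube_pos r).
    set (cP := clamp (tube r) P). set (cQ := clamp (tube r) Q). set (cP' := clamp (tube r) P'). set (cQ' := clamp (tube r) Q').
    assert (BP : Rabs cP <= tube r) by (apply clamp_bound; lra). assert (BQ : Rabs cQ <= tube r) by (apply clamp_bound; lra).
    assert (BP' : Rabs cP' <= tube r) by (apply clamp_bound; lra). assert (BQ' : Rabs cQ' <= tube r) by (apply clamp_bound; lra).
    set (D := Rabs (P - P') + Rabs (Q - Q')).
    assert (D1 : Rabs (cP - cP') <= Rabs (P - P')) by (apply clamp_lip; lra).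
    assert (D2 : Rabs (cQ - cQ') <= Rabs (Q - Q')) by (apply clamp_lip; lra).
    assert (HD : 0 <= D) by (unfold D; generalize (Rabs_pos (P - P')) (Rabs_pos (Q - Q')); lra).
    assert (Du : Rabs (u_of r cP cQ - u_of r cP' cQ') <= / km * D).
    { replace (u_of r cP cQ - u_of r cP' cQ') with (((cP - cP') - (cQ - cQ')) * / (2 * rate r)) by (unfold u_of; field; lra).
      rewrite Rabs_mult. rewrite (Rabs_pos_eq (/ (2 * rate r))) by (apply Rlt_le, Rinv_0_lt_compat; lra).
      rewrite Rmult_comm. apply Rmult_le_compat; try apply Rabs_pos.
      - apply Rlt_le, Rinv_0_lt_compat; lra.
      - apply Rinv_le_contravar; lra.
      - generalize (Rabs_triang (cP - cP') (- (cQ - cQ'))). rewrite Rabs_Ropp. unfold D, Rminus at 5. fold (cP - cP' - (cQ - cQ')). lra. }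
    assert (Dw : Rabs (v_of cP cQ - v_of cP' cQ') <= D).
    { replace (v_of cP cQ - v_of cP' cQ') with (((cP - cP') + (cQ - cQ')) * / 2) by (unfold v_of; field).
      rewrite Rabs_mult, (Rabs_pos_eq (/ 2)) by lra. generalize (Rabs_triang (cP - cP') (cQ - cQ')). unfold D in *. lra. }
    destruct (tube_in_square r cP cQ G BP BQ) as [X1 Y1]. destruct (tube_in_square r cP' cQ' G BP' BQ') as [X2 Y2].
    assert (Dv : forall sg, Rabs sg <= 1 -> Rabs (pq_dot sg base_order r cP cQ - pq_dot sg base_order r cP' cQ') <= L * D).
    { intros sg Hsg.
      specialize (LA r _ _ _ _ (conj Hr0 HrT) X1 Y1 X2 Y2). specialize (LB r _ _ _ _ (conj Hr0 HrT) X1 Y1 X2 Y2).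
      match type of LA with _ <= A * (Rabs ?x + Rabs ?y) =>
        replace x with (u_of r cP cQ - u_of r cP' cQ') in LA by ring; replace y with (v_of cP cQ - v_of cP' cQ') in LA by ring end.
      match type of LB with _ <= B * (Rabs ?x + Rabs ?y) =>
        replace x with (u_of r cP cQ - u_of r cP' cQ') in LB by ring; replace y with (v_of cP cQ - v_of cP' cQ') in LB by ring end.
      assert (SA : A * (Rabs (u_of r cP cQ - u_of r cP' cQ') + Rabs (v_of cP cQ - v_of cP' cQ')) <= A * ((/ km + 1) * D)) by (apply Rmult_le_compat_l; lra).
      assert (SB : B * (Rabs (u_of r cP cQ - u_of r cP' cQ') + Rabs (v_of cP cQ - v_of cP' cQ')) <= B * ((/ km + 1) * D)) by (apply Rmult_le_compat_l; lra).
      unfold pq_dot, udot, vdot.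
      match goal with |- Rabs (?F2 - ?d2 + sg * (rate r * (?F1 - ?d1) + rate' r * ?U) - (?F2' - ?d2 + sg * (rate r * (?F1' - ?d1) + rate' r * ?U'))) <= _ =>
        replace (F2 - d2 + sg * (rate r * (F1 - d1) + rate' r * U) - (F2' - d2 + sg * (rate r * (F1' - d1) + rate' r * U'))) with
         ((F2 - F2') + sg * (rate r * (F1 - F1') + rate' r * (U - U'))) by ring;
        set (q1 := F1 - F1') in *; set (q2 := F2 - F2') in *; set (qu := U - U') in * end.
      eapply Rle_trans; [apply Rabs_triang|]. rewrite (Rabs_mult sg).
      assert (Q1 : Rabs (rate r * q1 + rate' r * qu) <= rate0 * (A * ((/ km + 1) * D)) + rate0 * (/ km * D)).
      { eapply Rle_trans; [apply Rabs_triang|]. rewrite !Rabs_mult, (Rabs_pos_eq (rate r)) by lra.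
        apply Rplus_le_compat; apply Rmult_le_compat; try apply Rabs_pos; lra. }
      assert (Q2 : Rabs sg * Rabs (rate r * q1 + rate' r * qu) <= Rabs (rate r * q1 + rate' r * qu)).
      { rewrite <- (Rmult_1_l (Rabs (rate r * q1 + rate' r * qu))) at 2. apply Rmult_le_compat_r; [apply Rabs_pos|exact Hsg]. }
      assert (0 <= rate0 * D) by (apply Rmult_le_pos; lra). unfold L. lra. }
    assert (DP : rate r * Rabs (cP - cP') <= rate0 * D).
    { apply Rmult_le_compat; try apply Rabs_pos; try lra. unfold D. generalize (Rabs_pos (Q - Q')). lra. }
    assert (DQ : rate r * Rabs (cQ - cQ') <= rate0 * D).
    { apply Rmult_le_compat; try apply Rabs_pos; try lra. unfold D. generalize (Rabs_pos (P - P')). lra. }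
    assert (DP0 : rate r * Rabs (P - P') <= rate0 * D).
    { apply Rmult_le_compat; try apply Rabs_pos; try lra. unfold D. generalize (Rabs_pos (Q - Q')). lra. }
    assert (DQ0 : rate r * Rabs (Q - Q') <= rate0 * D).
    { apply Rmult_le_compat; try apply Rabs_pos; try lra. unfold D. generalize (Rabs_pos (P - P')). lra. }
    unfold clampedP, clampedQ. fold r. fold cP cQ cP' cQ'. fold D.
    assert (T3 : forall x y z, Rabs (x + y + z) <= Rabs x + Rabs y + Rabs z).
    { intros. eapply Rle_trans; [apply Rabs_triang|]. apply Rplus_le_compat_r, Rabs_triang. }
    split.
    + match goal with |- Rabs ?E <= _ => replace E with (rate r * (P - P') + (pq_dot 1 base_order r cP cQ - pq_dot 1 base_order r cP' cQ') + - (rate r * (cP - cP'))) by ring end.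
      eapply Rle_trans; [apply T3|]. rewrite Rabs_Ropp, !Rabs_mult, (Rabs_pos_eq (rate r)) by lra.
      generalize (Dv 1 ltac:(rewrite Rabs_R1; lra)). lra.
    + match goal with |- Rabs ?E <= _ => replace E with (- (rate r * (Q - Q')) + (pq_dot (-1) base_order r cP cQ - pq_dot (-1) base_order r cP' cQ') + rate r * (cQ - cQ')) by ring end.
      eapply Rle_trans; [apply T3|]. rewrite Rabs_Ropp, !Rabs_mult, (Rabs_pos_eq (rate r)) by lra.
      generalize (Dv (-1) ltac:(rewrite Rabs_left; lra)). lra.
Qed.

(** Q cannot leave the tube, and P cannot return to it. Shooting for P = 0 at time T gives an
    initial point whose trajectory is in the tube up to T. *)
Theorem saddle_solution : expanding_solution p f1 f2 a b.
Proof.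
  assert (Hp := ds_p_pos).
  destruct (at_infty_from _ (at_infty_good)) as (t0 & Ht0 & Hgood).
  set (g1 := clampedP t0). set (g2 := clampedQ t0).
  assert (Hrf : regular_field g1 g2) by (apply (saddle_regular); [lra|exact Hgood]).
  set (tube' := fun t => - (INR tube_order / INR p) * sv p t ^ (tube_order + p)).
  assert (Hrho : forall t, 0 < t -> is_derive tube t (tube' t)) by (intros; apply is_derive_svpow; auto).
  assert (Hrp : forall t, 0 < tube t) by (intros; apply tube_pos).
  assert (Hr' : forall t, t0 <= t -> tube' t <= 0 /\ - tube' t < rate t / 2 * tube t).
  { intros t Ht. destruct (Hgood t Ht) as (_ & _ & G3 & _). unfold tube'.
    assert (0 <= INR tube_order / INR p * sv p t ^ (tube_order + p)).
    { apply Rmult_le_pos; [apply Rdiv_le_0_compat; [apply pos_INR|apply lt_0_INR; exact Hp]|apply pow_le, Rlt_le, sv_pos]. }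
    split; lra. }
  assert (Hg : forall t P Q, t0 <= t -> Rabs (g1 t P Q - rate t * P) <= rate t / 2 * tube t /\ Rabs (g2 t P Q + rate t * Q) <= rate t / 2 * tube t).
  { intros t P Q Ht. destruct (Hgood t Ht) as (_ & G2 & _). unfold g1, g2, clampedP, clampedQ. rewrite Rmax_left by lra.
    destruct (G2 (clamp (tube t) P) (clamp (tube t) Q)) as [A B]; try (apply clamp_bound, Rlt_le, Hrp).
    split.
    - match goal with |- Rabs ?E <= _ => match type of A with Rabs ?F <= _ => replace E with F by ring end end. exact A.
    - match goal with |- Rabs ?E <= _ => match type of B with Rabs ?F <= _ => replace E with F by ring end end. exact B. }
  assert (Hkr : forall t, 0 < rate t * tube t) by (intros; apply Rmult_lt_0_compat; [apply (rate_pos)|apply Hrp]).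
  assert (Hup : forall P Q, ode_solution g1 g2 P Q -> forall t1 T, t0 <= t1 <= T -> tube t1 <= P t1 -> tube T <= P T).
  { intros P Q Hs t1 T HT H1.
    assert (B := barrier (fun t => tube t - P t) (fun t => tube' t - g1 t (P t) (Q t)) t1 T).
    assert (tube T - P T <= 0); [|lra]. apply B; [| |lra|lra].
    - intros t Ht. apply (is_derive_minus tube P); [apply Hrho; lra|apply Hs].
    - intros t Ht E. destruct (Hg t (P t) (Q t) ltac:(lra)) as [A _]. apply Rabs_le_between in A.
      destruct (Hr' t ltac:(lra)) as [R1 _]. replace (rate t * P t) with (rate t * tube t) in A by (replace (P t) with (tube t) by lra; ring). generalize (Hkr t). lra. }
  assert (Hdown : forall P Q, ode_solution g1 g2 P Q -> forall t1 T, t0 <= t1 <= T -> P t1 <= - tube t1 -> P T <= - tube T).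
  { intros P Q Hs t1 T HT H1.
    assert (B := barrier (fun t => tube t + P t) (fun t => tube' t + g1 t (P t) (Q t)) t1 T).
    assert (tube T + P T <= 0); [|lra]. apply B; [| |lra|lra].
    - intros t Ht. apply (is_derive_plus tube P); [apply Hrho; lra|apply Hs].
    - intros t Ht E. destruct (Hg t (P t) (Q t) ltac:(lra)) as [A _]. apply Rabs_le_between in A.
      destruct (Hr' t ltac:(lra)) as [R1 _]. replace (rate t * P t) with (- (rate t * tube t)) in A by (replace (P t) with (- tube t) by lra; ring).
      generalize (Hkr t). lra. }
  assert (HQ : forall P Q, ode_solution g1 g2 P Q -> Q t0 = 0 -> forall t, t0 <= t -> Rabs (Q t) <= tube t).
  { intros P Q Hs H0 t Ht. apply Rabs_le. split.
    - assert (B := barrier (fun t => - Q t - tube t) (fun t => - g2 t (P t) (Q t) - tube' t) t0 t).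
      assert (- Q t - tube t <= 0); [|lra]. apply B; [| |generalize (Hrp t0); lra|lra].
      + intros r Hr. apply (is_derive_minus (fun t => - Q t) tube); [|apply Hrho; lra]. apply (is_derive_opp Q). apply Hs.
      + intros r Hr E. destruct (Hg r (P r) (Q r) ltac:(lra)) as [_ A]. apply Rabs_le_between in A.
        destruct (Hr' r ltac:(lra)) as [_ R1]. replace (rate r * Q r) with (- (rate r * tube r)) in A by (replace (Q r) with (- tube r) by lra; ring).
        generalize (Hkr r). lra.
    - assert (B := barrier (fun t => Q t - tube t) (fun t => g2 t (P t) (Q t) - tube' t) t0 t).
      assert (Q t - tube t <= 0); [|lra]. apply B; [| |generalize (Hrp t0); lra|lra].
      + intros r Hr. apply (is_derive_minus Q tube); [apply Hs|apply Hrho; lra].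
      + intros r Hr E. destruct (Hg r (P r) (Q r) ltac:(lra)) as [_ A]. apply Rabs_le_between in A.
        destruct (Hr' r ltac:(lra)) as [_ R1]. replace (rate r * Q r) with (rate r * tube r) in A by (replace (Q r) with (tube r) by lra; ring).
        generalize (Hkr r). lra. }
  set (Tube := fun t P Q => Rabs P <= tube t /\ Rabs Q <= tube t).
  assert (Hstay : exists P Q, ode_solution g1 g2 P Q /\ forall t, t0 <= t -> Tube t (P t) (Q t)).
  { apply (stay_forever g1 g2 Tube t0 (tube t0) Hrf).
    - intros t P Q Hn.
      assert (Hopen : forall A C, 0 < A * Q ^ 2 + C * P ^ 2 - tube t ^ 2 ->
        exists d, 0 < d /\ forall P' Q', (P' - P) ^ 2 + (Q' - Q) ^ 2 < d -> 0 < A * Q' ^ 2 + C * P' ^ 2 - tube t ^ 2).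
      { intros A C H. destruct (open_pos (fun x y => A * (y - 0) ^ 2 + 0 * ((x - 0) * (y - 0)) + C * (x - 0) ^ 2 - tube t ^ 2) P Q) as (d & Hd & HO).
        - apply (continuous_quadratic A 0 C 0 0 (tube t ^ 2) (P, Q)).
        - replace (A * (Q - 0) ^ 2 + 0 * ((P - 0) * (Q - 0)) + C * (P - 0) ^ 2 - tube t ^ 2) with (A * Q ^ 2 + C * P ^ 2 - tube t ^ 2) by ring. exact H.
        - exists d. split; [exact Hd|]. intros P' Q' HPQ. specialize (HO P' Q' HPQ).
          replace (A * Q' ^ 2 + C * P' ^ 2 - tube t ^ 2) with (A * (Q' - 0) ^ 2 + 0 * ((P' - 0) * (Q' - 0)) + C * (P' - 0) ^ 2 - tube t ^ 2) by ring. exact HO. }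
      assert (Hsq : forall z, tube t < Rabs z -> 0 < z ^ 2 - tube t ^ 2).
      { intros z Hz. rewrite <- (pow2_abs z). generalize (Hrp t). nra. }
      assert (Hsq' : forall z, 0 < z ^ 2 - tube t ^ 2 -> ~ Rabs z <= tube t).
      { intros z Hz Hle. rewrite <- (pow2_abs z) in Hz. generalize (Hrp t) (Rabs_pos z). nra. }
      destruct (Rlt_le_dec (tube t) (Rabs P)) as [HP|HP].
      + destruct (Hopen 0 1) as (d & Hd & HO); [generalize (Hsq _ HP); lra|].
        exists d. split; [exact Hd|]. intros P' Q' HPQ [HT _]. apply (Hsq' P'); [|exact HT]. generalize (HO P' Q' HPQ). lra.
      + destruct (Rlt_le_dec (tube t) (Rabs Q)) as [HQ1|HQ1]; [|elim Hn; split; assumption].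
        destruct (Hopen 1 0) as (d & Hd & HO); [generalize (Hsq _ HQ1); lra|].
        exists d. split; [exact Hd|]. intros P' Q' HPQ [_ HT]. apply (Hsq' Q'); [|exact HT]. generalize (HO P' Q' HPQ). lra.
    - intros T HT.
      destruct (shooting g1 g2 t0 T (tube t0) Hrf HT (Rlt_le _ _ (Hrp t0))) as (P & Q & Hs & H1 & H2 & H3).
      + intros P Q Hs H. generalize (Hup P Q Hs t0 T ltac:(lra) H) (Hrp T). lra.
      + intros P Q Hs H. generalize (Hdown P Q Hs t0 T ltac:(lra) H) (Hrp T). lra.
      + exists P, Q. split; [exact Hs|]. split; [exact H1|]. split; [rewrite H2, Rabs_R0; apply Rlt_le, Hrp|].
        intros t Ht. split; [|apply (HQ P Q Hs H2); lra]. apply Rabs_le. split.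
        * apply Rnot_lt_le. intros Hlt. generalize (Hdown P Q Hs t T ltac:(lra) ltac:(lra)) (Hrp T). lra.
        * apply Rnot_lt_le. intros Hlt. generalize (Hup P Q Hs t T ltac:(lra) ltac:(lra)) (Hrp T). lra. }
  destruct Hstay as (P & Q & Hs & Hin).
  set (x := fun t => spoly a base_order (sv p t) + u_of t (P t) (Q t)). set (y := fun t => spoly b base_order (sv p t) + v_of (P t) (Q t)).
  assert (Hsol : forall t, t0 < t -> is_derive x t (f1 (x t) (y t) t) /\ is_derive y t (f2 (x t) (y t) t)).
  { intros t Ht. destruct (Hin t ltac:(lra)) as [T1 T2]. destruct (Hs t) as [DP DQ].
    assert (Hk := rate_pos t).
    assert (E1 : g1 t (P t) (Q t) = pq_dot 1 base_order t (P t) (Q t)).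
    { unfold g1, clampedP. rewrite Rmax_left, !clamp_id by (assumption || lra). ring. }
    assert (E2 : g2 t (P t) (Q t) = pq_dot (-1) base_order t (P t) (Q t)).
    { unfold g2, clampedQ. rewrite Rmax_left, !clamp_id by (assumption || lra). ring. }
    rewrite E1 in DP. rewrite E2 in DQ. unfold pq_dot, udot, vdot in DP, DQ. fold (x t) (y t) in DP, DQ.
    set (X' := Derive (fun t => spoly a base_order (sv p t)) t) in *. set (Y' := Derive (fun t => spoly b base_order (sv p t)) t) in *.
    set (u := u_of t (P t) (Q t)) in *.
    split.
    - evar_last.
      + apply (is_derive_plus (fun t => spoly a base_order (sv p t)) (fun t => u_of t (P t) (Q t))); [apply (ds_dX); lra|].
        apply (is_derive_div (fun t => P t - Q t) (fun t => 2 * rate t)).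
        * apply (is_derive_minus P Q); [exact DP|exact DQ].
        * apply (is_derive_scal rate). apply (is_derive_rate). lra.
        * lra.
      + fold X'. change (P t - Q t) with (P t - Q t). unfold plus, minus, opp, plus; simpl.
        replace (P t - Q t) with (2 * rate t * u) by (unfold u, u_of; field; lra). field. lra.
    - evar_last.
      + apply (is_derive_plus (fun t => spoly b base_order (sv p t)) (fun t => v_of (P t) (Q t))); [apply (ds_dY); lra|].
        apply (is_derive_ext (fun t => / 2 * (P t + Q t)));
          [intros r; unfold v_of, Rdiv; apply Rmult_comm|].
        apply (is_derive_scal (fun t => P t + Q t)). apply (is_derive_plus P Q); [exact DP|exact DQ].
      + fold Y'. unfold plus; simpl. field. }
  exists t0, x, y. split; [lra|]. split; [exact Hsol|].
  apply (all_orders p (p + nu + 2) (base_order + p + 2)); [exact Hp|]. intros N' HN'.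
  assert (Hthin : forall t, t0 < t -> Rabs (x t - spoly a base_order (sv p t)) <= sv p t ^ (p + 2 * nu + 3) /\
                                      Rabs (y t - spoly b base_order (sv p t)) <= sv p t ^ (p + 2 * nu + 3)).
  { intros t Ht. destruct (Hin t ltac:(lra)) as [T1 T2]. destruct (Hgood t ltac:(lra)) as (_ & _ & _ & _ & _ & G6).
    unfold x, y. replace (spoly a base_order (sv p t) + u_of t (P t) (Q t) - spoly a base_order (sv p t)) with (u_of t (P t) (Q t)) by ring.
    replace (spoly b base_order (sv p t) + v_of (P t) (Q t) - spoly b base_order (sv p t)) with (v_of (P t) (Q t)) by ring. apply G6; assumption. }
  apply (saddle_bootstrap base_order (p + 2 * nu + 3) t0); auto; try lra.
  - unfold base_order, tube_order. lia.
  - exists 1. split; [lra|]. exists t0. intros t Ht. rewrite Rmult_1_l. apply Hthin, Ht.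
  - exists 1. split; [lra|]. exists t0. intros t Ht. rewrite Rmult_1_l. apply Hthin, Ht.
Qed.

End Saddle.
End Deviation.

(** * The perturbed system *)

Lemma even_sum_psum q c J t x y : (0 < q)%nat ->
  even_sum c J (sv (2 * q) t) x y = c 0%nat x y + psum q 1 (fun k => c k x y) J t.
Proof.
  intros Hq. induction J as [|J IH].
  - rewrite even_sum_0. unfold psum. rewrite sum_n_m_zero by lia. symmetry. apply Rplus_0_r.
  - rewrite even_sum_S, IH. unfold psum. rewrite (sum_n_Sm _ 1 J) by lia. rewrite npow_sv, <- (sv_double q t Hq), <- pow_mult.
    symmetry. apply Rplus_assoc || (rewrite Rplus_assoc; reflexivity).
Qed.

Lemma approx_of_expansion q c0 c f : (0 < q)%nat -> uniform_expansion q c f ->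
  (forall k x y, (1 <= k)%nat -> c0 k x y = c k x y) ->
  approx (2 * q) c0 (fun x y t => c0 0%nat x y + f x y t).
Proof.
  intros Hq Hf Hc J. exists 1. split; [lra|].
  generalize (Hf J 1 1 Rlt_0_1). apply filter_imp. intros t Ht x y Hx Hy. specialize (Ht x y Hx Hy).
  rewrite (even_sum_psum q c0 J t x y Hq).
  assert (E : psum q 1 (fun k => c0 k x y) J t = psum q 1 (fun k => c k x y) J t).
  { unfold psum. apply sum_n_m_ext_loc. intros k Hk. rewrite Hc by lia. reflexivity. }
  rewrite E. rewrite npow_sv, <- (sv_double q t Hq), <- pow_mult in Ht.
  match goal with |- Rabs ?A <= _ => replace A with (f x y t - psum q 1 (fun k => c k x y) J t) by ring end. exact Ht.
Qed.

Lemma branch_solution q n nu m0 w0 cF cG f1 f2 : (0 < q)%nat ->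
  expanded_field (2 * q) n nu m0 w0 cF cG f1 f2 ->
  exists t0 x y a b, 0 < t0 /\
    (forall t, t0 < t -> is_derive x t (f1 (x t) (y t) t) /\ is_derive y t (f2 (x t) (y t) t)) /\
    expansion (2 * q) nu a x /\ expansion (2 * q) (2 * n) b y /\
    (forall N, is_domin (Rbar_locally p_infty) (npow (2 * q) N)
        (fun t => Derive (psum (2 * q) nu a N) t - f1 (psum (2 * q) nu a N t) (psum (2 * q) (2 * n) b N t) t) /\
      is_domin (Rbar_locally p_infty) (npow (2 * q) N)
        (fun t => Derive (psum (2 * q) (2 * n) b N) t - f2 (psum (2 * q) nu a N t) (psum (2 * q) (2 * n) b N t) t)) /\
    a nu = m0 /\ bigO (2 * q) (S nu) (fun t => x t - m0 * sv (2 * q) t ^ nu).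
Proof.
  intros Hq EF. assert (Hp := ef_p_pos EF).
  destruct (formal_series EF) as (a & b & Ha & Hb & Han & HR).
  destruct (deviation_exists _ _ _ _ _ _ _ _ _ a b EF Ha Hb Han HR) as (al & be & ka & de & DS).
  assert (Hsol : expanding_solution (2 * q) f1 f2 a b).
  { assert (Hm0 := ef_m0 EF). assert (Hw0 := ef_w0 EF).
    destruct (Rlt_le_dec 0 m0) as [Hpos|Hneg].
    - apply (oscillating_solution DS). apply Rmult_lt_0_compat; lra.
    - apply (saddle_solution DS). assert (0 < w0 * - m0) by (apply Rmult_lt_0_compat; lra). lra. }
  destruct Hsol as (t0 & x & y & Ht0 & Hs & HN).
  assert (EA : forall N t, psum (2 * q) nu a N t = spoly a N (sv (2 * q) t)) by (intros; apply spoly_psum, Ha).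
  assert (EB : forall N t, psum (2 * q) (2 * n) b N t = spoly b N (sv (2 * q) t)) by (intros; apply spoly_psum, Hb).
  exists t0, x, y, a, b. split; [exact Ht0|]. split; [exact Hs|].
  split; [|split; [|split; [|split; [exact Han|]]]].
  - intros N. apply bigO_domin; [exact Hp|]. destruct (HN N) as [H _]. revert H. apply bigO_ext'. intros t. rewrite EA. reflexivity.
  - intros N. apply bigO_domin; [exact Hp|]. destruct (HN N) as [_ H]. revert H. apply bigO_ext'. intros t. rewrite EB. reflexivity.
  - intros N. destruct (HR N) as [H1 H2]. split; apply bigO_domin; try exact Hp.
    + revert H1. apply bigO_ext'. intros t. unfold residual. rewrite EA, EB. f_equal. apply Derive_ext. intros; symmetry; apply EA.
    + revert H2. apply bigO_ext'. intros t. unfold residual. rewrite EA, EB. f_equal. apply Derive_ext. intros; symmetry; apply EB.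
  - destruct (HN nu) as [H _]. revert H. apply bigO_ext'. intros t. f_equal.
    destruct EF as [Hn Hnu1 _ _ _ _ _ _ _ _ _ _ _ _ _ _ _ _ _ _ _ _].
    destruct nu as [|v] eqn:Ev; [lia|]. rewrite spoly_S, Han, spoly_low; [ring|]. intros k Hk. apply Ha. lia.
Qed.

(** The smoothness of w at 0 is not visible in x^2 w(x), but it is in the force at lam = -1, which
    is (x^2 + 1) w(x). *)
Lemma force_bounds (H : R -> R -> R -> R) (V : R -> R -> R) (w : R -> R) :
  smooth3 (fun _ _ _ => True) H -> (forall x y lam, H x y lam = y ^ 2 / 2 + V x lam) ->
  (forall x lam, is_derive (fun u => V u lam) x ((x ^ 2 - lam) * w x)) ->
  (forall x y lam, Derive (fun u => H u y lam) x = (x ^ 2 - lam) * w x) /\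
  exists w' C, 0 <= C /\ (forall x, is_derive w x (w' x)) /\
   (forall x, Rabs x <= 1 -> Rabs (w x - w 0) <= C * Rabs x) /\ (forall x, Rabs x <= 1 -> Rabs (w' x) <= C).
Proof.
  intros Hs HH HV.
  assert (HD : forall x y lam, Derive (fun u => H u y lam) x = (x ^ 2 - lam) * w x).
  { intros x y lam. apply is_derive_unique. apply (is_derive_ext (fun u => y ^ 2 / 2 + V u lam)); [intros; symmetry; apply HH|].
    evar_last; [apply (is_derive_plus (fun _ => y ^ 2 / 2) (fun u => V u lam)); [apply @is_derive_const|apply HV]|].
    apply @plus_zero_l. }
  split; [exact HD|].
  set (gg := fun x y : R => Derive (fun u => H u y (-1)) x).
  assert (Hgs : smooth2 gg).
  { intros k. destruct (Hs (S k)) as (_ & _ & HX & _). apply (C3_slice k _ (-1) HX). }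
  set (g := fun x => gg x 0). set (g' := fun x => Derive g x).
  assert (Eg : forall x, g x = (x ^ 2 + 1) * w x) by (intros x; unfold g, gg; rewrite HD; ring).
  assert (Hg : forall x, is_derive g x (g' x)).
  { intros x. apply Derive_correct. destruct (Hgs 1%nat) as (_ & D & _). apply (D x 0). }
  destruct (C2_lip gg (Hgs 1%nat)) as (L & HL & HLip).
  destruct (C2_bounded _ (Hgs 0%nat)) as (B & HB & HBd).
  destruct (C2_bounded _ (smooth2_dX _ Hgs 0%nat)) as (B' & HB' & HBd').
  assert (Z0 : Rabs 0 <= 1) by (rewrite Rabs_R0; lra).
  assert (Hden : forall x, 1 <= x ^ 2 + 1) by (intros x; generalize (pow2_ge_0 x); lra).
  assert (Ew : forall x, w x = g x / (x ^ 2 + 1)) by (intros x; rewrite Eg; field; generalize (Hden x); lra).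
  exists (fun x => (g' x * (x ^ 2 + 1) - g x * (2 * x)) / (x ^ 2 + 1) ^ 2), (L + Rabs (g 0) + (2 * B' + 2 * B)).
  split; [generalize (Rabs_pos (g 0)); lra|]. split; [|split].
  - intros x. apply (is_derive_ext (fun x => g x / (x ^ 2 + 1))); [intros; symmetry; apply Ew|].
    apply (is_derive_div g (fun x => x ^ 2 + 1)); [apply Hg| |generalize (Hden x); lra].
    auto_derive; [exact I|ring].
  - intros x Hx. rewrite !Ew. replace (g x / (x ^ 2 + 1) - g 0 / (0 ^ 2 + 1)) with ((g x - g 0 - g 0 * (x * x)) / (x ^ 2 + 1))
      by (field; generalize (Hden x); lra).
    unfold Rdiv. rewrite Rabs_mult, (Rabs_pos_eq (/ (x ^ 2 + 1))) by (apply Rlt_le, Rinv_0_lt_compat; generalize (Hden x); lra).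
    assert (I1 : / (x ^ 2 + 1) <= 1) by (apply Rle_trans with (/ 1); [apply Rinv_le_contravar; [lra|apply Hden]|rewrite Rinv_1; lra]).
    assert (K1 : Rabs (g x - g 0) <= L * Rabs x).
    { generalize (HLip x 0 0 0 Hx Z0 Z0 Z0). rewrite !Rminus_0_r, Rabs_R0, Rplus_0_r. auto. }
    assert (K2 : Rabs (g 0 * (x * x)) <= Rabs (g 0) * Rabs x).
    { rewrite Rabs_mult. apply Rmult_le_compat_l; [apply Rabs_pos|]. rewrite Rabs_mult. generalize (Rabs_pos x). nra. }
    assert (K3 : Rabs (g x - g 0 - g 0 * (x * x)) <= (L + Rabs (g 0)) * Rabs x).
    { unfold Rminus at 1. eapply Rle_trans; [apply Rabs_triang|]. rewrite Rabs_Ropp. lra. }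
    apply Rle_trans with (Rabs (g x - g 0 - g 0 * (x * x)) * 1); [apply Rmult_le_compat_l; [apply Rabs_pos|exact I1]|].
    assert (0 <= (2 * B' + 2 * B) * Rabs x) by (apply Rmult_le_pos; [lra|apply Rabs_pos]). lra.
  - intros x Hx. assert (D2 := Hden x).
    unfold Rdiv. rewrite Rabs_mult, (Rabs_pos_eq (/ (x ^ 2 + 1) ^ 2)) by (apply Rlt_le, Rinv_0_lt_compat, pow_lt; lra).
    assert (I1 : / (x ^ 2 + 1) ^ 2 <= 1).
    { apply Rle_trans with (/ 1); [apply Rinv_le_contravar; [lra|nra]|rewrite Rinv_1; lra]. }
    assert (K1 : Rabs (g' x * (x ^ 2 + 1) - g x * (2 * x)) <= 2 * B' + 2 * B).
    { unfold Rminus. eapply Rle_trans; [apply Rabs_triang|]. rewrite Rabs_Ropp, !Rabs_mult.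
      assert (Rabs (g' x) <= B') by apply (HBd' x 0 Hx Z0). assert (Rabs (g x) <= B) by apply (HBd x 0 Hx Z0).
      assert (x ^ 2 <= 1) by (rewrite <- pow2_abs; generalize (Rabs_pos x); nra).
      rewrite (Rabs_pos_eq (x ^ 2 + 1)), (Rabs_pos_eq 2) by lra.
      apply Rplus_le_compat.
      - rewrite (Rmult_comm 2). apply Rmult_le_compat; try apply Rabs_pos; lra.
      - rewrite (Rmult_comm 2 B). apply Rmult_le_compat; try apply Rabs_pos; try lra. generalize (Rabs_pos x). lra. }
    apply Rle_trans with (Rabs (g' x * (x ^ 2 + 1) - g x * (2 * x)) * 1); [apply Rmult_le_compat_l; [apply Rabs_pos|exact I1]|].
    generalize (Rabs_pos (g 0)). lra.
Qed.

Theorem theorem2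
  (H F G : R -> R -> R -> R) (V : R -> R -> R) (w : R -> R) (d0 : R)
  (q : nat) (Fk Gk : nat -> R -> R -> R)
  (H_smooth : smooth3 (fun _ _ _ => True) H)
  (F_smooth : smooth3 (fun _ _ t => 0 < t) F)
  (G_smooth : smooth3 (fun _ _ t => 0 < t) G)
  (H_def : forall x y lam, H x y lam = y ^ 2 / 2 + V x lam)
  (V_derive : forall x lam,
     is_derive (fun u => V u lam) x ((x ^ 2 - lam) * w x))
  (d0_pos : 0 < d0)
  (w_pos : forall x lam,
     (Rabs x < sqrt lam + d0 /\ 0 <= lam) \/ (Rabs x < d0 /\ lam < 0) -> 0 < w x)
  (F_vanishes : vanishes F)
  (G_vanishes : vanishes G)
  (q_pos : (0 < q)%nat)
  (Fk_smooth : forall k, (1 <= k)%nat -> smooth2 (Fk k))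
  (Gk_smooth : forall k, (1 <= k)%nat -> smooth2 (Gk k))
  (F_expansion : uniform_expansion q Fk F)
  (G_expansion : uniform_expansion q Gk G)
  (lam : R) (lam_eq : lam = 0)
  (n m : nat) (n_range : (1 <= n <= q)%nat) (m_range : (0 <= m < n)%nat)
  (FG_zero : forall i, (1 <= i < n)%nat ->
     forall x y, Fk i x y = 0 /\ Gk i x y = 0)
  (G_lead_neq0 : Gk (n + m)%nat 0 0 <> 0)
  (G_lower : forall l, (0 <= l < m)%nat -> Gk (n + l)%nat 0 0 = 0)
  (G_lead_pos : 0 < Gk (n + m)%nat 0 0) :
  let mu := sqrt (Gk (n + m)%nat 0 0 / w 0) in
  exists (t0 : R) (x1 y1 x2 y2 : R -> R) (a1 b1 a2 b2 : nat -> R),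
    0 < t0 /\
    (is_solution H F G lam t0 x1 y1 /\
     expansion (2 * q) (n + m) a1 x1 /\
     expansion (2 * q) (2 * n) b1 y1 /\
     formal_solution H F G lam (2 * q) (n + m) (2 * n) a1 b1 /\
     a1 (n + m)%nat = mu) /\
    (is_solution H F G lam t0 x2 y2 /\
     expansion (2 * q) (n + m) a2 x2 /\
     expansion (2 * q) (2 * n) b2 y2 /\
     formal_solution H F G lam (2 * q) (n + m) (2 * n) a2 b2 /\
     a2 (n + m)%nat = - mu) /\
    (exists t, t0 < t /\ (x1 t, y1 t) <> (x2 t, y2 t)).
Proof.
  intros mu. subst lam.
  assert (Hw0 : 0 < w 0).
  { apply (w_pos 0 0). left. rewrite Rabs_R0, sqrt_0. lra. }
  assert (Hmu : 0 < mu) by (apply sqrt_lt_R0, Rdiv_lt_0_compat; assumption).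
  assert (Hmu2 : mu ^ 2 * w 0 = Gk (n + m)%nat 0 0).
  { unfold mu. rewrite pow2_sqrt by (apply Rlt_le, Rdiv_lt_0_compat; assumption). field. lra. }
  destruct (force_bounds H V w H_smooth H_def V_derive) as (HD & w' & Cw & HCw & Hw' & Hwl & Hwb).
  (* the unperturbed field becomes the term k = 0 *)
  set (cF := fun k => match k with O => fun _ y : R => y | S _ => Fk k end).
  set (cG := fun k => match k with O => fun x y : R => - Derive (fun u => H u y 0) x | S _ => Gk k end).
  assert (HHy : forall x y, Derive (fun v => H x v 0) y = y).
  { intros x y. rewrite (Derive_ext _ (fun v => v ^ 2 / 2 + V x 0)) by (intros; apply H_def).
    apply is_derive_unique. auto_derive; [exact I|field]. }
  assert (EF : forall m0, m0 ^ 2 = mu ^ 2 -> m0 <> 0 ->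
     expanded_field (2 * q) n (n + m) m0 (w 0) cF cG (field_x H F 0) (field_y H G 0)).
  { intros m0 Hm Hm0. constructor; try lia; try assumption.
    - intros [|k]; [intros j; apply C2_snd|apply Fk_smooth; lia].
    - intros [|k]; [|apply Gk_smooth; lia]. intros j. apply (C2_opp j (fun x y => Derive (fun u => H u y 0) x)).
      destruct (H_smooth (S j)) as (_ & _ & HX & _). apply (C3_slice j _ 0 HX).
    - intros [|k] Hk x y; [lia|]. apply FG_zero. lia.
    - intros [|k] Hk x y; [lia|]. apply FG_zero. lia.
    - reflexivity.
    - intros x y. simpl. rewrite !HD. reflexivity.
    - exists Cw. split; [exact HCw|]. intros x y Hx Hy. simpl. rewrite HD.
      replace (- ((x ^ 2 - 0) * w x) + w 0 * (x * (x * 1))) with (- (x ^ 2 * (w x - w 0))) by ring.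
      rewrite Rabs_Ropp, Rabs_mult, <- RPow_abs. replace (Cw * (Rabs x * (Rabs x * (Rabs x * 1)))) with (Rabs x ^ 2 * (Cw * Rabs x)) by ring.
      apply Rmult_le_compat_l; [apply pow_le, Rabs_pos|apply Hwl, Hx].
    - exists (3 * Cw). split; [lra|]. intros x y Hx Hy. simpl.
      assert (E : Derive (fun u => - Derive (fun v => H v y 0) u) x = - (2 * x * w x + x ^ 2 * w' x)).
      { apply is_derive_unique. apply (is_derive_ext (fun u => - (u ^ 2 * w u))).
        - intros u. rewrite HD. simpl. ring.
        - apply (is_derive_opp (fun u => u ^ 2 * w u)). evar_last.
          + apply (is_derive_mult (fun u => u ^ 2) w); [apply is_derive_pow, is_derive_id|apply Hw'|intros; apply Rmult_comm].
          + unfold plus, mult, one; simpl. ring. }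
      rewrite E. replace (- (2 * x * w x + x ^ 2 * w' x) + 2 * w 0 * x) with (- (2 * x * (w x - w 0) + x ^ 2 * w' x)) by ring.
      rewrite Rabs_Ropp. eapply Rle_trans; [apply Rabs_triang|]. rewrite !Rabs_mult, <- RPow_abs, (Rabs_pos_eq 2) by lra.
      specialize (Hwl x Hx). specialize (Hwb x Hx). assert (X0 := Rabs_pos x).
      assert (2 * Rabs x * Rabs (w x - w 0) <= 2 * Rabs x * (Cw * Rabs x)) by (apply Rmult_le_compat_l; lra).
      assert (Rabs x ^ 2 * Rabs (w' x) <= Rabs x ^ 2 * Cw) by (apply Rmult_le_compat_l; [apply pow_le|]; lra).
      simpl in *. lra.
    - intros [|k] Hk; [lia|]. simpl. destruct (Nat.lt_ge_cases (S k) n) as [Hlt|Hge].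
      + apply FG_zero. lia.
      + replace (S k) with (n + (S k - n))%nat by lia. apply G_lower. lia.
    - rewrite Hm, Hmu2. unfold cG. destruct (n + m)%nat eqn:E; [lia|reflexivity].
    - assert (A : approx (2 * q) cF (fun x y t => cF 0%nat x y + F x y t)).
      { apply (approx_of_expansion q cF Fk F q_pos F_expansion). intros [|k] x y Hk; [lia|reflexivity]. }
      intros J. destruct (A J) as (C & HC & K). exists C. split; [exact HC|]. revert K. apply filter_imp. intros t Ht x y Hx Hy.
      unfold field_x. rewrite HHy. apply Ht; assumption.
    - assert (A : approx (2 * q) cG (fun x y t => cG 0%nat x y + G x y t)).
      { apply (approx_of_expansion q cG Gk G q_pos G_expansion). intros [|k] x y Hk; [lia|reflexivity]. }
      intros J. destruct (A J) as (C & HC & K). exists C. split; [exact HC|]. revert K. apply filter_imp. intros t Ht x y Hx Hy.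
      apply Ht; assumption.
    - intros T0 T1 HT. destruct (C3_lip F (F_smooth 1%nat) T0 T1 HT) as (C & HC & K). exists (C + 1). split; [lra|].
      intros t x y x' y' Ht Hx Hy Hx' Hy'. specialize (K t x y x' y' Ht Hx Hy Hx' Hy'). unfold field_x. rewrite !HHy.
      replace (y + F x y t - (y' + F x' y' t)) with ((y - y') + (F x y t - F x' y' t)) by ring.
      eapply Rle_trans; [apply Rabs_triang|]. generalize (Rabs_pos (x - x')). lra.
    - intros T0 T1 HT. destruct (C3_lip G (G_smooth 1%nat) T0 T1 HT) as (C & HC & K).
      destruct (H_smooth 2%nat) as (_ & _ & HX & _).
      destruct (C2_lip _ (C3_slice 1 _ 0 HX)) as (D & HD0 & L). exists (C + D). split; [lra|].
      intros t x y x' y' Ht Hx Hy Hx' Hy'. specialize (K t x y x' y' Ht Hx Hy Hx' Hy'). specialize (L x y x' y' Hx Hy Hx' Hy').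
      unfold field_y. cbv beta in L.
      match type of L with Rabs (?A - ?B) <= _ => replace (- A + G x y t - (- B + G x' y' t)) with (- (A - B) + (G x y t - G x' y' t)) by ring end.
      eapply Rle_trans; [apply Rabs_triang|]. rewrite Rabs_Ropp. lra.
    - intros x y tau t Hx Hy Ht H0. unfold field_x.
      apply (continuous_ext (fun t => y t + F (x t) (y t) (tau t))); [intros r; rewrite HHy; reflexivity|].
      apply (continuous_plus y (fun t => F (x t) (y t) (tau t))); [exact Hy|]. apply (C3_cont F (F_smooth 0%nat)); assumption.
    - intros x y tau t Hx Hy Ht H0. unfold field_y.
      apply (continuous_plus (fun t => - Derive (fun u => H u (y t) 0) (x t)) (fun t => G (x t) (y t) (tau t))); [|apply (C3_cont G (G_smooth 0%nat)); assumption].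
      apply (continuous_opp (fun t => Derive (fun u => H u (y t) 0) (x t))).
      destruct (H_smooth 1%nat) as (_ & _ & HX & _). destruct (C3_slice 0 (fun x y t => Derive (fun u => H u y t) x) 0 HX) as [Hc _].
      apply (continuous_comp (fun t => (x t, y t)) (fun z : R * R => Derive (fun u => H u (snd z) 0) (fst z))).
      + apply continuous_pair; assumption.
      + apply Hc. }
  destruct (branch_solution q n (n + m) mu (w 0) _ _ _ _ q_pos (EF mu eq_refl (Rgt_not_eq _ _ Hmu)))
    as (t1 & x1 & y1 & a1 & b1 & Ht1 & S1 & X1 & Y1 & Fo1 & A1 & L1).
  destruct (branch_solution q n (n + m) (- mu) (w 0) _ _ _ _ q_pos (EF (- mu) ltac:(ring) ltac:(lra)))
    as (t2 & x2 & y2 & a2 & b2 & Ht2 & S2 & X2 & Y2 & Fo2 & A2 & L2).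
  assert (Hp : (0 < 2 * q)%nat) by lia.
  exists (Rmax t1 t2), x1, y1, x2, y2, a1, b1, a2, b2.
  assert (M1 : t1 <= Rmax t1 t2) by apply Rmax_l. assert (M2 : t2 <= Rmax t1 t2) by apply Rmax_r.
  split; [lra|]. split; [|split].
  - split; [intros t Ht; apply (S1 t); lra|]. split; [exact X1|]. split; [exact Y1|]. split; [exact Fo1|exact A1].
  - split; [intros t Ht; apply (S2 t); lra|]. split; [exact X2|]. split; [exact Y2|]. split; [exact Fo2|exact A2].
  - assert (Hh : 0 < mu / 2) by lra.
    destruct (filter_and _ _ (bigO_small _ _ _ _ Hp Hh L1) (bigO_small _ _ _ _ Hp Hh L2)) as [T HT].
    set (t := Rmax (Rmax t1 t2) T + 1).
    assert (N1 : Rmax t1 t2 <= Rmax (Rmax t1 t2) T) by apply Rmax_l. assert (N2 : T <= Rmax (Rmax t1 t2) T) by apply Rmax_r.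
    exists t. split; [unfold t; lra|]. intros E. injection E as Ex _.
    destruct (HT t ltac:(unfold t; lra)) as [B1 B2]. rewrite Ex in B1.
    apply Rabs_le_between in B1, B2. assert (P : 0 < sv (2 * q) t ^ (n + m)) by apply pow_lt, sv_pos.
    assert (0 < mu * sv (2 * q) t ^ (n + m)) by (apply Rmult_lt_0_compat; assumption). lra.
Qed.
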